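(* Let $H\in(0,1)$. Let $(B(t))_{t\in\mathbb R}$ be a two-sided G-Brownian motion on a sublinear expectation space $(\Omega,\mathcal H,\hat E)$, with $B(1)\sim N(\{0\},[\underline\sigma^2,\overline\sigma^2])$. Then the fractional G-Brownian motion with Hurst index $H$ is represented, for $t\in\mathbb R$, as $$B_H(t,\omega)=C_H^w\int_{\mathbb R}\big[(t-s)_+^{H-1/2}-(-s)_+^{H-1/2}\big]\,dB(s,\omega),\qquad C_H^w=\frac{(2H\sin(\pi H)\,\Gamma(2H))^{1/2}}{\Gamma(H+1/2)},$$ that is, the process defined by the right-hand side is a fractional G-Brownian motion with Hurst index $H$.
   Context: Sublinear expectation space: $\Omega$ is a set, $\mathcal H$ a linear space of real functions on $\Omega$ (random variables) containing constants, stable under $(X_1,\dots,X_n)\mapsto\varphi(X_1,\dots,X_n)$ for $\varphi\in C_{b,Lip}(\mathbb R^n)$, where $C_{b,Lip}(\mathbb R^n)$ here denotes the functions with $|\varphi(x)-\varphi(y)|\le C(1+|x|^m+|y|^m)|x-y|$ for some $C>0$, $m\in\mathbb N$ depending on $\varphi$. The functional $\hat E:\mathcal H\to\mathbb R$ is monotone, constant preserving, sub-additive ($\hat E[X+Y]\le\hat E[X]+\hat E[Y]$) and positively homogeneous. $L^p_G$ is the completion of $\mathcal H$ (modulo $\hat E[|X|^p]=0$) under $\|X\|_p=(\hat E|X|^p)^{1/p}$; $\hat E$ extends continuously to it. $X_1\stackrel d=X_2$ means $\hat E[\varphi(X_1)]=\hat E[\varphi(X_2)]$ for all $\varphi\in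 C_{b,Lip}$. $Y$ is independent of $X$ if $\hat E[\varphi(X,Y)]=\hat E\big[\hat E[\varphi(x,Y)]|_{x=X}\big]$ for all such $\varphi$. $X$ is G-normal distributed if $aX+b\bar X\stackrel d=\sqrt{a^2+b^2}\,X$ for all $a,b\ge0$, with $\bar X$ an independent copy of $X$; we write $X\sim N(\{0\},[\underline\sigma^2,\overline\sigma^2])$ with $\overline\sigma^2=\hat E[X^2]$, $\underline\sigma^2=-\hat E[-X^2]$. Throughout $0\le\underline\sigma\le\overline\sigma$ are constants. G-Brownian motion $(B_t)_{t\ge0}$: $B_0=0$, and for $t,s>0$ the increment $B_{t+s}-B_t$ is $N(\{0\},[s\underline\sigma^2,s\overline\sigma^2])$ distributed and independent of $(B_{t_1},\dots,B_{t_n})$ for all $n$ and $t_1,\dots,t_n\in(0,t]$. Two-sided G-Brownian motion: $B(t)=B^{(1)}(t)$ for $t\ge0$ and $B(t)=B^{(2)}(-t)$ for $t\le0$, with $B^{(1)},B^{(2)}$ two independent G-Brownian motions. For deterministic $f\in L^2(\mathbb R)$, $\int_{\mathbb R}f\,dB$ is the G-Itô integral, i.e. the $L^2_G$-limit of the integrals of step functions. Centered G-Gaussian process: $(X_t)_{t\in\mathbb R}$ such that for each $t$, $X_t$ is G-normal distributed $N(\{0\},[\underline\sigma_t^2,\overline\sigma_t^2])$ for some $0\le\underline\sigma_t\le\overline\sigma_t$. Fractional G-Brownian motion (fGBm) with Hurst index $H\in(0,1)$: a centered G-Gaussian process $(B_H(t))_{t\in\mathbb R}$ with (i) $B_H(0)=0$;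 (ii) for all $s,t\in\mathbb R^+$, $\hat E[B_H(s)B_H(t)]=\tfrac12\overline\sigma^2(|t|^{2H}+|s|^{2H}-|t-s|^{2H})$ and $-\hat E[-B_H(s)B_H(t)]=\tfrac12\underline\sigma^2(|t|^{2H}+|s|^{2H}-|t-s|^{2H})$. Notation: $x_+^{a}=x^a$ if $x>0$ and $0$ otherwise.
   Formalization: G-Brownian motion is taken with increments from t=0 included (so B_s itself is N({0},[sσ_low²,sσ_up²])), not only t>0; otherwise B^(2) could jump at 0+ and the integral against dB would be ill-defined. *)

(* Defs.v *)
From HB Require Import structures.
From mathcomp Require Import all_boot all_order all_algebra.
From mathcomp Require Import all_classical all_reals all_analysis.
From mathcomp Require Import ring lra.

Set Implicit Arguments.
Unset Strict Implicit.
Unset Printing Implicit Defensive.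

Import Order.TTheory GRing.Theory Num.Theory.
Import numFieldNormedType.Exports.

Local Open Scope classical_set_scope.
Local Open Scope ring_scope.

(* Locally Lipschitz functions of polynomial growth.  The library norm on row
   vectors is the sup norm; all norms on R^n give the same class. *)
Definition C_lLip (R : realType) (n : nat) (phi : 'rV[R]_n -> R) : Prop :=
  exists (C : R) (m : nat), 0 < C /\ forall x y : 'rV[R]_n,
    `|phi x - phi y| <= C * (1 + `|x| ^+ m + `|y| ^+ m) * `|x - y|.

Definition vec (R : realType) (T : Type) (n : nat) (X : 'I_n -> T -> R) (w : T)
  : 'rV[R]_n := \row_i X i w.

(* [sl_E] is a function on all of [Omega -> R], but its values outside the
   space of random variables [sl_H] are unconstrained and never used. *)
Record sublinear (R : realType) := Sublinear {
  Omega :> Type ;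
  sl_H : set (Omega -> R) ;
  sl_E : (Omega -> R) -> R ;
  sl_H_cst : forall c : R, sl_H (fun=> c) ;
  sl_H_add : forall X Y, sl_H X -> sl_H Y -> sl_H (fun w => X w + Y w) ;
  sl_H_scale : forall (c : R) X, sl_H X -> sl_H (fun w => c * X w) ;
  sl_H_comp : forall (n : nat) (X : 'I_n -> Omega -> R) (phi : 'rV[R]_n -> R),
    (forall i, sl_H (X i)) -> C_lLip phi -> sl_H (fun w => phi (vec X w)) ;
  sl_E_mono : forall X Y, sl_H X -> sl_H Y ->
    (forall w, X w <= Y w) -> sl_E X <= sl_E Y ;
  sl_E_cst : forall c : R, sl_E (fun=> c) = c ;
  sl_E_add : forall X Y, sl_H X -> sl_H Y ->
    sl_E (fun w => X w + Y w) <= sl_E X + sl_E Y ;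
  sl_E_scale : forall (c : R) X, 0 <= c -> sl_H X ->
    sl_E (fun w => c * X w) = c * sl_E X }.

Arguments sl_H {R} s.
Arguments sl_E {R} s.

(* The distribution of X = (X_1, ..., X_n) is the functional
   phi |-> E[phi(X)], only considered for phi in C_lLip. *)
Definition distr (R : realType) (n : nat) := ('rV[R]_n -> R) -> R.

Definition law (R : realType) (S : sublinear R) (n : nat) (X : 'I_n -> S -> R)
  : distr R n := fun phi => sl_E S (fun w => phi (vec X w)).

Definition law1 (R : realType) (S : sublinear R) (X : S -> R) : distr R 1 :=
  law (fun _ : 'I_1 => X).

Definition same_distr (R : realType) (n : nat) (F G : distr R n) : Prop :=
  forall phi, C_lLip phi -> F phi = G phi.

(* [independent X Y]: Y is independent of X (not a symmetric relation). *)
Definition independent (R : realType) (S : sublinear R) (m n : nat)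
    (X : 'I_m -> S -> R) (Y : 'I_n -> S -> R) : Prop :=
  forall phi : 'rV[R]_(m + n) -> R, C_lLip phi ->
    sl_E S (fun w => phi (row_mx (vec X w) (vec Y w))) =
    sl_E S (fun w => sl_E S (fun w' => phi (row_mx (vec X w) (vec Y w')))).

Definition independent_copy (R : realType) (S : sublinear R) (X Xbar : S -> R)
  : Prop :=
  same_distr (law1 Xbar) (law1 X) /\
  independent (fun _ : 'I_1 => X) (fun _ : 'I_1 => Xbar).

(* G-normality of a random variable with distribution F.  A given space need
   not contain an independent copy of its random variables, so X and its
   independent copy are realized on some sublinear expectation space (for
   instance a product space). *)
Definition G_normal (R : realType) (F : distr R 1) : Prop :=
  exists (S : sublinear R) (X Xbar : S -> R),
    [/\ sl_H S X, sl_H S Xbar, same_distr (law1 X) F, independent_copy X Xbar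
      & forall a b : R, 0 <= a -> 0 <= b ->
        same_distr (law1 (fun w => a * X w + b * Xbar w))
                   (law1 (fun w => Num.sqrt (a ^+ 2 + b ^+ 2) * X w))].

(* N({0}, [vlo, vhi]); the parameters are the variances. *)
Definition G_normal_var (R : realType) (F : distr R 1) (vlo vhi : R) : Prop :=
  [/\ G_normal F, vhi = F (fun x => x 0 0 ^+ 2)
    & vlo = - F (fun x => - x 0 0 ^+ 2)].

(* The case t = 0 is included for the increments, as otherwise the
   distribution of B_s would not be prescribed. *)
Definition G_brownian (R : realType) (S : sublinear R) (slo shi : R)
    (B : R -> S -> R) : Prop :=
  [/\ forall t, 0 <= t -> sl_H S (B t),
      forall w, B 0 w = 0
    & forall t s, 0 <= t -> 0 < s ->
      let dB := fun w => B (t + s) w - B t w in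
      G_normal_var (law1 dB) (s * slo ^+ 2) (s * shi ^+ 2) /\
      forall (n : nat) (u : 'I_n -> R), (forall i, 0 < u i <= t) ->
        independent (fun i => B (u i)) (fun _ : 'I_1 => dB)].

(* The process B2, indexed by [0, +oo[, is independent of the process B1. *)
Definition process_independent (R : realType) (S : sublinear R)
    (B1 B2 : R -> S -> R) : Prop :=
  forall (m n : nat) (s : 'I_m -> R) (t : 'I_n -> R),
    (forall i, 0 <= s i) -> (forall j, 0 <= t j) ->
    independent (fun i => B1 (s i)) (fun j => B2 (t j)).

(* Independence being directional, either direction is allowed. *)
Definition two_sided_G_brownian (R : realType) (S : sublinear R) (slo shi : R)
    (B : R -> S -> R) : Prop :=
  exists B1 B2 : R -> S -> R,
    [/\ G_brownian slo shi B1, G_brownian slo shi B2,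
        process_independent B1 B2 \/ process_independent B2 B1,
        forall t, 0 <= t -> B t = B1 t
      & forall t, t <= 0 -> B t = B2 (- t)].

Definition Gnorm (R : realType) (S : sublinear R) (p : R) (X : S -> R) : R :=
  sl_E S (fun w => `|X w| `^ p) `^ p^-1.

(* Elements of the completion L^p_G, represented by ||.||_p-Cauchy sequences of
   random variables; equality in L^p_G is [LG_eq] below. *)
Record LG (R : realType) (S : sublinear R) (p : R) := MkLG {
  LG_seq :> nat -> S -> R ;
  LG_H : forall k, sl_H S (LG_seq k) ;
  LG_cauchy : forall e : R, 0 < e -> exists N : nat, forall j k : nat,
    (N <= j)%N -> (N <= k)%N ->
    Gnorm p (fun w => LG_seq j w - LG_seq k w) < e }.

Definition LG_eq (R : realType) (S : sublinear R) (p : R) (X Y : LG S p)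
  : Prop :=
  Gnorm p (fun w => X k w - Y k w) @[k --> \oo] --> 0.

(* ||Y - X||_p for Y a random variable and X in L^p_G. *)
Definition LG_dist (R : realType) (S : sublinear R) (p : R) (Y : S -> R)
    (X : LG S p) : R :=
  lim (Gnorm p (fun w => Y w - X k w) @[k --> \oo]).

Definition LG_cvg (R : realType) (S : sublinear R) (p : R) (Y : nat -> S -> R)
    (X : LG S p) : Prop :=
  LG_dist (Y n) X @[n --> \oo] --> 0.

(* The continuous extension of the sublinear expectation to L^1_G. *)
Definition LG_E (R : realType) (S : sublinear R) (Y : LG S 1) : R :=
  lim (sl_E S (Y k) @[k --> \oo]).

(* phi(X) = Y in L^1_G for X in (L^2_G)^n: closure of the operation
   Z |-> phi(Z) defined on the n-tuples of random variables. *)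
Definition LG_comp (R : realType) (S : sublinear R) (n : nat)
    (X : 'I_n -> LG S 2) (phi : 'rV[R]_n -> R) (Y : LG S 1) : Prop :=
  exists Z : nat -> 'I_n -> S -> R,
    [/\ forall k i, sl_H S (Z k i),
        forall i, LG_cvg (fun k => Z k i) (X i)
      & LG_cvg (fun k w => phi (vec (Z k) w)) Y].

(* phi(X) is in L^1_G and E[phi(X)] = r. *)
Definition LG_expect (R : realType) (S : sublinear R) (n : nat)
    (X : 'I_n -> LG S 2) (phi : 'rV[R]_n -> R) (r : R) : Prop :=
  exists2 Y : LG S 1, LG_comp X phi Y & LG_E Y = r.

Definition LG_has_law (R : realType) (S : sublinear R) (n : nat)
    (X : 'I_n -> LG S 2) (F : distr R n) : Prop :=
  forall phi, C_lLip phi -> LG_expect X phi (F phi).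

Section linear_structure.
Variables (R : realType) (S : sublinear R).

Lemma C_lLip_sqr : C_lLip (fun x : 'rV[R]_1 => `|x 0 0| `^ 2).
Proof.
have coord (z : 'rV[R]_1) : `|z 0 0| <= `|z|.
  rewrite [leRHS]/Num.norm /= mx_normrE; apply/bigmax_geP; right => /=.
  by exists (0, 0).
exists 1, 1%N; split => // x y; rewrite !expr1 mul1r.
rewrite -[2]/(2%:R) !powR_mulrn// !real_normK ?num_real// subr_sqr mulrC normrM.
have := coord (x - y); rewrite !mxE => h.
apply: ler_pM => //; apply: (le_trans (ler_normD _ _)).
by have := coord x; have := coord y; lra.
Qed.

Lemma Gnorm2_scale (c : R) (X : S -> R) : sl_H S X ->
  Gnorm 2 (fun w => c * X w) = `|c| * Gnorm 2 X.
Proof.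
move=> HX.
have HX2 : sl_H S (fun w => `|X w| `^ 2).
  have := @sl_H_comp _ S 1 (fun=> X) _ (fun=> HX) C_lLip_sqr.
  by congr sl_H; apply/funext => w; rewrite /= !mxE.
have E0 : 0 <= sl_E S (fun w => `|X w| `^ 2).
  rewrite -(sl_E_cst S 0); apply: (sl_E_mono (sl_H_cst S 0) HX2) => w.
  exact: powR_ge0.
rewrite /Gnorm; under eq_fun do rewrite normrM powRM//.
rewrite sl_E_scale ?powR_ge0// powRM ?powR_ge0//.
by rewrite -powRrM mulfV// powRr1.
Qed.

Lemma Gnorm_0 (p : R) : p != 0 -> Gnorm p (fun _ : S => 0) = 0.
Proof.
move=> p0; rewrite /Gnorm; under eq_fun do rewrite normr0 powR0//.
by rewrite sl_E_cst powR0// invr_neq0.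
Qed.

Lemma zeroL2_cauchy (e : R) : 0 < e -> exists N : nat, forall j k : nat,
  (N <= j)%N -> (N <= k)%N -> Gnorm 2 (fun _ : S => 0 - 0 : R) < e.
Proof. by move=> e0; exists 0%N => *; rewrite subrr Gnorm_0. Qed.

Definition zeroL2 : LG S 2 :=
  @MkLG R S 2 (fun _ _ => 0) (fun=> sl_H_cst S 0) zeroL2_cauchy.

Lemma scaleL2_cauchy (c : R) (X : LG S 2) (e : R) : 0 < e ->
  exists N : nat, forall j k : nat, (N <= j)%N -> (N <= k)%N ->
    Gnorm 2 (fun w => c * X j w - c * X k w) < e.
Proof.
move=> e0.
have [N HN] := LG_cauchy X (divr_gt0 e0 (ltr_wpDl (normr_ge0 c) ltr01)).
exists N => j k Nj Nk; have := HN _ _ Nj Nk.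
have HD : sl_H S (fun w => X j w - X k w).
  have := sl_H_add (LG_H X j) (sl_H_scale (-1) (LG_H X k)).
  by under eq_fun do rewrite mulN1r.
have -> : (fun w => c * X j w - c * X k w) = (fun w => c * (X j w - X k w)).
  by apply/funext => w; rewrite mulrBr.
rewrite Gnorm2_scale// ltr_pdivlMr ?ltr_wpDl// => h.
apply: le_lt_trans h; rewrite mulrC ler_wpM2l ?powR_ge0//.
by rewrite lerDl.
Qed.

Definition scaleL2 (c : R) (X : LG S 2) : LG S 2 :=
  @MkLG R S 2 (fun k w => c * X k w) (fun k => sl_H_scale c (LG_H X k))
    (scaleL2_cauchy c X).

End linear_structure.
Arguments zeroL2 {R} S.

(* Step functions sum_(i < n) a_i 1_]t_i, t_(i+1)] with t_0 < ... < t_n. *)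
Record step (R : realType) := Step {
  step_n : nat ;
  step_t : nat -> R ;
  step_a : nat -> R ;
  step_lt : forall i, (i < step_n)%N -> step_t i < step_t i.+1 }.

Definition step_fun (R : realType) (f : step R) (x : R) : R :=
  \sum_(i < step_n f) step_a f i * \1_(`]step_t f i, step_t f i.+1]) x.

Definition step_integral (R : realType) (S : sublinear R) (B : R -> S -> R)
    (f : step R) (w : S) : R :=
  \sum_(i < step_n f) step_a f i * (B (step_t f i.+1) w - B (step_t f i) w).

(* X is the integral of the deterministic function f in L^2(R) against B. *)
Definition is_G_integral (R : realType) (S : sublinear R) (B : R -> S -> R)
    (f : R -> R) (X : LG S 2) : Prop :=
  (f : measurableTypeR R -> R) \in Lfun (@lebesgue_measure R) 2%:E /\
  exists g : nat -> step R,
    ('N[@lebesgue_measure R]_2%:E[EFin \o (step_fun (g n) \- f)%R])%E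
      @[n --> \oo] --> 0%E /\
    LG_cvg (fun n => step_integral B (g n)) X.

Definition centered_G_gaussian (R : realType) (S : sublinear R)
    (X : R -> LG S 2) : Prop :=
  forall t, exists slo shi : R, 0 <= slo <= shi /\
    exists2 F : distr R 1, LG_has_law (fun _ : 'I_1 => X t) F
      & G_normal_var F (slo ^+ 2) (shi ^+ 2).

Definition pairL2 (R : realType) (S : sublinear R) (X Y : LG S 2)
  : 'I_2 -> LG S 2 := fun i => if i == 0 then X else Y.

Definition fGBm (R : realType) (S : sublinear R) (H slo shi : R)
    (X : R -> LG S 2) : Prop :=
  [/\ centered_G_gaussian X,
      LG_eq (X 0) (zeroL2 S)
    & forall s t, 0 <= s -> 0 <= t ->
      let c := `|t| `^ (2 * H) + `|s| `^ (2 * H) - `|t - s| `^ (2 * H) in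
      LG_expect (pairL2 (X s) (X t)) (fun x => x 0 0 * x 0 1)
        (2^-1 * shi ^+ 2 * c) /\
      exists2 r : R,
        LG_expect (pairL2 (X s) (X t)) (fun x => - (x 0 0 * x 0 1)) r
        & - r = 2^-1 * slo ^+ 2 * c].

Definition Gamma (R : realType) (x : R) : R :=
  \int[@lebesgue_measure R]_(t in `]0, +oo[) (t `^ (x - 1) * expR (- t)).

(* x_+^a; needed since the library's x `^ a is 1 for x < 0. *)
Definition pos_pow (R : realType) (x a : R) : R := if 0 < x then x `^ a else 0.

Definition fGBm_kernel (R : realType) (H t s : R) : R :=
  pos_pow (t - s) (H - 2^-1) - pos_pow (- s) (H - 2^-1).

Definition fGBm_const (R : realType) (H : R) : R :=
  Num.sqrt (2 * H * sin (pi * H) * Gamma (2 * H)) / Gamma (H + 2^-1).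

(* Main.v *)
(* By independence of the increments, the integral of a step function has the law
   of a multiple of a fixed G-normal variable, the factor being the L^2 norm of
   the step function, so the integral is an isometry up to the factor shi.  That
   N({0}, [vlo, vhi]) determines the law (needed because increments are only
   known to be G-normal with given variances) is a Lindeberg argument: if P and Q
   are the semigroups of two such variables, one step of length 1/m changes them
   differently by O(m^(-3/2)) on functions with a Lipschitz second derivative,
   and smoothness is restored at each step by averaging, which costs nothing
   since averaging and a sublinear semigroup satisfy Jensen's inequality.

   The product of the integrals of two step functions on a common grid whose
   coefficients have pairwise the same sign has upper and lower expectation
   shi^2 and slo^2 times the L^2 scalar product.  For s, t >= 0 the kernels have
   the same sign everywhere and are L^2 limits of truncated samplings, so this
   passes to the covariances, and translation and scaling reduce the scalar
   product to the L^2 norm of the kernel at t = 1.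

   With a = H - 1/2, that norm reduces by integration by parts to the integral
   of u^a (1+u)^(a-2), a beta integral, and the normalization then amounts to
   cos(pi a) Gamma(1-2a) Gamma(1+2a) = Gamma(1-a) Gamma(1+a).  The latter is
   proved by rotating the ray of integration of z^(x-1)/(1+z) by a right angle,
   with x = 1-2a, which relates the integral for x to the one for (x+1)/2. *)

Require Import Defs.
From HB Require Import structures.
From mathcomp Require Import all_boot all_order all_algebra.
From mathcomp Require Import all_classical all_reals all_analysis.
From mathcomp Require Import measurable_realfun.
From mathcomp Require Import ring lra.

Set Implicit Arguments.
Unset Strict Implicit.
Unset Printing Implicit Defensive.

Import Order.TTheory GRing.Theory Num.Theory.
Import numFieldNormedType.Exports.

Local Open Scope classical_set_scope.
Local Open Scope ring_scope.

(** * Sublinear expectations and test functions *)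

(** The expectation is only sublinear, so equalities of expectations are mostly obtained as two
    opposite inequalities. For the product of two step integrals, expansion gives the upper bound
    and polarization of squares the lower one; the sign condition on the coefficients makes the two
    meet. For uniqueness of the G-normal law, no regularity of the G-heat equation is used. The
    semigroup need not create derivatives, but it keeps the Lipschitz constant of the initial
    function, and averaging twice over width e turns an L-Lipschitz function into one with a second
    derivative of Lipschitz constant 4 L / e^2. Hence the error of a step does not depend on how
    many steps came before, and only after the number of steps has gone to infinity is e sent to 0.
    A space carrying a G-Brownian motion need not contain independent copies of its increments. All
    laws are therefore compared with multiples of one variable [X0] living on its own space, where
    an independent copy exists. In the completion, test functions grow polynomially while
    convergence is quadratic; uniform bounds on all moments, read off from the law of [X0], bridge
    the gap. *)

Section plip.
Variable R : realType.
Implicit Types U V W : normedZmodType R.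

(** The product weight makes the class visibly closed under composition and products, and arbitrary
    normed domains allow functions of a pair, as independence requires. On row vectors it is the
    same class as [C_lLip]. *)
Definition plip V W (f : V -> W) : Prop :=
  exists (C : R) (k : nat), 0 <= C /\ forall x y : V,
    `|f x - f y| <= C * ((1 + `|x|) * (1 + `|y|)) ^+ k * `|x - y|.

Let w1 V (x : V) : 1 <= 1 + `|x|.
Proof. by rewrite lerDl. Qed.

Let ww1 V (x y : V) : 1 <= (1 + `|x|) * (1 + `|y|).
Proof. by rewrite -[leLHS]mulr1 ler_pM. Qed.

Let a0 V (x : V) : 0 <= 1 + `|x|.
Proof. by rewrite addr_ge0. Qed.

Let wmono V W (x y : V) (z : W) (C D : R) k l : 0 <= C -> C <= D -> (k <= l)%N ->
  C * ((1 + `|x|) * (1 + `|y|)) ^+ k * `|z| <=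
  D * ((1 + `|x|) * (1 + `|y|)) ^+ l * `|z|.
Proof.
move=> C0 CD kl; rewrite ler_wpM2r//; apply: ler_pM => //.
by rewrite ler_weXn2l.
Qed.

Lemma plip_lip V W (f : V -> W) (K : R) :
  (forall x y, `|f x - f y| <= K * `|x - y|) -> plip f.
Proof.
move=> fK; exists `|K|, 0%N; split=> // x y; rewrite expr0 mulr1.
by apply: (le_trans (fK x y)); rewrite ler_wpM2r// ler_norm.
Qed.

Lemma plip_id V : plip (@id V).
Proof. by apply: (@plip_lip _ _ _ 1) => x y; rewrite mul1r. Qed.

Lemma plip_cst V W (c : W) : plip (fun _ : V => c).
Proof. by apply: (@plip_lip _ _ _ 0) => x y; rewrite subrr normr0 mul0r. Qed.

Lemma plip_growth V W (f : V -> W) : plip f ->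
  exists (C : R) (k : nat), 1 <= C /\ forall x, 1 + `|f x| <= C * (1 + `|x|) ^+ k.
Proof.
move=> [C [k [C0 fC]]]; exists (1 + `|f 0| + C), k.+1; split.
  by rewrite -addrA lerDl addr_ge0.
move=> x; have h := fC x 0; rewrite subr0 normr0 addr0 mulr1 in h.
have h1 : `|f x| <= `|f 0| + C * (1 + `|x|) ^+ k * `|x|.
  by rewrite -lerBlDl; apply: le_trans h; rewrite lerB_dist.
have e1 : 1 <= (1 + `|x|) ^+ k.+1 by rewrite exprn_ege1.
have e2 : (1 + `|x|) ^+ k * `|x| <= (1 + `|x|) ^+ k.+1.
  by rewrite exprSr ler_wpM2l ?exprn_ge0 ?lerDr// addr_ge0.
rewrite mulrDl [leRHS]addrC addrC.
have : (1 + `|f 0|) * 1 <= (1 + `|f 0|) * (1 + `|x|) ^+ k.+1.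
  by rewrite ler_wpM2l// addr_ge0.
have : C * ((1 + `|x|) ^+ k * `|x|) <= C * (1 + `|x|) ^+ k.+1.
  by rewrite ler_wpM2l.
move: h1; rewrite -mulrA; lra.
Qed.

Lemma plip_comp U V W (f : V -> W) (g : U -> V) : plip f -> plip g ->
  plip (f \o g).
Proof.
move=> [C [k [C0 fC]]] pg; have [D [l [D1 gD]]] := plip_growth pg.
case: pg => K [j [K0 gK]].
have D0 : 0 <= D by apply: le_trans D1.
exists (C * (D ^+ 2) ^+ k * K), (l * k + j)%N; split.
  by rewrite !mulr_ge0// exprn_ge0// exprn_ge0.
move=> x y /=; apply: (le_trans (fC _ _)).
rewrite exprD exprM.
have -> : C * D ^+ 2 ^+ k * K *
    ((((1 + `|x|) * (1 + `|y|)) ^+ l) ^+ k * ((1 + `|x|) * (1 + `|y|)) ^+ j)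
    * `|x - y| =
  C * (D ^+ 2 * ((1 + `|x|) * (1 + `|y|)) ^+ l) ^+ k *
   (K * ((1 + `|x|) * (1 + `|y|)) ^+ j * `|x - y|).
  rewrite [(D ^+ 2 * _) ^+ k]exprMn; move: ((D ^+ 2) ^+ k) => d.
  move: (((_ * _) ^+ l) ^+ k) => p; move: ((_ * _) ^+ j) => q; ring.
apply: ler_pM => //.
  by rewrite mulr_ge0// exprn_ge0// mulr_ge0.
apply: ler_wpM2l => //; apply: lerXn2r; rewrite ?nnegrE ?mulr_ge0//.
by rewrite exprMn expr2 mulrACA; exact: ler_pM.
Qed.

Lemma plip_add V W (f g : V -> W) : plip f -> plip g ->
  plip (fun x => f x + g x).
Proof.
move=> [C [k [C0 fC]]] [D [l [D0 gD]]]; exists (C + D), (k + l)%N.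
split=> [|x y]; first exact: addr_ge0.
have -> : f x + g x - (f y + g y) = (f x - f y) + (g x - g y).
  by rewrite opprD addrACA.
apply: (le_trans (ler_normD _ _)); rewrite mulrDl mulrDl.
apply: lerD; [apply: (le_trans (fC _ _))|apply: (le_trans (gD _ _))].
  by rewrite ler_wpM2r// ler_wpM2l// ler_weXn2l// leq_addr.
by rewrite ler_wpM2r// ler_wpM2l// ler_weXn2l// leq_addl.
Qed.

Lemma plip_opp V W (f : V -> W) : plip f -> plip (fun x => - f x).
Proof.
move=> [C [k [C0 fC]]]; exists C, k; split=> // x y.
by rewrite -opprD normrN.
Qed.

Lemma plip_sub V W (f g : V -> W) : plip f -> plip g ->
  plip (fun x => f x - g x).
Proof. by move=> pf pg; apply: plip_add => //; exact: plip_opp. Qed.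

Lemma plip_norm V : plip (fun x : V => `|x|).
Proof.
apply: (@plip_lip _ _ _ 1) => x y; rewrite mul1r.
exact: ler_dist_dist.
Qed.

Lemma plip_sum V W (I : Type) (r : seq I) (f : I -> V -> W) :
  (forall i, plip (f i)) -> plip (fun x => \sum_(i <- r) f i x).
Proof.
move=> pf; elim: r => [|i r ih].
  by under eq_fun do rewrite big_nil; exact: plip_cst.
by under eq_fun do rewrite big_cons; exact: plip_add.
Qed.

Lemma plip_fst V W : plip (fun z : V * W => z.1).
Proof.
apply: (@plip_lip _ _ _ 1) => x y; rewrite mul1r.
by rewrite [leRHS]/Num.norm/= le_max lexx.
Qed.

Lemma plip_snd V W : plip (fun z : V * W => z.2).
Proof.
apply: (@plip_lip _ _ _ 1) => x y; rewrite mul1r.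
by rewrite [leRHS]/Num.norm/= le_max lexx orbT.
Qed.

Lemma plip_pair U V W (f : U -> V) (g : U -> W) : plip f -> plip g ->
  plip (fun x => (f x, g x)).
Proof.
move=> [C [k [C0 fC]]] [D [l [D0 gD]]]; exists (C + D), (k + l)%N.
split=> [|x y]; first exact: addr_ge0.
rewrite [leLHS]/Num.norm/= ge_max; apply/andP; split.
  by apply: (le_trans (fC _ _)); apply: wmono; rewrite ?lerDl ?leq_addr.
by apply: (le_trans (gD _ _)); apply: wmono; rewrite ?lerDr ?leq_addl.
Qed.

Lemma plip_mulr : plip (fun z : R * R => z.1 * z.2).
Proof.
exists 1, 1%N; split=> // -[x x'] [y y'] /=; rewrite mul1r expr1.
have -> : x * x' - y * y' = x * (x' - y') + (x - y) * y' by ring.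
apply: (le_trans (ler_normD _ _)); rewrite !normrM.
have n1 (a b : R) : `|a| <= `|(a, b)|.
  by rewrite [leRHS]/Num.norm/= le_max lexx.
have n2 (a b : R) : `|b| <= `|(a, b)|.
  by rewrite [leRHS]/Num.norm/= le_max lexx orbT.
have h1 := n1 x x'; have h2 := n2 x x'; have h3 := n1 y y'; have h4 := n2 y y'.
have h5 := n1 (x - y) (x' - y'); have h6 := n2 (x - y) (x' - y').
have -> : (x, x') - (y, y') = (x - y, x' - y') by [].
have a1 : `|x| * `|x' - y'| <= `|(x, x')| * `|(x - y, x' - y')| by exact: ler_pM.
have a2 : `|x - y| * `|y'| <= `|(x - y, x' - y')| * `|(y, y')| by exact: ler_pM.
apply: (le_trans (lerD a1 a2)); rewrite [X in _ + X]mulrC -mulrDl ler_wpM2r//.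
by have := normr_ge0 (x, x'); have := normr_ge0 (y, y'); nra.
Qed.

Lemma plip_mul V (f g : V -> R) : plip f -> plip g -> plip (fun x => f x * g x).
Proof.
move=> pf pg.
exact: (plip_comp plip_mulr (plip_pair pf pg)).
Qed.

Lemma plip_exp V (f : V -> R) n : plip f -> plip (fun x => f x ^+ n).
Proof.
move=> pf; elim: n => [|n ih].
  by under eq_fun do rewrite expr0; exact: plip_cst.
by under eq_fun do rewrite exprS; exact: plip_mul.
Qed.

Lemma mx_coord m n (x : 'M[R]_(m, n)) i j : `|x i j| <= `|x|.
Proof.
rewrite [leRHS]/Num.norm /= mx_normrE; apply/bigmax_geP; right => /=.
by exists (i, j).
Qed.

Lemma mx_norm_le m n (x : 'M[R]_(m, n)) c : 0 <= c ->
  (forall i j, `|x i j| <= c) -> `|x| <= c.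
Proof.
move=> c0 h; rewrite [leLHS]/Num.norm /= mx_normrE.
by apply/bigmax_leP; split=> // -[i j] _; exact: h.
Qed.

Lemma plip_coord m n i j : plip (fun x : 'M[R]_(m, n) => x i j).
Proof.
apply: (@plip_lip _ _ _ 1) => x y; rewrite mul1r.
by have := mx_coord (x - y) i j; rewrite !mxE.
Qed.

Lemma plip_lsub m n : plip (fun x : 'rV[R]_(m + n) => lsubmx x).
Proof.
apply: (@plip_lip _ _ _ 1) => x y; rewrite mul1r; apply: mx_norm_le => // i j.
by have := mx_coord (x - y) i (lshift n j); rewrite !mxE.
Qed.

Lemma plip_rsub m n : plip (fun x : 'rV[R]_(m + n) => rsubmx x).
Proof.
apply: (@plip_lip _ _ _ 1) => x y; rewrite mul1r; apply: mx_norm_le => // i j.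
by have := mx_coord (x - y) i (rshift m j); rewrite !mxE.
Qed.

Lemma plip_const_mx : plip (fun x : R => (const_mx x : 'rV[R]_1)).
Proof.
apply: (@plip_lip _ _ _ 1) => x y; rewrite mul1r; apply: mx_norm_le => // i j.
by rewrite !mxE.
Qed.

Lemma C_lLip_plip n (phi : 'rV[R]_n -> R) : C_lLip phi -> plip phi.
Proof.
move=> [C [m [C0 h]]]; exists (C * 3), m; split; first by rewrite mulr_ge0// ltW.
move=> x y; apply: (le_trans (h x y)); rewrite ler_wpM2r// -mulrA ler_wpM2l//; first exact: ltW.
have h1 : 1 <= ((1 + `|x|) * (1 + `|y|)) ^+ m by rewrite exprn_ege1.
have h2 : `|x| ^+ m <= ((1 + `|x|) * (1 + `|y|)) ^+ m.
  apply: lerXn2r; rewrite ?nnegrE ?mulr_ge0//.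
  by rewrite -[leLHS]mulr1 ler_pM ?lerDr ?lerDl.
have h3 : `|y| ^+ m <= ((1 + `|x|) * (1 + `|y|)) ^+ m.
  apply: lerXn2r; rewrite ?nnegrE ?mulr_ge0//.
  by rewrite -[leLHS]mul1r ler_pM ?lerDr ?lerDl.
lra.
Qed.

Lemma pow1D_le (x : R) k : 0 <= x -> (1 + x) ^+ k <= 2 ^+ k * (1 + x ^+ k).
Proof.
move=> x0; have [x1|x1] := leP x 1.
  apply: (@le_trans _ _ (2 ^+ k * 1)); last first.
    by rewrite ler_wpM2l ?exprn_ge0// lerDl exprn_ge0.
  by rewrite mulr1; apply: lerXn2r; rewrite ?nnegrE//; lra.
apply: (@le_trans _ _ (2 ^+ k * x ^+ k)); last first.
  by rewrite ler_wpM2l ?exprn_ge0// lerDr.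
by rewrite -exprMn; apply: lerXn2r; rewrite ?nnegrE//; lra.
Qed.

(** The product weight is separated by pq <= (p^2 + q^2)/2, which doubles the exponent. The summand
    1 keeps the constant positive when [C] is 0. *)
Lemma plip_C_lLip n (phi : 'rV[R]_n -> R) : plip phi -> C_lLip phi.
Proof.
move=> [C [k [C0 h]]].
exists (1 + C * (2 ^+ (2 * k))), (2 * k)%N; split.
  by rewrite ltr_pwDl// mulr_ge0// exprn_ge0.
move=> x y; apply: (le_trans (h x y)); rewrite ler_wpM2r//.
have hx := @pow1D_le `|x| (2 * k) (normr_ge0 _).
have hy := @pow1D_le `|y| (2 * k) (normr_ge0 _).
have h2 : ((1 + `|x|) * (1 + `|y|)) ^+ k <=
    ((1 + `|x|) ^+ (2 * k) + (1 + `|y|) ^+ (2 * k)) / 2.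
  rewrite exprMn mulnC !exprM.
  have := sqr_ge0 ((1 + `|x|) ^+ k - (1 + `|y|) ^+ k); nra.
have p0 : 0 <= 2 ^+ (2 * k) :> R by rewrite exprn_ge0.
have px : 0 <= `|x| ^+ (2 * k) by rewrite exprn_ge0.
have py : 0 <= `|y| ^+ (2 * k) by rewrite exprn_ge0.
set P := 2 ^+ (2 * k) in hx hy p0 *.
set X := `|x| ^+ _ in hx px *; set Y := `|y| ^+ _ in hy py *.
apply: (@le_trans _ _ (C * (P * (1 + X + Y)))); last first.
  rewrite -subr_ge0 (_ : _ - _ = 1 + X + Y); last by ring.
  by rewrite !addr_ge0.
rewrite ler_wpM2l//; apply: (le_trans h2); nra.
Qed.

End plip.

#[export] Hint Resolve plip_id plip_cst plip_norm plip_fst plip_snd plip_coord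
  plip_lsub plip_rsub plip_const_mx : plip.

Section sublinear_theory.
Variables (R : realType) (S : sublinear R).
Implicit Types X Y Z : S -> R.
Local Notation E := (sl_E S).
Local Notation H := (sl_H S).

Lemma H_plip n (X : 'I_n -> S -> R) (phi : 'rV[R]_n -> R) :
  (forall i, H (X i)) -> plip phi -> H (fun w => phi (vec X w)).
Proof. by move=> HX /plip_C_lLip; exact: sl_H_comp. Qed.

Lemma H_comp1 X (phi : R -> R) : H X -> plip phi -> H (fun w => phi (X w)).
Proof.
move=> HX pphi.
have := @H_plip 1 (fun=> X) (fun x => phi (x 0 0)) (fun=> HX)
  (plip_comp pphi (@plip_coord R 1 1 0 0)).
by congr H; apply/funext => w; rewrite mxE.
Qed.

Lemma H_opp X : H X -> H (fun w => - X w).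
Proof.
by move=> HX; have := sl_H_scale (-1) HX; under eq_fun do rewrite mulN1r.
Qed.

Lemma H_sub X Y : H X -> H Y -> H (fun w => X w - Y w).
Proof. by move=> HX HY; apply: sl_H_add => //; exact: H_opp. Qed.

Lemma H_sum I (r : seq I) (X : I -> S -> R) : (forall i, H (X i)) ->
  H (fun w => \sum_(i <- r) X i w).
Proof.
move=> HX; elim: r => [|i r ih].
  by under eq_fun do rewrite big_nil; exact: sl_H_cst.
by under eq_fun do rewrite big_cons; exact: sl_H_add.
Qed.

Lemma H_exp X n : H X -> H (fun w => X w ^+ n).
Proof.
move=> HX; apply: (H_comp1 HX (phi := fun x => x ^+ n)).
by apply: plip_exp; exact: plip_id.
Qed.

Lemma H_norm X : H X -> H (fun w => `|X w|).
Proof. by move=> HX; apply: (H_comp1 HX (@plip_norm R R)). Qed.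

Lemma H_mul X Y : H X -> H Y -> H (fun w => X w * Y w).
Proof.
move=> HX HY.
have -> : (fun w => X w * Y w) =
    (fun w => 4^-1 * ((X w + Y w) ^+ 2 - (X w - Y w) ^+ 2)).
  by apply/funext => w; field.
apply: sl_H_scale; apply: H_sub; apply: H_exp.
  exact: sl_H_add.
exact: H_sub.
Qed.

Lemma E_ge0 X : H X -> (forall w, 0 <= X w) -> 0 <= E X.
Proof.
by move=> HX X0; rewrite -(sl_E_cst S 0); exact: sl_E_mono (sl_H_cst S 0) HX X0.
Qed.

Lemma E_sub X Y : H X -> H Y -> E X - E Y <= E (fun w => X w - Y w).
Proof.
move=> HX HY; rewrite lerBlDr.
have := sl_E_add (H_sub HX HY) HY.
by under eq_fun do rewrite subrK.
Qed.

Lemma E_addc X c : H X -> E (fun w => X w + c) = E X + c.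
Proof.
move=> HX; apply/eqP; rewrite eq_le; apply/andP; split.
  by apply: (le_trans (sl_E_add HX (sl_H_cst S c))); rewrite sl_E_cst.
have := sl_E_add (sl_H_add HX (sl_H_cst S c)) (sl_H_cst S (- c)).
rewrite sl_E_cst (_ : (fun w => X w + c + - c) = X); first by lra.
by apply/funext => w; rewrite addrK.
Qed.

Lemma E_dist X Y : H X -> H Y -> `|E X - E Y| <= E (fun w => `|X w - Y w|).
Proof.
move=> HX HY; rewrite ler_norml; apply/andP; split; last first.
  apply: (le_trans (E_sub HX HY)); apply: sl_E_mono => [||w].
  - exact: H_sub.
  - by apply: H_norm; exact: H_sub.
  - exact: ler_norm.
rewrite lerNl opprB; apply: (le_trans (E_sub HY HX)); apply: sl_E_mono => [||w].
- exact: H_sub.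
- by apply: H_norm; exact: H_sub.
- by rewrite distrC ler_norm.
Qed.

Lemma E_sum I (r : seq I) (X : I -> S -> R) : (forall i, H (X i)) ->
  E (fun w => \sum_(i <- r) X i w) <= \sum_(i <- r) E (X i).
Proof.
move=> HX; elim: r => [|i r ih].
  by under eq_fun do rewrite big_nil; rewrite big_nil sl_E_cst.
under eq_fun do rewrite big_cons; rewrite big_cons.
by apply: (le_trans (sl_E_add (HX i) (H_sum r HX))); rewrite lerD2l.
Qed.

(** A variable without mean uncertainty is additive: subtracting [Y] again by sub-additivity gives
    the missing inequality. *)
Lemma E_add_certain X Y m : H X -> H Y -> E Y = m -> E (fun w => - Y w) = - m ->
  E (fun w => X w + Y w) = E X + m.
Proof.
move=> HX HY Em ENm; apply/eqP; rewrite eq_le; apply/andP; split.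
  by apply: (le_trans (sl_E_add HX HY)); rewrite Em.
have := sl_E_add (sl_H_add HX HY) (H_opp HY); rewrite ENm.
rewrite (_ : (fun w => X w + Y w + - Y w) = X); first by lra.
by apply/funext => w; rewrite addrK.
Qed.

Lemma vec_norm_le n (X : 'I_n -> S -> R) w :
  `|vec X w| <= \sum_(i < n) `|X i w|.
Proof.
apply: mx_norm_le => [|i j]; first by apply: sumr_ge0.
by rewrite mxE (bigD1 j)//= lerDl sumr_ge0.
Qed.

Section indep.
Variables (m n : nat) (X : 'I_m -> S -> R) (Y : 'I_n -> S -> R).
Hypotheses (HX : forall i, H (X i)) (HY : forall i, H (Y i)).

(** The weight at (x, Y) and (y, Y) is at most the weight at x and y times (1 + |Y|)^(2k), whose
    expectation joins the constant. So the inner expectation of an iterated one is again a test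
    function. *)
Lemma plip_E (V : normedZmodType R) (f : V -> 'rV[R]_n -> R) :
  plip (fun z : V * 'rV[R]_n => f z.1 z.2) ->
  plip (fun x => E (fun w => f x (vec Y w))).
Proof.
move=> pf; have pfx x : plip (f x).
  exact: (plip_comp pf (plip_pair (plip_cst _ x) (@plip_id _ _))).
have := pf; move=> [C [k [C0 fC]]].
have Hw : H (fun w => (1 + `|vec Y w|) ^+ (2 * k)).
  apply: (H_plip HY (phi := fun y => (1 + `|y|) ^+ (2 * k))).
  apply: plip_exp; apply: plip_add; [exact: plip_cst|exact: plip_norm].
exists (C * E (fun w => (1 + `|vec Y w|) ^+ (2 * k))), k; split.
  rewrite mulr_ge0// E_ge0// => w; by rewrite exprn_ge0// addr_ge0.
move=> x y; apply: (le_trans (E_dist (H_plip HY (pfx x)) (H_plip HY (pfx y)))).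
set c := ((1 + `|x|) * (1 + `|y|)) ^+ k.
have c0 : 0 <= c by rewrite exprn_ge0// mulr_ge0// addr_ge0.
rewrite (_ : _ * _ * _ = C * c * `|x - y| *
    E (fun w => (1 + `|vec Y w|) ^+ (2 * k))); last by ring.
rewrite -sl_E_scale//; last by rewrite !mulr_ge0.
apply: sl_E_mono => [||w].
- apply: H_norm; apply: H_sub; exact: H_plip.
- exact: sl_H_scale.
- apply: (le_trans (fC (x, vec Y w) (y, vec Y w))).
  have -> : (x, vec Y w) - (y, vec Y w) = (x - y, 0).
    by rewrite -(subrr (vec Y w)).
  have nE (a : V) (b : 'rV[R]_n) : `|(a, b)| = Num.max `|a| `|b| by [].
  have nd : `|(x - y, 0 : 'rV[R]_n)| <= `|x - y|.
    by rewrite nE normr0 ge_max lexx normr_ge0.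
  have a0 (V' : normedZmodType R) (z : V') : 0 <= 1 + `|z| by rewrite addr_ge0.
  have nx (z : V) (y' : 'rV[R]_n) : 1 + `|(z, y')| <= (1 + `|z|) * (1 + `|y'|).
    have : `|(z, y')| <= `|z| + `|y'|.
      by rewrite nE ge_max lerDl lerDr !normr_ge0.
    have := mulr_ge0 (normr_ge0 z) (normr_ge0 y'); nra.
  have -> : C * c * `|x - y| * (1 + `|vec Y w|) ^+ (2 * k) =
      C * (((1 + `|x|) * (1 + `|vec Y w|)) * ((1 + `|y|) * (1 + `|vec Y w|))) ^+ k
      * `|x - y|.
    by rewrite exprM expr2 /c mulrACA !exprMn; ring.
  apply: ler_pM => //.
    by rewrite mulr_ge0// exprn_ge0// mulr_ge0.
  apply: ler_wpM2l => //; apply: lerXn2r; rewrite ?nnegrE ?mulr_ge0//.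
  by apply: ler_pM.
Qed.

Lemma indepE (f : 'rV[R]_m -> 'rV[R]_n -> R) : independent X Y ->
  plip (fun z : 'rV[R]_m * 'rV[R]_n => f z.1 z.2) ->
  E (fun w => f (vec X w) (vec Y w)) =
  E (fun w => E (fun w' => f (vec X w) (vec Y w'))).
Proof.
move=> ind pf.
have pf' : plip (fun z : 'rV[R]_(m + n) => f (lsubmx z) (rsubmx z)).
  exact: (plip_comp pf (plip_pair (@plip_lsub _ _ _) (@plip_rsub _ _ _))).
have e (a : 'rV[R]_m) (b : 'rV[R]_n) :
  f (lsubmx (row_mx a b)) (rsubmx (row_mx a b)) = f a b.
  by rewrite row_mxKl row_mxKr.
transitivity (E (fun w => f (lsubmx (row_mx (vec X w) (vec Y w)))
    (rsubmx (row_mx (vec X w) (vec Y w))))).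
  by congr (sl_E S); apply/funext => w; rewrite e.
rewrite (ind _ (plip_C_lLip pf')); congr (sl_E S); apply/funext => w.
by congr (sl_E S); apply/funext => w'; rewrite e.
Qed.

End indep.

Lemma Gnorm1E X : Gnorm 1 X = E (fun w => `|X w|) `^ 1^-1.
Proof.
by rewrite /Gnorm; under eq_fun do rewrite powRr1//.
Qed.

Lemma Gnorm1 X : H X -> Gnorm 1 X = E (fun w => `|X w|).
Proof.
move=> HX; rewrite Gnorm1E invr1 powRr1// E_ge0//; exact: H_norm.
Qed.

Lemma Gnorm2 X : H X -> Gnorm 2 X = Num.sqrt (E (fun w => X w ^+ 2)).
Proof.
move=> HX; rewrite /Gnorm; under eq_fun do rewrite -[2]/(2%:R) powR_mulrn// real_normK ?num_real//.
by rewrite powR12_sqrt// E_ge0// => [|w]; [exact: H_exp|exact: sqr_ge0].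
Qed.

End sublinear_theory.

(** * Smoothing by averages over a short interval *)

Section averaging.
Variable R : realType.
Implicit Types (u U f df : R -> R) (x y : R).
Local Notation mu := (@lebesgue_measure R).

Lemma le_addeps (a b : R) : (forall d : R, 0 < d -> a <= b + d) -> a <= b.
Proof. by move=> h; apply/ler_addgt0Pr => d; exact: h. Qed.

Lemma archi_div (c d : R) : 0 < d -> exists N : nat, c / N.+1%:R <= d.
Proof.
move=> d0; exists (Num.truncn (c / d)).
by rewrite ler_pdivrMr ?ltr0n// mulrC -ler_pdivrMr//; apply/ltW/truncnS_gt.
Qed.

Lemma is_derive_scale f x (d k : R) : is_derive x 1 f d ->
  is_derive x 1 (fun y => k * f y) (k * d).
Proof. by move=> h; exact: (@is_deriveZ R R R f k x 1 d h). Qed.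

Lemma is_derive_shiftr f (c x d : R) : is_derive (x + c) 1 f d ->
  is_derive x 1 (fun y => f (y + c)) d.
Proof.
move=> h; have := @is_derive1_comp R f (shift c) x d 1 h (is_derive_shift _ _ _).
by rewrite mulr1.
Qed.

Lemma mvt_all f df : (forall x, is_derive x 1 f (df x)) -> forall x y,
  exists2 z, `|z - x| <= `|y - x| & f y - f x = df z * (y - x).
Proof.
move=> fd x y.
have fc : continuous f.
  by move=> z; apply: differentiable_continuous; apply/derivable1_diffP;
    have [] := fd z.
have [xy|yx] := leP x y.
  have [z] := MVT_segment xy (fun z _ => fd z) (continuous_subspaceT fc).
  rewrite in_itv/= => /andP[xz zy] e; exists z => //.
  by rewrite !ger0_norm ?subr_ge0// lerD2r.
have [z] := MVT_segment (ltW yx) (fun z _ => fd z) (continuous_subspaceT fc).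
rewrite in_itv/= => /andP[yz zx] e; exists z.
  by rewrite distrC [leRHS]distrC !ger0_norm ?subr_ge0 ?(ltW yx)// lerD2l lerN2.
by rewrite -opprB e -mulrN opprB.
Qed.

Lemma continuous_primitive u : continuous u ->
  exists U, forall x, is_derive x 1 U (u x).
Proof.
move=> uc.
have ui a b : mu.-integrable `[a, b] (EFin \o u).
  apply: continuous_compact_integrable; first exact: segment_compact.
  exact: continuous_subspaceT.
pose I a x := (\int[mu]_(t in [set` `[a, x]]) (u t))%R.
have Isub a b x y : a <= b -> b <= x -> b <= y -> I a x - I a y = I b x - I b y.
  move=> ab bx by_.
  have h c : b <= c -> I a c - I a b = (\int[mu]_(t in [set` `]b, c]]) (u t))%R.
    by move=> bc; apply: Rintegral_itvB => //; rewrite bnd_simp.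
  have h' c : b <= c -> (\int[mu]_(t in [set` `]b, c]]) (u t))%R = I b c.
    move=> bc; apply: Rintegral_itv_obnd_cbnd.
    apply: (integrableS _ _ _ (ui b c)) => //.
    by apply: subset_itvr; rewrite bnd_simp.
  by have := h x bx; have := h y by_; rewrite !h'//; lra.
(* The base point moves with [x] so that one formula serves the whole line; subtracting the integral
   up to 0 from the same base makes the value independent of the base. *)
exists (fun x => I (- `|x| - 1) x - I (- `|x| - 1) 0) => x.
(* This base lies to the left of those of all [y] within distance 1 of [x], so near [x] it can
   replace them. *)
pose a := - `|x| - 2.
have ax : a < x by rewrite /a; have := ler_norm (- x); rewrite normrN; lra.
have [dI I'] := @continuous_FTC1_closed R u a x (x + 1)
  (ltr_pwDr ltr01 (lexx x)) (ui _ _) ax (uc x).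
have : is_derive x 1 (fun y => I a y - I a 0) (u x).
  have hI : is_derive x 1 (I a) (u x).
    by apply: DeriveDef; [exact: dI|rewrite -derive1E].
  have := is_deriveB hI (is_derive_cst (I a 0) x 1).
  by rewrite subr0.
apply: near_eq_is_derive.
near=> y.
have yx : `|y| < `|x| + 1.
  have : `|y - x| < 1.
    by rewrite distrC; near: y; apply: cvgr_dist_lt => //; exact: cvg_id.
  by have := ler_normD x (y - x); rewrite [x + _]addrC subrK; lra.
apply: Isub; rewrite /a; try by have := normr_ge0 y; lra.
by have := ler_norm (- y); rewrite normrN; lra.
Unshelve. all: by end_near. Qed.

Lemma lip_continuous u (L : R) : (forall x y, `|u x - u y| <= L * `|x - y|) ->
  continuous u.
Proof.
move=> uL x; apply/cvgrPdist_le => e e0.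
near=> y.
have h : `|x - y| <= e / (`|L| + 1).
  near: y; apply: cvgr_dist_le; [exact: cvg_id|].
  by rewrite divr_gt0// ltr_pwDr.
apply: (le_trans (uL x y)).
have L1 : 0 < `|L| + 1 by rewrite ltr_pwDr.
rewrite ler_pdivlMr// in h; apply: le_trans h.
rewrite mulrC ler_wpM2l//; have := ler_norm L; lra.
Unshelve. all: by end_near. Qed.

Definition primitive u : R -> R :=
  get [set U | forall x, is_derive x 1 U (u x)].

Lemma primitiveP u : continuous u -> forall x, is_derive x 1 (primitive u) (u x).
Proof. by move=> /continuous_primitive /getPex. Qed.

(** The mean of [u] over [x, x + e], written as a difference quotient of a primitive so that its
    derivative is immediate. *)
Definition avg (e : R) u : R -> R :=
  fun x => e^-1 * (primitive u (x + e) - primitive u x).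

Section avg.
Variables (u : R -> R) (L e : R).
Hypothesis uL : forall x y, `|u x - u y| <= L * `|x - y|.
Hypothesis e0 : 0 < e.

Let uc : continuous u := lip_continuous uL.

Let ei0 : 0 <= e^-1.
Proof. by rewrite invr_ge0 ltW. Qed.

Lemma avg_derive x : is_derive x 1 (avg e u) (e^-1 * (u (x + e) - u x)).
Proof.
rewrite /avg.
have h1 : is_derive x 1 (fun y => primitive u (y + e)) (u (x + e)).
  by apply: is_derive_shiftr; exact: primitiveP.
have h2 := primitiveP uc x.
exact: is_derive_scale (is_deriveB h1 h2).
Qed.

Lemma L_ge0 : 0 <= L.
Proof.
by have := uL 1 0; rewrite subr0 normr1 mulr1; exact: le_trans.
Qed.

(** Riemann sums are finite convex combinations, to which monotonicity and sub-additivity of an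
    expectation apply directly; the explicit rate carries the resulting inequalities over to the
    average. *)
Lemma avg_riemann x (N : nat) :
  `|avg e u x - N.+1%:R^-1 * \sum_(i < N.+1) u (x + e * i%:R / N.+1%:R)|
    <= L * e / N.+1%:R.
Proof.
pose t (i : nat) := x + e * i%:R / N.+1%:R.
have N0 : 0 < N.+1%:R :> R by rewrite ltr0n.
have tS i : t i.+1 - t i = e / N.+1%:R.
  by rewrite /t -natr1; field; rewrite nat1r lt0r_neq0.
have h i : `|primitive u (t i.+1) - primitive u (t i) - e / N.+1%:R * u (t i)|
    <= e / N.+1%:R * (L * e / N.+1%:R).
  have [z zt ->] := mvt_all (primitiveP uc) (t i) (t i.+1).
  rewrite tS [X in X - _]mulrC -mulrBr normrM ger0_norm; last first.
    by rewrite divr_ge0// ltW.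
  apply: ler_wpM2l; first by rewrite divr_ge0// ltW.
  apply: (le_trans (uL _ _)); rewrite -mulrA; apply: ler_wpM2l; first exact: L_ge0.
  by apply: (le_trans zt); rewrite tS ger0_norm// divr_ge0// ltW.
have -> : avg e u x = e^-1 * \sum_(i < N.+1) (primitive u (t i.+1) - primitive u (t i)).
  rewrite -(big_mkord xpredT (fun i => primitive u (t i.+1) - primitive u (t i))).
  rewrite telescope_sumr// /avg /t mulr0 mul0r addr0 mulfK//.
rewrite [X in `|X|](_ : _ =
  e^-1 * \sum_(i < N.+1) (primitive u (t i.+1) - primitive u (t i) - e / N.+1%:R * u (t i))); last first.
  rewrite [X in _ = _ * X]sumrB [RHS]mulrBr; congr (_ - _); rewrite -mulr_sumr mulrA; congr (_ * _).
  by rewrite mulrA mulVf ?mul1r// lt0r_neq0.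
rewrite normrM (ger0_norm ei0).
have -> : L * e / N.+1%:R = e^-1 * \sum_(i < N.+1) (e / N.+1%:R * (L * e / N.+1%:R)).
  rewrite sumr_const card_ord -mulr_natr; field.
  by rewrite nat1r !lt0r_neq0.
apply: ler_wpM2l => //.
by apply: (le_trans (ler_norm_sum _ _ _)); exact: ler_sum.
Qed.

Lemma avg_dist x : `|avg e u x - u x| <= L * e.
Proof.
have := avg_riemann x 0; rewrite big_ord1 mulr0 mul0r addr0 invr1 mul1r mulr1.
exact.
Qed.

Lemma avg_lip x y : `|avg e u x - avg e u y| <= L * `|x - y|.
Proof.
have [z _ ->] := mvt_all avg_derive y x.
rewrite normrM; apply: ler_wpM2r => //.
rewrite normrM (ger0_norm ei0) ler_pdivrMl//.
by apply: (le_trans (uL _ _)); rewrite addrC addKr (ger0_norm (ltW e0)) mulrC.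
Qed.

End avg.

Lemma avg_le u (v : R -> R) (L M e : R) : (forall x y, `|u x - u y| <= L * `|x - y|) ->
  (forall x y, `|v x - v y| <= M * `|x - y|) -> 0 < e ->
  (forall x, u x <= v x) -> forall x, avg e u x <= avg e v x.
Proof.
move=> uL vM e0 uv x; apply: le_addeps => d d0.
have [N hN] := archi_div ((L + M) * e) d0.
have N0 : 0 < N.+1%:R :> R by rewrite ltr0n.
have h1 := avg_riemann uL e0 x N; have h2 := avg_riemann vM e0 x N.
have h3 : N.+1%:R^-1 * \sum_(i < N.+1) u (x + e * i%:R / N.+1%:R) <=
  N.+1%:R^-1 * \sum_(i < N.+1) v (x + e * i%:R / N.+1%:R).
  apply: ler_wpM2l; first by rewrite invr_ge0 ler0n.
  by apply: ler_sum => i _; exact: uv.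
move: h1 h2; rewrite !ler_norml => /andP[_ h1] /andP[h2 _].
rewrite !mulrDl in hN.
move: h1 h2 h3 hN.
move: (_ * \sum_(i < _) _) (_ * \sum_(i < _) _) (L * e / _) (M * e / _) => p q a b.
lra.
Qed.

(** Each average turns one derivative into a difference quotient, so [d2] is a second difference of
    [u] and inherits a Lipschitz constant: four values of [u], each contributing L / e^2. Two
    applications of the mean value theorem bound the remainder, without the optimal factor 1/6. *)
Lemma avg2_taylor u (L e : R) : (forall x y, `|u x - u y| <= L * `|x - y|) -> 0 < e ->
  exists d1 d2 : R -> R, forall x y,
  `|avg e (avg e u) (x + y) - (avg e (avg e u) x + d1 x * y + d2 x * y ^+ 2 / 2)|
    <= 4 * L / e ^+ 2 * `|y| ^+ 3.
Proof.
move=> uL e0.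
pose d1 x := e^-1 * (avg e u (x + e) - avg e u x).
pose d2 x := e^-1 * (e^-1 * (u (x + e + e) - u (x + e)) - e^-1 * (u (x + e) - u x)).
have D1 x : is_derive x 1 (avg e (avg e u)) (d1 x).
  by apply: avg_derive; exact: (avg_lip uL e0).
have D2 x : is_derive x 1 d1 (d2 x).
  have h1 : is_derive x 1 (fun y => avg e u (y + e)) (e^-1 * (u (x + e + e) - u (x + e))).
    by apply: is_derive_shiftr; apply: avg_derive; exact: uL.
  have h2 : is_derive x 1 (avg e u) (e^-1 * (u (x + e) - u x)).
    by apply: avg_derive; exact: uL.
  exact: is_derive_scale (is_deriveB h1 h2).
exists d1, d2 => x y.
pose K := 4 * L / e ^+ 2.
have L0 : 0 <= L := L_ge0 uL.
have K0 : 0 <= K by apply: divr_ge0; [exact: mulr_ge0|exact: sqr_ge0].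
have d2K a b : `|d2 a - d2 b| <= K * `|a - b|.
  have -> : d2 a - d2 b = (e ^+ 2)^-1 * ((u (a + e + e) - u (b + e + e)) -
      (u (a + e) - u (b + e)) - (u (a + e) - u (b + e)) + (u a - u b)).
    by rewrite /d2; field; rewrite lt0r_neq0.
  rewrite normrM ger0_norm ?invr_ge0 ?sqr_ge0// /K mulrAC mulrC.
  apply: ler_wpM2r; first by rewrite invr_ge0 sqr_ge0.
  have h1 := uL (a + e + e) (b + e + e); have h2 := uL (a + e) (b + e).
  have h3 := uL a b.
  have e1 : a + e - (b + e) = a - b by ring.
  have e2 : a + e + e - (b + e + e) = a - b by ring.
  rewrite e1 in h2; rewrite e2 in h1.
  move: h1 h2 h3; rewrite !ler_norml => /andP[? ?] /andP[? ?] /andP[? ?].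
  by apply/andP; split; lra.
pose g z := avg e (avg e u) (x + z) - (d1 x * z + d2 x * z ^+ 2 / 2).
pose g' z := d1 (x + z) - (d1 x + d2 x * z).
have Dg (z : R) : is_derive z 1 g (g' z).
  have h1 : is_derive z 1 (fun y => avg e (avg e u) (x + y)) (d1 (x + z)).
    under eq_fun do rewrite addrC.
    by apply: is_derive_shiftr; rewrite addrC; exact: D1.
  have h2 : is_derive z 1 (fun z => d1 x * z + d2 x * z ^+ 2 / 2) (d1 x + d2 x * z).
    have -> : (fun z => d1 x * z + d2 x * z ^+ 2 / 2) =
       (d1 x \*: (@id R)) + (d2 x / 2) \*: ((@id R) ^+ 2).
      apply/funext => t; rewrite !fctE/= /GRing.scale/=; lra.
    apply: is_derive_eq; rewrite /GRing.scale/= !expr1 /GRing.scale/=; lra.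
  exact: (is_deriveB h1 h2).
have [z zy gE] := mvt_all Dg 0 y.
have -> : avg e (avg e u) (x + y) -
    (avg e (avg e u) x + d1 x * y + d2 x * y ^+ 2 / 2) = g y - g 0.
  by rewrite /g addr0 expr2; lra.
rewrite !subr0 in zy gE; rewrite gE normrM -/K [`|y| ^+ 3]exprSr mulrA.
apply: ler_wpM2r => //.
have [t tz dE] := mvt_all D2 x (x + z).
rewrite addrAC subrr add0r in tz dE.
have -> : g' z = (d2 t - d2 x) * z by rewrite /g' mulrBl -dE; lra.
rewrite normrM; apply: (@le_trans _ _ (K * `|t - x| * `|z|)).
  exact: ler_wpM2r.
rewrite expr2 -mulrA; apply: ler_wpM2l => //.
by apply: ler_pM => //; exact: (le_trans tz).
Qed.

End averaging.

Section law1.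
Variables (R : realType) (S : sublinear R).
Implicit Types (X Y : S -> R) (phi : R -> R).
Local Notation E := (sl_E S).
Local Notation H := (sl_H S).

Lemma vec1 X w : vec (fun _ : 'I_1 => X) w = const_mx (X w).
Proof. by apply/rowP => i; rewrite !mxE. Qed.

Lemma const_mx1 (x : 'rV[R]_1) : const_mx (x 0 0) = x.
Proof. by apply/rowP => i; rewrite !mxE !ord1. Qed.

Lemma same_distr1P (F G : distr R 1) : same_distr F G <->
  forall phi, plip phi -> F (fun x => phi (x 0 0)) = G (fun x => phi (x 0 0)).
Proof.
split=> [h phi pphi|h phi /C_lLip_plip pphi].
  apply: h; apply: plip_C_lLip.
  exact: (plip_comp pphi (@plip_coord _ _ _ _ _)).
have -> : phi = (fun x => (fun y => phi (const_mx y)) (x 0 0)).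
  by apply/funext => x; rewrite const_mx1.
apply: (h (fun y => phi (const_mx y))).
exact: (plip_comp pphi (@plip_const_mx _)).
Qed.

Lemma law1E X phi : law1 X (fun x => phi (x 0 0)) = E (fun w => phi (X w)).
Proof. by rewrite /law1 /law; congr (sl_E S); apply/funext => w; rewrite mxE. Qed.

Lemma indepE1 X Y (f : R -> R -> R) : H X -> H Y ->
  independent (fun _ : 'I_1 => X) (fun _ : 'I_1 => Y) ->
  plip (fun z : R * R => f z.1 z.2) ->
  E (fun w => f (X w) (Y w)) = E (fun w => E (fun w' => f (X w) (Y w'))).
Proof.
move=> HX HY ind pf.
pose g (x y : 'rV[R]_1) := f (x 0 0) (y 0 0).
have e w w' : g (vec (fun _ : 'I_1 => X) w) (vec (fun _ : 'I_1 => Y) w') = f (X w) (Y w').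
  by rewrite /g !mxE.
transitivity (E (fun w => g (vec (fun _ : 'I_1 => X) w) (vec (fun _ : 'I_1 => Y) w))).
  by congr (sl_E S); apply/funext => w; rewrite e.
rewrite (indepE ind)//; last first.
  apply: (plip_comp (f := fun z : R * R => f z.1 z.2)
    (g := fun z : 'rV[R]_1 * 'rV[R]_1 => (z.1 0 0, z.2 0 0)) pf).
  apply: plip_pair.
    exact: (plip_comp (@plip_coord _ _ _ _ _) (@plip_fst _ _ _)).
  exact: (plip_comp (@plip_coord _ _ _ _ _) (@plip_snd _ _ _)).
by congr (sl_E S); apply/funext => w; congr (sl_E S); apply/funext => w'; rewrite e.
Qed.

Lemma plip_affine (a b : R) : plip (fun y : R => a + b * y).
Proof.
apply: (@plip_lip _ _ _ _ `|b|) => x y.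
by rewrite opprD addrACA subrr add0r -mulrBr normrM.
Qed.

Lemma plip_comp_affine phi (a b : R) : plip phi -> plip (fun y => phi (a + b * y)).
Proof. move=> pphi; exact: (plip_comp pphi (plip_affine a b)). Qed.

Lemma plip_lin (a b : R) : plip (fun z : R * R => a * z.1 + b * z.2).
Proof.
apply: plip_add; apply: plip_mul; do ?exact: plip_cst.
  exact: plip_fst.
exact: plip_snd.
Qed.

End law1.

(** * The semigroup of a G-normal variable *)

Section G_normal_theory.
Variables (R : realType) (S : sublinear R) (X Xb : S -> R).
Implicit Types (phi psi : R -> R).
Local Notation E := (sl_E S).
Local Notation H := (sl_H S).
Hypotheses (HX : H X) (HXb : H Xb) (ic : independent_copy X Xb).
Hypothesis GX : forall a b : R, 0 <= a -> 0 <= b ->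
        same_distr (law1 (fun w => a * X w + b * Xb w))
                   (law1 (fun w => Num.sqrt (a ^+ 2 + b ^+ 2) * X w)).

Lemma G_copyE phi : plip phi -> E (fun w => phi (Xb w)) = E (fun w => phi (X w)).
Proof.
by move=> pphi; case: ic => /same_distr1P/(_ _ pphi) + _; rewrite !law1E.
Qed.

Lemma G_sum phi a b : plip phi -> 0 <= a -> 0 <= b ->
  E (fun w => E (fun w' => phi (a * X w + b * X w'))) =
  E (fun w => phi (Num.sqrt (a ^+ 2 + b ^+ 2) * X w)).
Proof.
move=> pphi a0 b0.
have /same_distr1P/(_ _ pphi) := GX a0 b0; rewrite !law1E => <-.
rewrite (indepE1 (f := fun x y => phi (a * x + b * y)) HX HXb ic.2); last first.
  exact: (plip_comp pphi (plip_lin a b)).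
congr (sl_E S); apply/funext => w.
by rewrite (G_copyE (phi := fun y => phi (a * X w + b * y)))//; exact: plip_comp_affine.
Qed.

(** With a = b = 1 the stability identity reads 2 m = sqrt(2) m for the upper mean m of [X], and
    likewise for -[X]. Both signs are needed because only nonnegative factors leave the
    expectation. *)
Lemma G_mean (c : R) : E (fun w => c * X w) = 0.
Proof.
have h (s : R) : s = 1 \/ s = -1 -> E (fun w => s * X w) = 0.
  move=> s1.
  have e := @G_sum (fun x => s * x) 1 1 (plip_mul (plip_cst _ _) (@plip_id _ _))
    ler01 ler01.
  have HsX : H (fun w => s * X w) by exact: sl_H_scale.
  have e1 : E (fun w => s * (Num.sqrt (1 ^+ 2 + 1 ^+ 2) * X w)) =
      Num.sqrt (1 + 1) * E (fun w => s * X w).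
    rewrite -sl_E_scale// expr1n; congr (sl_E S); apply/funext => w; ring.
  have e2 : E (fun w => E (fun w' => s * (1 * X w + 1 * X w'))) =
      E (fun w => s * X w) + E (fun w => s * X w).
    rewrite -[RHS]E_addc//; congr (sl_E S); apply/funext => w.
    rewrite [RHS]addrC -E_addc//; congr (sl_E S); apply/funext => w'; ring.
  rewrite e1 e2 in e.
  set m := E _ in e *.
  have s2 : Num.sqrt (1 + 1) != 2 :> R.
    apply/eqP => s2.
    have : Num.sqrt (1 + 1) ^+ 2 = 2 ^+ 2 :> R by rewrite s2.
    by rewrite sqr_sqrtr//; lra.
  apply/eqP; have : (Num.sqrt (1 + 1) - 2) * m = 0 by rewrite mulrBl -e; lra.
  by move=> /eqP; rewrite mulf_eq0 subr_eq0 (negbTE s2).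
have [c0|c0] := leP 0 c.
  rewrite sl_E_scale//; have := h 1 (or_introl erefl).
  by under eq_fun do rewrite mul1r; move=> ->; rewrite mulr0.
have -> : (fun w => c * X w) = (fun w => - c * (-1 * X w)).
  by apply/funext => w; ring.
by rewrite sl_E_scale ?h ?mulr0 ?oppr_ge0 ?ltW//; [right|exact: sl_H_scale].
Qed.

(** As a function of [c] this is twice the function G of the G-heat equation: the sign of [c]
    selects the variance. *)
Lemma G_quadratic (c v w : R) : E (fun w => X w ^+ 2) = v ->
  E (fun w => - X w ^+ 2) = - w ->
  E (fun w => c * X w ^+ 2) = if 0 <= c then c * v else c * w.
Proof.
move=> Ev Ew; case: ifPn => [c0|].
  by rewrite sl_E_scale ?Ev//; exact: H_exp.
rewrite -ltNge => c0.
have -> : (fun w => c * X w ^+ 2) = (fun w => - c * (- X w ^+ 2)).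
  by apply/funext => t; rewrite mulrNN.
rewrite sl_E_scale ?Ew ?mulrNN// ?oppr_ge0 ?ltW//.
by apply: H_opp; exact: H_exp.
Qed.

(* Composing [G_semi a] and [G_semi b] gives [G_semi (sqrt (a^2 + b^2))]: these
   operators are a semigroup in the time parameter [a ^+ 2]. *)
Definition G_semi a phi x := E (fun w => phi (x + a * X w)).

Lemma H_G_semi a phi x : plip phi -> H (fun w => phi (x + a * X w)).
Proof. by move=> pphi; exact: (H_comp1 HX (plip_comp_affine x a pphi)). Qed.

(** A translation does not change the difference of the arguments, so the constant [L] survives
    every step of the iteration. *)
Lemma G_semi_lip a phi (L : R) : (forall x y, `|phi x - phi y| <= L * `|x - y|) ->
  forall x y, `|G_semi a phi x - G_semi a phi y| <= L * `|x - y|.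
Proof.
move=> pL x y; have pphi := plip_lip pL.
apply: (le_trans (E_dist (H_G_semi a x pphi) (H_G_semi a y pphi))).
rewrite -[leRHS](sl_E_cst S); apply: sl_E_mono => [||w].
- by apply: H_norm; apply: H_sub; exact: H_G_semi.
- exact: sl_H_cst.
- apply: (le_trans (pL _ _)).
  by rewrite opprD addrACA subrr addr0.
Qed.

Lemma G_semi0 phi : G_semi 0 phi = phi.
Proof.
apply/funext => x; rewrite /G_semi; under eq_fun do rewrite mul0r addr0.
exact: sl_E_cst.
Qed.

Lemma G_semiD a b phi : plip phi -> 0 <= a -> 0 <= b ->
  G_semi a (G_semi b phi) = G_semi (Num.sqrt (a ^+ 2 + b ^+ 2)) phi.
Proof.
move=> pphi a0 b0; apply/funext => x; rewrite /G_semi.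
have pphi' : plip (fun y => phi (x + y)).
  have := plip_comp_affine x 1 pphi.
  by under eq_fun do rewrite mul1r.
rewrite -(G_sum pphi' a0 b0).
by congr (sl_E S); apply/funext => w; congr (sl_E S); apply/funext => w'; rewrite addrA.
Qed.

Lemma G_semi_le a phi psi c : plip phi -> plip psi ->
  (forall x, phi x <= psi x + c) -> forall x, G_semi a phi x <= G_semi a psi x + c.
Proof.
move=> pphi ppsi le x; rewrite /G_semi -E_addc; last exact: H_G_semi.
apply: sl_E_mono => [||w]; [exact: H_G_semi| |exact: le].
by apply: sl_H_add; [exact: H_G_semi|exact: sl_H_cst].
Qed.

(** The first order term has upper and lower mean 0, so it drops out exactly despite sublinearity.
    Up to a third moment the law then enters only through its two variances. *)
Lemma G_semi_taylor a psi x (d1 d2 K : R) : 0 <= a -> plip psi ->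
  (forall y, `|psi (x + y) - (psi x + d1 * y + d2 * y ^+ 2 / 2)| <= K * `|y| ^+ 3) ->
  `|G_semi a psi x - (psi x + E (fun w => (d2 * a ^+ 2 / 2) * X w ^+ 2))|
    <= K * a ^+ 3 * E (fun w => `|X w| ^+ 3).
Proof.
move=> a0 ppsi psiK.
have K0 : 0 <= K.
  have := psiK 1; rewrite normr1 !expr1n !mulr1 => h; exact: le_trans h.
have HX2 : H (fun w => (d2 * a ^+ 2 / 2) * X w ^+ 2).
  by apply: sl_H_scale; exact: H_exp.
have HX1 : H (fun w => (d1 * a) * X w) by exact: sl_H_scale.
pose T w := (d2 * a ^+ 2 / 2) * X w ^+ 2 + (d1 * a) * X w + psi x.
have HT : H T by apply: sl_H_add (sl_H_cst S _); exact: sl_H_add.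
have -> : psi x + E (fun w => (d2 * a ^+ 2 / 2) * X w ^+ 2) = E T.
  rewrite /T E_addc; last exact: sl_H_add.
  rewrite (E_add_certain (m := 0)) ?addr0 1?addrC// ?oppr0 ?G_mean//.
  by under eq_fun do rewrite -mulNr; rewrite G_mean.
apply: (le_trans (E_dist (H_G_semi a x ppsi) HT)).
rewrite -sl_E_scale; last 2 first.
- by rewrite mulr_ge0// exprn_ge0.
- by apply: H_exp; exact: H_norm.
apply: sl_E_mono => [||w].
- by apply: H_norm; apply: H_sub => //; exact: H_G_semi.
- by apply: sl_H_scale; apply: H_exp; exact: H_norm.
- have h := psiK (a * X w); rewrite normrM (ger0_norm a0) in h.
  rewrite -(mulrA K) -exprMn;apply: le_trans h; rewrite /T le_eqVlt.
  by apply/orP; left; apply/eqP; congr `|_ - _|; field.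
Qed.

(* Jensen's inequality, through Riemann sums of the average. *)
Lemma G_semi_avg a u (L e : R) : (forall x y, `|u x - u y| <= L * `|x - y|) ->
  0 < e -> forall x, G_semi a (avg e u) x <= avg e (G_semi a u) x.
Proof.
move=> uL e0 x; apply: le_addeps => d d0.
have [N hN] := archi_div (2 * (L * e)) d0.
have N0 : 0 <= N.+1%:R^-1 :> R by rewrite invr_ge0 ler0n.
have h1 y := avg_riemann uL e0 y N.
have h2 := avg_riemann (G_semi_lip a uL) e0 x N.
have pu : plip u := plip_lip uL.
pose v y := N.+1%:R^-1 * \sum_(i < N.+1) u (y + e * i%:R / N.+1%:R).
have pv : plip v.
  apply: plip_mul; first exact: plip_cst.
  apply: plip_sum => i; have := plip_comp_affine (e * i%:R / N.+1%:R) 1 pu.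
  by under eq_fun do rewrite mul1r addrC.
have h3 : G_semi a (avg e u) x <= G_semi a v x + L * e / N.+1%:R.
  apply: G_semi_le => //; first exact: plip_lip (avg_lip uL e0).
  by move=> y; have := h1 y; rewrite ler_norml => /andP[_]; rewrite lerBlDl.
have h4 : G_semi a v x <=
    N.+1%:R^-1 * \sum_(i < N.+1) G_semi a u (x + e * i%:R / N.+1%:R).
  have Hi (i : 'I_N.+1) : H (fun w => u (x + a * X w + e * i%:R / N.+1%:R)).
    have := H_G_semi a (x + e * i%:R / N.+1%:R) pu.
    by under eq_fun do rewrite addrAC.
  rewrite /G_semi /v sl_E_scale//; last exact: H_sum.
  apply: ler_wpM2l => //; apply: (le_trans (E_sum _ Hi)).
  by apply: ler_sum => i _; under eq_fun do rewrite addrAC.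
move: h2 h3 h4 hN; rewrite ler_norml => /andP[+ _].
rewrite -[2 * _ / _]mulrA.
by move: (L * e / _) (_ * \sum_(i < _) _) => b c; lra.
Qed.

End G_normal_theory.

Section clamp.
Variable R : realType.

(* This is [max (-n) (min x n)] for [0 <= n]. *)
Definition clamp (n x : R) : R := (`|x + n| - `|x - n|) / 2.

Lemma clamp_lip n x y : `|clamp n x - clamp n y| <= `|x - y|.
Proof.
rewrite /clamp.
have h1 := ler_dist_dist (x + n) (y + n); have h2 := ler_dist_dist (x - n) (y - n).
have e1 : x + n - (y + n) = x - y by ring.
have e2 : x - n - (y - n) = x - y by ring.
rewrite e1 in h1; rewrite e2 in h2; move: h1 h2.
rewrite ![`|_ - _| <= `|x - y|]ler_norml => /andP[? ?] /andP[? ?].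
by apply/andP; split; lra.
Qed.

Lemma clamp_bounded n x : 0 <= n -> `|clamp n x| <= n.
Proof.
move=> n0; rewrite /clamp.
have := ler_dist_dist (x + n) (x - n).
have -> : x + n - (x - n) = 2 * n by ring.
rewrite (@ger0_norm _ (2 * n)) ?mulr_ge0// !ler_norml => /andP[? ?].
by apply/andP; split; lra.
Qed.

Lemma clampE n x : `|x| <= n -> clamp n x = x.
Proof.
rewrite ler_norml => /andP[h1 h2]; rewrite /clamp.
by rewrite ger0_norm ?ler0_norm; lra.
Qed.

(** Besides bounding the truncation error, this keeps the coefficients of sampled kernels of equal
    sign. *)
Lemma clamp_same_sign n x : 0 <= n -> 0 <= clamp n x * x.
Proof.
move=> n0; rewrite /clamp; have [x0|x0] := leP 0 x.
  apply: mulr_ge0 => //; apply: divr_ge0 => //; rewrite subr_ge0.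
  by rewrite [leRHS]ger0_norm ?addr_ge0// ler_norml; apply/andP; split; lra.
rewrite -mulrNN; apply: mulr_ge0; last by lra.
rewrite -mulNr; apply: divr_ge0 => //; rewrite opprB subr_ge0.
rewrite [leRHS]ler0_norm; last by lra.
by rewrite ler_norml; apply/andP; split; lra.
Qed.

Lemma clamp_le n x : 0 <= n -> `|clamp n x| <= `|x|.
Proof.
by move=> n0; have := clamp_lip n x 0; rewrite /clamp !add0r normrN subrr mul0r !subr0.
Qed.

Lemma clamp_dist n x : 0 < n -> `|x - clamp n x| <= x ^+ 2 / n.
Proof.
move=> n0; have [xn|nx] := leP `|x| n.
  by rewrite clampE// subrr normr0 divr_ge0 ?sqr_ge0 ?ltW.
have h : `|x - clamp n x| <= `|x|.
  have := clamp_le x (ltW n0); have := clamp_same_sign x (ltW n0).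
  have [x0|x0] := ltP 0 x.
    rewrite pmulr_lge0// => c0; rewrite (ger0_norm c0) (gtr0_norm x0) => cx.
    by rewrite ger0_norm; lra.
  have [->|xn0] := eqVneq x 0; first by rewrite normr0 normr_le0 => _ /eqP->; rewrite subrr normr0.
  have xl : x < 0 by rewrite lt_neqAle xn0.
  rewrite nmulr_lge0// => c0; rewrite (ler0_norm c0) (ler0_norm x0) => cx.
  by rewrite ler0_norm; lra.
apply: (le_trans h); rewrite ler_pdivlMr// -real_normK ?num_real// expr2.
by apply: ler_wpM2l => //; exact: ltW.
Qed.

End clamp.

(** * A G-normal law is determined by its two variances *)

Section G_normal_compare.
Variables (R : realType).
Variables (S : sublinear R) (X Xb : S -> R).
Variables (S' : sublinear R) (X' Xb' : S' -> R).
Hypotheses (HX : sl_H S X) (HXb : sl_H S Xb) (ic : independent_copy X Xb).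
Hypothesis GX : forall a b : R, 0 <= a -> 0 <= b ->
        same_distr (law1 (fun w => a * X w + b * Xb w))
                   (law1 (fun w => Num.sqrt (a ^+ 2 + b ^+ 2) * X w)).
Hypotheses (HX' : sl_H S' X') (HXb' : sl_H S' Xb') (ic' : independent_copy X' Xb').
Hypothesis GX' : forall a b : R, 0 <= a -> 0 <= b ->
        same_distr (law1 (fun w => a * X' w + b * Xb' w))
                   (law1 (fun w => Num.sqrt (a ^+ 2 + b ^+ 2) * X' w)).
Variables v w : R.
Hypotheses (Xv : sl_E S (fun t => X t ^+ 2) = v)
  (Xw : sl_E S (fun t => - X t ^+ 2) = - w).
Hypotheses (Xv' : sl_E S' (fun t => X' t ^+ 2) = v)
  (Xw' : sl_E S' (fun t => - X' t ^+ 2) = - w).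
Local Notation P := (G_semi X).
Local Notation Q := (G_semi X').

Section smooth.
Variables (phi : R -> R) (L e : R).
Hypothesis pL : forall x y, `|phi x - phi y| <= L * `|x - y|.
Hypothesis e0 : 0 < e.
Local Notation A := (avg e).

Let d := 4 * L / e ^+ 2 * (sl_E S (fun t => `|X t| ^+ 3) + sl_E S' (fun t => `|X' t| ^+ 3)).

Let A2lip f : (forall x y, `|f x - f y| <= L * `|x - y|) ->
  forall x y, `|A (A f) x - A (A f) y| <= L * `|x - y|.
Proof. by move=> fL; apply: avg_lip => //; exact: avg_lip. Qed.

(** The two expansions share the same value and derivatives of the averaged function and, the
    variances being equal, the same second order term; only the remainders differ. *)
Let one_step a f : 0 <= a -> (forall x y, `|f x - f y| <= L * `|x - y|) ->
  forall x, Q a (A (A f)) x <= P a (A (A f)) x + a ^+ 3 * d.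
Proof.
move=> a0 fL x.
have [d1 [d2 h]] := avg2_taylor fL e0.
have pA : plip (A (A f)) := plip_lip (A2lip fL).
have h1 := G_semi_taylor HX HXb ic GX a0 pA (h x).
have h2 := G_semi_taylor HX' HXb' ic' GX' a0 pA (h x).
rewrite (G_quadratic HX _ Xv Xw) in h1.
rewrite (G_quadratic HX' _ Xv' Xw') in h2.
move: h1 h2; rewrite !ler_norml => /andP[h1 _] /andP[_ h2].
rewrite /d; move: h1 h2.
move: (sl_E S _) (sl_E S' _) (4 * L / _) (a ^+ 3) => m m' k b.
by case: ifP => _; lra.
Qed.

(** The averages stand inside [Q] on the left but outside [P] on the right. Thus each new step is
    compared on the double average of an [L]-Lipschitz function, and Jensen's inequality then moves
    the averages out past the new [P a]. *)
Let compare_iter (m k : nat) : let a := m.+1%:R^-1 in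
  forall x, Q (Num.sqrt k%:R * a) (A (A phi)) x <=
    A (A (P (Num.sqrt k%:R * a) phi)) x + k%:R * (a ^+ 3 * d).
Proof.
move=> a; have a0 : 0 <= a by rewrite invr_ge0.
elim: k => [|k ih] x.
  by rewrite sqrtr0 mul0r !G_semi0 mul0r addr0.
have semiD (T : sublinear R) (Y Yb : T -> R) : sl_H T Y -> sl_H T Yb ->
   independent_copy Y Yb -> (forall a b : R, 0 <= a -> 0 <= b ->
        same_distr (law1 (fun w => a * Y w + b * Yb w))
                   (law1 (fun w => Num.sqrt (a ^+ 2 + b ^+ 2) * Y w))) ->
   forall f, plip f -> G_semi Y (Num.sqrt k.+1%:R * a) f =
     G_semi Y a (G_semi Y (Num.sqrt k%:R * a) f).
  move=> HY HYb icY GY f pf.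
  rewrite (G_semiD HY HYb icY GY pf)//; last by rewrite mulr_ge0 ?sqrtr_ge0.
  congr (G_semi Y _ f); rewrite exprMn sqr_sqrtr//.
  rewrite (_ : a ^+ 2 + k%:R * a ^+ 2 = k.+1%:R * a ^+ 2); last first.
    by rewrite -natr1; ring.
  by rewrite sqrtrM// sqrtr_sqr ger0_norm.
set b := Num.sqrt k%:R * a in ih semiD.
have uL := G_semi_lip HX b pL.
have pA : plip (A (A phi)) := plip_lip (A2lip pL).
rewrite (semiD _ _ _ HX' HXb' ic' GX' _ pA) (semiD _ _ _ HX HXb ic GX _ (plip_lip pL)).
have h1 := G_semi_le HX' a (plip_lip (G_semi_lip HX' b (A2lip pL)))
  (plip_lip (A2lip uL)) ih x.
have h2 := one_step a0 uL x.
have h3 : P a (A (A (P b phi))) x <= A (P a (A (P b phi))) x.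
  by apply: (G_semi_avg HX) => //; exact: avg_lip uL e0.
have h4 : A (P a (A (P b phi))) x <= A (A (P a (P b phi))) x.
  apply: (avg_le (L := L) (M := L)) => //.
  - by apply: (G_semi_lip HX); exact: avg_lip.
  - by apply: avg_lip => //; exact: (G_semi_lip HX).
  - by move=> y; exact: (G_semi_avg HX _ uL).
by rewrite -natr1 mulrDl mul1r; move: h1 h2 h3 h4; lra.
Qed.

Lemma compare_avg x : Q 1 (A (A phi)) x <= A (A (P 1 phi)) x.
Proof.
apply: le_addeps => r r0; have [m hm] := archi_div d r0.
(* With (m + 1)^2 steps of scale a = 1 / (m + 1) the total scale is exactly 1, and the accumulated
   error a^(-2) a^3 d is d / (m + 1). *)
have := compare_iter m (m.+1 ^ 2) x.
rewrite natrX sqrtr_sqr ger0_norm// mulfV ?pnatr_eq0// => h.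
apply: (le_trans h); rewrite lerD2l; apply: le_trans hm.
by rewrite le_eqVlt; apply/orP; left; apply/eqP; field; rewrite nat1r pnatr_eq0.
Qed.

End smooth.

Lemma compare_lip phi (L : R) : (forall x y, `|phi x - phi y| <= L * `|x - y|) ->
  forall x, Q 1 phi x <= P 1 phi x.
Proof.
move=> pL x; apply: le_addeps => r r0.
have L0 := L_ge0 pL.
(* A double average moves an [L]-Lipschitz function by at most 2 L e, and one is removed on each
   side. The summand 1 covers L = 0. *)
pose e := r / (4 * L + 1).
have e0 : 0 < e by rewrite divr_gt0// ltr_pwDr// mulr_ge0.
have eL : 4 * (L * e) <= r.
  rewrite /e mulrA mulrA [_ * r]mulrC -mulrA ger_pMr//.
  by rewrite ler_pdivrMr ?ltr_pwDr ?mulr_ge0//; lra.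
have h := compare_avg pL e0 x.
have d2 f : (forall x y, `|f x - f y| <= L * `|x - y|) -> forall y,
    `|avg e (avg e f) y - f y| <= 2 * (L * e).
  move=> fL y; have h1 := avg_dist fL e0 y.
  have h2 := avg_dist (avg_lip fL e0) e0 y.
  rewrite (_ : _ - f y = (avg e (avg e f) y - avg e f y) + (avg e f y - f y)); last by ring.
  by apply: (le_trans (ler_normD _ _)); lra.
have h1 := d2 _ (G_semi_lip HX 1 pL) x.
have h2 : Q 1 phi x <= Q 1 (avg e (avg e phi)) x + 2 * (L * e).
  apply: (G_semi_le HX'); first exact: plip_lip pL.
    by apply: plip_lip (avg_lip _ e0); exact: avg_lip.
  by move=> y; have := d2 _ pL y; rewrite ler_norml => /andP[]; lra.
move: h1 h2; rewrite ler_norml => /andP[_ h1]; lra.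
Qed.

End G_normal_compare.

Section truncation.
Variables (R : realType) (S : sublinear R) (X : S -> R).
Hypothesis HX : sl_H S X.

Lemma clamp_approx (phi : R -> R) : plip phi -> exists M : R, forall n, 0 < n ->
  `|sl_E S (fun w => phi (X w)) - sl_E S (fun w => phi (clamp n (X w)))| <= M / n.
Proof.
move=> pphi; have := pphi => -[C [k [C0 pC]]].
have HM : sl_H S (fun w => C * ((1 + `|X w|) ^+ (2 * k) * X w ^+ 2)).
  apply: sl_H_scale; apply: H_mul; last exact: H_exp.
  apply: H_exp; apply: sl_H_add; [exact: sl_H_cst|exact: H_norm].
exists (sl_E S (fun w => C * ((1 + `|X w|) ^+ (2 * k) * X w ^+ 2))) => n n0.
have Hc : sl_H S (fun w => phi (clamp n (X w))).
  apply: (H_comp1 HX (phi := fun x => phi (clamp n x))).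
  by apply: plip_comp => //; apply: (@plip_lip _ _ _ _ 1) => x y; rewrite mul1r clamp_lip.
have Hp : sl_H S (fun w => phi (X w)) by exact: (H_comp1 HX).
apply: (le_trans (E_dist Hp Hc)).
have ni0 : 0 <= n^-1 by rewrite invr_ge0 ltW.
rewrite [leRHS]mulrC -sl_E_scale//; apply: sl_E_mono => [||w].
- by apply: H_norm; exact: H_sub.
- exact: sl_H_scale.
- apply: (le_trans (pC _ _)).
  rewrite (_ : n^-1 * _ = C * (1 + `|X w|) ^+ (2 * k) * (X w ^+ 2 / n)); last by ring.
  apply: ler_pM => //; last exact: clamp_dist.
    by rewrite mulr_ge0// exprn_ge0// mulr_ge0// addr_ge0.
  apply: ler_wpM2l => //; rewrite exprM expr2.
  apply: lerXn2r; rewrite ?nnegrE ?mulr_ge0 ?addr_ge0//.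
  apply: ler_pM => //; rewrite ?addr_ge0// lerD2l.
  exact/clamp_le/ltW.
Qed.

End truncation.

(** The comparison used in both directions gives equality on Lipschitz functions. A test function
    composed with [clamp n] is Lipschitz; its constant may grow with [n], since the equality has no
    error term, and the truncation itself costs O(1/n). *)
Theorem G_normal_unique (R : realType) (F F' : distr R 1) (v w : R) :
  G_normal_var F v w -> G_normal_var F' v w -> same_distr F F'.
Proof.
move=> [[S [X [Xb [HX HXb XF ic GX]]]] Fw Fv] [[S' [X' [Xb' [HX' HXb' XF' ic' GX']]]] Fw' Fv'].
have sq n : plip (fun x : R => x ^+ n) by apply: plip_exp; exact: plip_id.
have sqN n : plip (fun x : R => - x ^+ n) by apply: plip_opp.
have EF (phi : R -> R) : plip phi -> sl_E S (fun w => phi (X w)) = F (fun x => phi (x 0 0)).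
  by move=> pphi; have /same_distr1P/(_ _ pphi) := XF; rewrite law1E.
have EF' (phi : R -> R) : plip phi -> sl_E S' (fun w => phi (X' w)) = F' (fun x => phi (x 0 0)).
  by move=> pphi; have /same_distr1P/(_ _ pphi) := XF'; rewrite law1E.
have Xw : sl_E S (fun t => X t ^+ 2) = w by rewrite (EF (fun x => x ^+ 2)).
have Xw' : sl_E S' (fun t => X' t ^+ 2) = w by rewrite (EF' (fun x => x ^+ 2)).
have Xv : sl_E S (fun t => - X t ^+ 2) = - v.
  by rewrite (EF (fun x => - x ^+ 2))// Fv opprK.
have Xv' : sl_E S' (fun t => - X' t ^+ 2) = - v.
  by rewrite (EF' (fun x => - x ^+ 2))// Fv' opprK.
have lip_eq (phi : R -> R) L : (forall x y, `|phi x - phi y| <= L * `|x - y|) ->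
    sl_E S (fun w => phi (X w)) = sl_E S' (fun w => phi (X' w)).
  move=> pL.
  have h1 := compare_lip HX HXb ic GX HX' HXb' ic' GX' Xw Xv Xw' Xv' pL 0.
  have h2 := compare_lip HX' HXb' ic' GX' HX HXb ic GX Xw' Xv' Xw Xv pL 0.
  have e (T : sublinear R) (Y : T -> R) : G_semi Y 1 phi 0 = sl_E T (fun w => phi (Y w)).
    by rewrite /G_semi; under eq_fun do rewrite mul1r add0r.
  by move: h1 h2; rewrite !e => h1 h2; apply/eqP; rewrite eq_le h1 h2.
apply/same_distr1P => phi pphi; rewrite -EF// -EF'//.
have [M hM] := clamp_approx HX pphi; have [M' hM'] := clamp_approx HX' pphi.
have h n : 0 < n -> `|sl_E S (fun w => phi (X w)) - sl_E S' (fun w => phi (X' w))| <=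
    (M + M') / n.
  move=> n0; have := hM n n0; have := hM' n n0.
  have [C [k [C0 pC]]] := pphi.
  rewrite (lip_eq (fun x => phi (clamp n x)) (C * ((1 + n) * (1 + n)) ^+ k)); last first.
    move=> x y; apply: (le_trans (pC _ _)).
    apply: ler_pM => //; last exact: clamp_lip.
      by rewrite mulr_ge0// exprn_ge0// mulr_ge0// addr_ge0.
    have n0' := ltW n0.
    apply: ler_wpM2l => //; apply: lerXn2r; rewrite ?nnegrE ?mulr_ge0 ?addr_ge0//.
    by apply: ler_pM; rewrite ?addr_ge0// lerD2l clamp_bounded.
  rewrite mulrDl => h1 h2; rewrite distrC in h1.
  apply: (le_trans _ (lerD h2 h1)); apply: le_trans (ler_normD _ _).
  by rewrite le_eqVlt; apply/orP; left; apply/eqP; congr `|_|; ring.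
apply/eqP; rewrite -subr_eq0 -normr_le0; apply: le_addeps => r r0.
have [m hm] := archi_div (M + M') r0.
by rewrite add0r; apply: le_trans hm; apply: h; rewrite ltr0n.
Qed.

(** * Laws of the integrals of step functions *)

Section indep_rv.
Variables (R : realType) (S : sublinear R).
Local Notation E := (sl_E S).
Local Notation H := (sl_H S).

(** The scalar form of [independent], with the same direction: [V] is independent of [U]. It lets
    [U] be any test function of finitely many values of a process, such as a sum of increments. *)
Definition indep_rv (U V : S -> R) : Prop :=
  forall phi : R -> R -> R, plip (fun z : R * R => phi z.1 z.2) ->
  E (fun w => phi (U w) (V w)) = E (fun w => E (fun w' => phi (U w) (V w'))).

Lemma independent_rv m n (X : 'I_m -> S -> R) (Y : 'I_n -> S -> R) f g :
  independent X Y -> plip f -> plip g ->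
  indep_rv (fun w => f (vec X w)) (fun w => g (vec Y w)).
Proof.
move=> ind pf pg phi pphi.
apply: (indepE (f := fun x y => phi (f x) (g y)) ind).
apply: (plip_comp pphi (g := fun z => (f z.1, g z.2))).
apply: plip_pair.
  exact: (plip_comp pf (@plip_fst _ _ _)).
exact: (plip_comp pg (@plip_snd _ _ _)).
Qed.

Lemma indep_rv_cross U V : H U -> H V -> indep_rv U V ->
  (forall c, E (fun w => c * V w) = 0) -> forall c, E (fun w => c * (U w * V w)) = 0.
Proof.
move=> HU HV ind V0 c.
have := ind (fun x y => c * (x * y)).
move=> -> //; last first.
  by apply: plip_mul; [exact: plip_cst|exact: plip_mulr].
rewrite -[RHS](sl_E_cst S); congr (sl_E S); apply/funext => w.
by rewrite -[RHS](V0 (c * U w)); congr (sl_E S); apply/funext => w'; rewrite mulrA.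
Qed.

(** Independence is given only from values at times in ]0, t], while sums of increments also involve
    time 0. There [B] vanishes, so time 0 is replaced by [t] and its coordinate masked by [k]; when
    t = 0 all the values vanish and the empty family serves. *)
Lemma brownian_indep_rv slo shi (B : R -> S -> R) m (v : 'I_m -> R) f (t s : R) :
  G_brownian slo shi B -> 0 <= t -> 0 < s -> (forall i, 0 <= v i <= t) -> plip f ->
  indep_rv (fun w => f (vec (fun i => B (v i)) w)) (fun w => B (t + s) w - B t w).
Proof.
move=> [HB B0 inc] t0 s0 vt pf.
have [_ ind] := inc t s t0 s0.
have g0 : plip (fun x : 'rV[R]_1 => x 0 0) by exact: plip_coord.
have e : (fun w => B (t + s) w - B t w) =
   (fun w => vec (fun _ : 'I_1 => fun w => B (t + s) w - B t w) w 0 0).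
  by apply/funext => w; rewrite mxE.
rewrite e; have [tp|tn] := ltP 0 t.
  pose u i := if v i == 0 then t else v i.
  have ut i : 0 < u i <= t.
    rewrite /u; have [_|vi0] := eqVneq (v i) 0; first by rewrite tp lexx.
    by have /andP[h1 ->] := vt i; rewrite andbT lt_neqAle eq_sym vi0.
  pose k (x : 'rV[R]_m) : 'rV[R]_m := \row_i (if v i == 0 then 0 else x 0 i).
  have pk : plip k.
    apply: (@plip_lip _ _ _ _ 1) => x y; rewrite mul1r.
    apply: mx_norm_le => // i j; rewrite !mxE.
    by case: ifP => _; [rewrite subrr normr0|have := mx_coord (x - y) 0 j; rewrite !mxE].
  have -> : (fun w => f (vec (fun i => B (v i)) w)) =
      (fun w => f (k (vec (fun i => B (u i)) w))).
    apply/funext => w; congr f; apply/rowP => i; rewrite !mxE /u.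
    by case: eqP => // ->; rewrite B0.
  exact: (independent_rv (ind m u ut) (plip_comp pf pk) g0).
have u0 (i : 'I_0) : 0 < (fun _ : 'I_0 => 1 : R) i <= t by case: i.
have -> : (fun w => f (vec (fun i => B (v i)) w)) =
    (fun w => (fun=> f 0) (vec (fun i : 'I_0 => B 1) w)).
  apply/funext => w; congr f; apply/rowP => i; rewrite !mxE.
  have -> : v i = 0.
    have /andP[v0 v1] := vt i; apply/eqP; rewrite eq_le v0 andbT.
    exact: le_trans tn.
  by rewrite B0.
exact: (independent_rv (ind 0%N (fun=> 1) u0) (plip_cst _ (f 0)) g0).
Qed.

End indep_rv.

Section scaled_law.
Variables (R : realType).

Lemma G_normal_var_scale (F : distr R 1) (c v w : R) : G_normal_var F v w ->
  G_normal_var (fun phi => F (fun x => phi (c *: x))) (c ^+ 2 * v) (c ^+ 2 * w).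
Proof.
move=> [[S [X [Xb [HX HXb XF ic GX]]]] Fw Fv].
have sq n : plip (fun x : R => x ^+ n) by apply: plip_exp; exact: plip_id.
have EF (phi : R -> R) : plip phi -> sl_E S (fun w => phi (X w)) = F (fun x => phi (x 0 0)).
  by move=> pphi; have /same_distr1P/(_ _ pphi) := XF; rewrite law1E.
have plc n (phi : 'rV[R]_n -> R) : C_lLip phi -> C_lLip (fun x => phi (c *: x)).
  move=> /C_lLip_plip pphi; apply: plip_C_lLip; apply: (plip_comp pphi).
  apply: (@plip_lip _ _ _ _ `|c|) => x y; rewrite -scalerBr.
  apply: mx_norm_le => [|i j]; first by rewrite mulr_ge0.
  by rewrite mxE normrM; apply: ler_wpM2l => //; exact: mx_coord.
have vecc (T : sublinear R) n (Y : 'I_n -> T -> R) t : vec (fun i w => c * Y i w) t = c *: vec Y t.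
  by apply/rowP => i; rewrite !mxE.
split.
- exists S, (fun w => c * X w), (fun w => c * Xb w); split.
  + exact: sl_H_scale.
  + exact: sl_H_scale.
  + move=> phi pphi; rewrite -(XF _ (plc _ _ pphi)) /law1 /law.
    by congr (sl_E S); apply/funext => t; rewrite -vecc.
  + case: ic => ic1 ic2; split=> phi pphi.
      have := ic1 _ (plc _ _ pphi); rewrite /law1 /law.
      under eq_fun do rewrite -(vecc _ _ (fun=> Xb)).
      by under [in X in _ = X -> _]eq_fun do rewrite -(vecc _ _ (fun=> X)).
    have e t t' : phi (row_mx (vec (fun=> (fun w => c * X w)) t) (vec (fun=> (fun w => c * Xb w)) t'))
       = phi (c *: row_mx (vec (fun=> X) t) (vec (fun=> Xb) t')).
      by rewrite scale_row_mx -!vecc.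
    under eq_fun do rewrite e.
    rewrite (ic2 _ (plc _ _ pphi)); congr (sl_E S); apply/funext => t.
    by congr (sl_E S); apply/funext => t'; rewrite e.
  + move=> a b a0 b0; apply/same_distr1P => phi pphi; rewrite !law1E.
    have pphic : plip (fun x => phi (c * x)).
      by have := plip_comp_affine 0 c pphi; under eq_fun do rewrite add0r.
    have /same_distr1P/(_ _ pphic) := GX a b a0 b0; rewrite !(law1E _ (fun y => phi (c * y))) => h.
    transitivity (sl_E S (fun t => phi (c * (a * X t + b * Xb t)))).
      by congr (sl_E S); apply/funext => t; congr phi; ring.
    by rewrite h; congr (sl_E S); apply/funext => t; congr phi; ring.
- have e : (fun x : 'rV[R]_1 => (c *: x) 0 0 ^+ 2) = (fun x => c ^+ 2 * (x 0 0) ^+ 2).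
    by apply/funext => x; rewrite mxE exprMn.
  rewrite e Fw -(EF (fun y => y ^+ 2))// -(EF (fun y => c ^+ 2 * y ^+ 2)); last first.
    by apply: plip_mul => //; exact: plip_cst.
  by rewrite sl_E_scale ?sqr_ge0//; exact: H_exp.
- have e : (fun x : 'rV[R]_1 => - (c *: x) 0 0 ^+ 2) = (fun x => c ^+ 2 * (- (x 0 0) ^+ 2)).
    by apply/funext => x; rewrite mxE exprMn mulrN.
  rewrite e Fv -(EF (fun y => - y ^+ 2)); last exact: plip_opp.
  rewrite -(EF (fun y => c ^+ 2 * (- y ^+ 2))); last first.
    by apply: plip_mul; [exact: plip_cst|exact: plip_opp].
  rewrite sl_E_scale ?sqr_ge0//; first by rewrite mulrN.
  by apply: H_opp; exact: H_exp.
Qed.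

End scaled_law.

Section has_law.
Variables (R : realType) (S0 : sublinear R) (X0 Xb0 : S0 -> R) (vlo vhi : R).
Local Notation E0 := (sl_E S0).
Hypotheses (HX0 : sl_H S0 X0) (HXb0 : sl_H S0 Xb0) (ic0 : independent_copy X0 Xb0).
Hypothesis GX0 : forall a b : R, 0 <= a -> 0 <= b ->
        same_distr (law1 (fun w => a * X0 w + b * Xb0 w))
                   (law1 (fun w => Num.sqrt (a ^+ 2 + b ^+ 2) * X0 w)).
Hypotheses (Xvhi : E0 (fun t => X0 t ^+ 2) = vhi)
  (Xvlo : E0 (fun t => - X0 t ^+ 2) = - vlo).

(** All laws that occur are multiples of [X0], so one real number records the law. The variable [Z]
    may live on a space that contains no independent copy of it. *)
Definition has_law (S : sublinear R) (Z : S -> R) (c : R) : Prop :=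
  forall phi : R -> R, plip phi ->
  sl_E S (fun w => phi (Z w)) = E0 (fun w => phi (c * X0 w)).

Lemma G_normal_var_X0 : G_normal_var (law1 X0) vlo vhi.
Proof.
split.
- by exists S0, X0, Xb0; split.
- by rewrite (law1E X0 (fun x => x ^+ 2)).
- by rewrite (law1E X0 (fun x => - x ^+ 2)) Xvlo opprK.
Qed.

Lemma has_law_G_normal (S : sublinear R) (Z : S -> R) c :
  G_normal_var (law1 Z) (c ^+ 2 * vlo) (c ^+ 2 * vhi) -> has_law Z c.
Proof.
move=> GZ phi pphi.
have := G_normal_unique GZ (G_normal_var_scale c G_normal_var_X0).
move=> /same_distr1P/(_ _ pphi); rewrite law1E => ->.
have := law1E X0 (fun y => phi (c * y)).
by move=> <-; congr (law1 X0); apply/funext => x; rewrite mxE.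
Qed.

(** Symmetry is not part of the definition of G-normality. It follows from uniqueness, since -[X0]
    is G-normal with the same variances. *)
Lemma law_even phi c : plip phi -> E0 (fun w => phi (- c * X0 w)) = E0 (fun w => phi (c * X0 w)).
Proof.
move=> pphi; have h : has_law X0 (-1).
  by apply: has_law_G_normal; rewrite sqrrN expr1n !mul1r; exact: G_normal_var_X0.
have pc : plip (fun x => phi (c * x)).
  by have := plip_comp_affine 0 c pphi; under eq_fun do rewrite add0r.
rewrite (h _ pc); congr (sl_E S0); apply/funext => w; congr phi; ring.
Qed.

Lemma law_abs phi c : plip phi -> E0 (fun w => phi (`|c| * X0 w)) = E0 (fun w => phi (c * X0 w)).
Proof. by move=> pphi; case: (ger0P c) => // _; exact: law_even. Qed.

Lemma plip_law phi b : plip phi -> plip (fun y => E0 (fun w => phi (y + b * X0 w))).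
Proof.
move=> pphi.
have := @plip_E _ S0 1 (fun=> X0) (fun=> HX0) R (fun y x => phi (y + b * x 0 0)).
have -> : (fun x : R => E0 (fun w => phi (x + b * vec (fun _ : 'I_1 => X0) w 0 0))) =
    (fun y : R => E0 (fun w => phi (y + b * X0 w))).
  by apply/funext => y; congr (sl_E S0); apply/funext => w; rewrite mxE.
apply; apply: (plip_comp pphi (g := fun z : R * 'rV[R]_1 => z.1 + b * z.2 0 0)).
apply: plip_add; first exact: plip_fst.
apply: plip_mul; first exact: plip_cst.
exact: (plip_comp (@plip_coord _ _ _ _ _) (@plip_snd _ _ _)).
Qed.

(** Symmetry removes the sign conditions of [G_sum], as the coefficients of a step function are
    arbitrary reals. *)
Lemma law_sum phi a b : plip phi ->
  E0 (fun w => E0 (fun w' => phi (a * X0 w + b * X0 w'))) =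
  E0 (fun w => phi (Num.sqrt (a ^+ 2 + b ^+ 2) * X0 w)).
Proof.
move=> pphi.
rewrite -(law_abs a (plip_law b pphi)) -[a ^+ 2]real_normK ?num_real//.
rewrite -[b ^+ 2]real_normK ?num_real// -(G_sum HX0 HXb0 ic0 GX0 pphi)//.
congr (sl_E S0); apply/funext => w.
rewrite (law_abs (phi := fun y => phi (`|a| * X0 w + y)))//.
by have := plip_comp_affine (`|a| * X0 w) 1 pphi; under eq_fun do rewrite mul1r.
Qed.

Lemma has_law_scale (S : sublinear R) (Z : S -> R) c a :
  has_law Z c -> has_law (fun w => a * Z w) (a * c).
Proof.
move=> h phi pphi.
have pc : plip (fun x => phi (a * x)).
  by have := plip_comp_affine 0 a pphi; under eq_fun do rewrite add0r.
by rewrite (h _ pc); congr (sl_E S0); apply/funext => w; rewrite mulrA.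
Qed.

Lemma has_law0 (S : sublinear R) : has_law (fun _ : S => 0) 0.
Proof.
move=> phi pphi; rewrite sl_E_cst; under eq_fun do rewrite mul0r.
by rewrite sl_E_cst.
Qed.

Lemma has_law_add (S : sublinear R) (U V : S -> R) a b :
  indep_rv U V -> has_law U a -> has_law V b ->
  has_law (fun w => U w + V w) (Num.sqrt (a ^+ 2 + b ^+ 2)).
Proof.
move=> ind hU hV phi pphi.
rewrite (ind (fun x y => phi (x + y))); last first.
  apply: (plip_comp pphi (g := fun z : R * R => z.1 + z.2)).
  by apply: plip_add; [exact: plip_fst|exact: plip_snd].
rewrite -law_sum// -(hU _ (plip_law b pphi)).
congr (sl_E S); apply/funext => w; apply: (hV (fun y => phi (U w + y))).
by have := plip_comp_affine (U w) 1 pphi; under eq_fun do rewrite mul1r.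
Qed.

Lemma has_law_mean (S : sublinear R) (V : S -> R) b : has_law V b ->
  forall c, sl_E S (fun w => c * V w) = 0.
Proof.
move=> hV c; rewrite (hV (fun x => c * x)); last first.
  by apply: plip_mul; [exact: plip_cst|exact: plip_id].
under eq_fun do rewrite mulrA; exact: (G_mean HX0 HXb0 ic0 GX0).
Qed.

Lemma has_law_sqr (S : sublinear R) (V : S -> R) b c : has_law V b -> vlo <= vhi ->
  sl_E S (fun w => c * V w ^+ 2) = b ^+ 2 * (if 0 <= c then c * vhi else c * vlo).
Proof.
move=> hV lohi; rewrite (hV (fun x => c * x ^+ 2)); last first.
  by apply: plip_mul; [exact: plip_cst|apply: plip_exp; exact: plip_id].
have -> : (fun w => c * (b * X0 w) ^+ 2) = (fun w => b ^+ 2 * (c * X0 w ^+ 2)).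
  by apply/funext => w; ring.
rewrite sl_E_scale ?sqr_ge0//; last by apply: sl_H_scale; exact: H_exp.
by rewrite (G_quadratic HX0 _ Xvhi Xvlo).
Qed.

Lemma has_law_norm (S : sublinear R) (V : S -> R) b n : has_law V b ->
  sl_E S (fun w => `|V w| ^+ n) = `|b| ^+ n * E0 (fun w => `|X0 w| ^+ n).
Proof.
move=> hV; rewrite (hV (fun x => `|x| ^+ n)); last first.
  by apply: plip_exp; exact: plip_norm.
rewrite -sl_E_scale ?exprn_ge0//; last by apply: H_exp; exact: H_norm.
by congr (sl_E S0); apply/funext => w; rewrite normrM exprMn.
Qed.

End has_law.

Section brownian.
Variables (R : realType) (S0 : sublinear R) (X0 Xb0 : S0 -> R) (slo shi : R).
Local Notation E0 := (sl_E S0).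
Hypotheses (HX0 : sl_H S0 X0) (HXb0 : sl_H S0 Xb0) (ic0 : independent_copy X0 Xb0).
Hypothesis GX0 : forall a b : R, 0 <= a -> 0 <= b ->
        same_distr (law1 (fun w => a * X0 w + b * Xb0 w))
                   (law1 (fun w => Num.sqrt (a ^+ 2 + b ^+ 2) * X0 w)).
Hypotheses (Xvhi : E0 (fun t => X0 t ^+ 2) = shi ^+ 2)
  (Xvlo : E0 (fun t => - X0 t ^+ 2) = - slo ^+ 2).
Hypothesis lohi : slo ^+ 2 <= shi ^+ 2.
Variable S : sublinear R.
Local Notation E := (sl_E S).
Local Notation H := (sl_H S).
Local Notation has_law := (has_law X0).
Implicit Types (B : R -> S -> R).

Definition sumB B (n : nat) (t a : nat -> R) (w : S) : R :=
  \sum_(i < n) a i * (B (t i.+1) w - B (t i) w).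

Lemma increment_law B (t s : R) : G_brownian slo shi B -> 0 <= t <= s ->
  has_law (fun w => B s w - B t w) (Num.sqrt (s - t)).
Proof.
move=> [HB B0 inc] /andP[t0 ts].
have [->|tns] := eqVneq s t.
  rewrite subrr sqrtr0; under eq_fun do rewrite subrr; exact: has_law0.
have st : 0 < s - t by rewrite subr_gt0 lt_neqAle eq_sym tns.
have [Gn _] := inc t (s - t) t0 st.
apply: (has_law_G_normal HX0 HXb0 ic0 GX0 Xvhi Xvlo).
by rewrite sqr_sqrtr ?ltW// addrC subrK in Gn *.
Qed.

Lemma H_sumB B n (t a : nat -> R) : (forall i, H (B (t i))) -> H (sumB B n t a).
Proof.
move=> HB; apply: H_sum => i; apply: sl_H_scale; exact: H_sub.
Qed.

Lemma sumB_vec B n (t a : nat -> R) : exists2 f : 'rV[R]_(n.+1) -> R, plip f &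
  sumB B n t a = (fun w => f (vec (fun i : 'I_n.+1 => B (t i)) w)).
Proof.
exists (fun x => \sum_(i < n) a i * (x 0 (inord i.+1) - x 0 (inord i))).
  apply: plip_sum => i; apply: plip_mul; first exact: plip_cst.
  by apply: plip_sub; exact: plip_coord.
apply/funext => w; apply: eq_bigr => i _; rewrite !mxE.
have i1 := ltn_ord i.
by rewrite !inordK// ltnS// ltnW.
Qed.

Lemma one_sided_law B n (t a : nat -> R) : G_brownian slo shi B -> (forall i, 0 <= t i) ->
  {homo t : i j / (i <= j)%N >-> i <= j} ->
  has_law (sumB B n t a) (Num.sqrt (\sum_(i < n) a i ^+ 2 * (t i.+1 - t i))).
Proof.
move=> GB t0 tm; have [HB B0 _] := GB; elim: n => [|n ih].
  rewrite big_ord0 sqrtr0 /sumB; under eq_fun do rewrite big_ord0; exact: has_law0.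
have tS : t n <= t n.+1 by apply: tm.
have hinc : has_law (fun w => a n * (B (t n.+1) w - B (t n) w))
    (a n * Num.sqrt (t n.+1 - t n)).
  by apply: has_law_scale; apply: increment_law => //; rewrite t0.
have s0 : 0 <= \sum_(i < n) a i ^+ 2 * (t i.+1 - t i).
  by apply: sumr_ge0 => i _; rewrite mulr_ge0 ?sqr_ge0// subr_ge0; apply: tm.
have eS : sumB B n.+1 t a =
    (fun w => sumB B n t a w + a n * (B (t n.+1) w - B (t n) w)).
  by apply/funext => w; rewrite /sumB big_ord_recr.
(* Repeated times must be allowed, because the positive part of a two-sided grid repeats 0;
   independence of the last increment needs a positive length. *)
have [e|tne] := eqVneq (t n.+1) (t n).
  rewrite eS big_ord_recr/= e subrr mulr0 addr0.
  by under eq_fun do rewrite subrr mulr0 addr0.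
have [f pf ef] := sumB_vec B n t a.
have st : 0 < t n.+1 - t n by rewrite subr_gt0 lt_neqAle eq_sym tne.
have vt (i : 'I_n.+1) : 0 <= t i <= t n by rewrite t0/= tm// -ltnS.
have ind : indep_rv (sumB B n t a) (fun w => a n * (B (t n.+1) w - B (t n) w)).
  move=> phi pphi; have := brownian_indep_rv GB (t0 n) st vt pf.
  rewrite -ef addrC subrK => /(_ (fun x y => phi x (a n * y))); apply.
  apply: (plip_comp pphi (g := fun z : R * R => (z.1, a n * z.2))).
  apply: plip_pair; first exact: plip_fst.
  by apply: plip_mul; [exact: plip_cst|exact: plip_snd].
have := has_law_add HX0 HXb0 ic0 GX0 Xvhi Xvlo ind ih hinc.
rewrite -eS sqr_sqrtr// exprMn sqr_sqrtr ?subr_ge0//.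
by rewrite big_ord_recr.
Qed.

Definition ppart (x : R) := Num.max x 0.

Lemma ppart_ge0 x : 0 <= ppart x.
Proof. by rewrite /ppart le_max lexx orbT. Qed.

Lemma ppart_le x y : x <= y -> ppart x <= ppart y.
Proof. by move=> xy; rewrite /ppart ge_max !le_max xy lexx orbT. Qed.

Lemma ppart_sub x : ppart x - ppart (- x) = x.
Proof. by rewrite /ppart; case: (leP x 0) => x0; case: (leP (- x) 0) => y0; lra. Qed.

Section two_sided.
Variables (B B1 B2 : R -> S -> R).
Hypotheses (GB1 : G_brownian slo shi B1) (GB2 : G_brownian slo shi B2).
Hypothesis ind12 : process_independent B1 B2 \/ process_independent B2 B1.
Hypotheses (Bpos : forall t : R, 0 <= t -> B t = B1 t)
  (Bneg : forall t : R, t <= 0 -> B t = B2 (- t)).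

(** One of the two terms always vanishes. In this form a grid need not be split at 0. *)
Lemma BE (t : R) w : B t w = B1 (ppart t) w + B2 (ppart (- t)) w.
Proof.
have [_ B10 _] := GB1; have [_ B20 _] := GB2.
have [t0|t0] := leP t 0.
  rewrite Bneg// /ppart max_r// max_l; last by lra.
  by rewrite B10 add0r.
rewrite Bpos ?(ltW t0)// /ppart max_l ?(ltW t0)// max_r; last by lra.
by rewrite B20 addr0.
Qed.

Lemma H_B (t : R) : H (B t).
Proof.
have [HB1 _ _] := GB1; have [HB2 _ _] := GB2.
have -> : B t = (fun w => B1 (ppart t) w + B2 (ppart (- t)) w).
  by apply/funext => w; exact: BE.
by apply: sl_H_add; [exact: HB1 (ppart_ge0 _)|exact: HB2 (ppart_ge0 _)].
Qed.

Lemma indep12 m n (s : 'I_m -> R) (t : 'I_n -> R) f g :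
  (forall i, 0 <= s i) -> (forall i, 0 <= t i) -> plip f -> plip g ->
  let U w := f (vec (fun i => B1 (s i)) w) in
  let V w := g (vec (fun i => B2 (t i)) w) in indep_rv U V \/ indep_rv V U.
Proof.
move=> s0 t0 pf pg; case: ind12 => ind; [left|right].
  exact: (independent_rv (ind _ _ _ _ s0 t0)).
exact: (independent_rv (ind _ _ _ _ t0 s0)).
Qed.

Lemma sumB_law n (t a : nat -> R) : {homo t : i j / (i <= j)%N >-> i <= j} ->
  has_law (sumB B n t a) (Num.sqrt (\sum_(i < n) a i ^+ 2 * (t i.+1 - t i))).
Proof.
move=> tm.
pose t1 i := ppart (t i); pose t2 i := ppart (- t i).
(* The times of [B2] decrease along the grid, so its sum is read backwards; each increment then
   changes sign, whence the sign in [b]. *)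
pose r i := t2 (n - i)%N; pose b i := - a (n - i.+1)%N.
have h1 : has_law (sumB B1 n t1 a) _ := one_sided_law n a GB1
  (fun i => ppart_ge0 _) (fun i j ij => ppart_le (tm i j ij)).
have rm : {homo r : i j / (i <= j)%N >-> i <= j}.
  by move=> i j ij; apply: ppart_le; rewrite lerN2; apply: tm; exact: leq_sub2l.
have h2 : has_law (sumB B2 n r b) _ := one_sided_law n b GB2
  (fun i => ppart_ge0 _) rm.
have rev1 (F : nat -> R) : \sum_(i < n) F (n - i.+1)%N = \sum_(i < n) F i.
  by rewrite [RHS](reindex_inj rev_ord_inj).
have nS (i : 'I_n) : (n - i = (n - i.+1).+1)%N by rewrite subnSK.
have e : sumB B n t a = (fun w => sumB B1 n t1 a w + sumB B2 n r b w).
  apply/funext => w; rewrite /sumB.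
  have -> : \sum_(i < n) b i * (B2 (r i.+1) w - B2 (r i) w) =
      \sum_(i < n) a i * (B2 (t2 i.+1) w - B2 (t2 i) w).
    rewrite -(rev1 (fun i => a i * (B2 (t2 i.+1) w - B2 (t2 i) w))).
    by apply: eq_bigr => i _; rewrite /b /r (nS i) mulNr -mulrN opprB.
  rewrite -big_split/=; apply: eq_bigr => i _; rewrite -mulrDr !BE /t1 /t2.
  by congr (_ * _); ring.
have [f pf ef] := sumB_vec B1 n t1 a; have [g pg eg] := sumB_vec B2 n r b.
have s1 : 0 <= \sum_(i < n) a i ^+ 2 * (t1 i.+1 - t1 i).
  by apply: sumr_ge0 => i _; rewrite mulr_ge0 ?sqr_ge0// subr_ge0; apply/ppart_le/tm.
have s2 : 0 <= \sum_(i < n) b i ^+ 2 * (r i.+1 - r i).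
  by apply: sumr_ge0 => i _; rewrite mulr_ge0 ?sqr_ge0// subr_ge0; apply: rm.
have es : \sum_(i < n) a i ^+ 2 * (t1 i.+1 - t1 i) +
    \sum_(i < n) b i ^+ 2 * (r i.+1 - r i) = \sum_(i < n) a i ^+ 2 * (t i.+1 - t i).
  have -> : \sum_(i < n) b i ^+ 2 * (r i.+1 - r i) =
      \sum_(i < n) a i ^+ 2 * (t2 i - t2 i.+1).
    rewrite -(rev1 (fun i => a i ^+ 2 * (t2 i - t2 i.+1))).
    by apply: eq_bigr => i _; rewrite /b /r (nS i) sqrrN.
  rewrite -big_split/=; apply: eq_bigr => i _; rewrite -mulrDr; congr (_ * _).
  by rewrite /t1 /t2 -[in RHS](ppart_sub (t i)) -[in RHS](ppart_sub (t i.+1)); ring.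
rewrite e -es.
have := @indep12 n.+1 n.+1 (fun i => t1 i) (fun i => r i) f g
  (fun i => ppart_ge0 _) (fun i => ppart_ge0 _) pf pg.
rewrite /= -ef -eg => -[ind|ind].
  have := has_law_add HX0 HXb0 ic0 GX0 Xvhi Xvlo ind h1 h2.
  by rewrite !sqr_sqrtr.
have := has_law_add HX0 HXb0 ic0 GX0 Xvhi Xvlo ind h2 h1.
rewrite !sqr_sqrtr// [X in Num.sqrt X]addrC.
by under eq_fun do rewrite addrC.
Qed.

Lemma increment_mean B' (r s : R) : G_brownian slo shi B' -> 0 <= r -> 0 <= s ->
  forall c : R, E (fun w => c * (B' s w - B' r w)) = 0.
Proof.
move=> GB' r0 s0; have [rs|sr] := leP r s.
  have h : has_law (fun w => B' s w - B' r w) _ := increment_law GB' (introT andP (conj r0 rs)).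
  exact: (has_law_mean HX0 HXb0 ic0 GX0 h).
move=> c; have h : has_law (fun w => B' r w - B' s w) _ :=
  increment_law GB' (introT andP (conj s0 (ltW sr))).
rewrite -(has_law_mean HX0 HXb0 ic0 GX0 h (- c)).
by congr (sl_E S); apply/funext => w; ring.
Qed.

Lemma increments_cross B' (r s t u : R) : G_brownian slo shi B' ->
  0 <= r <= s -> s <= t <= u ->
  forall c : R, E (fun w => c * ((B' s w - B' r w) * (B' u w - B' t w))) = 0.
Proof.
move=> GB' /andP[r0 rs] /andP[st tu] c; have [HB' _ _] := GB'.
have s0 : 0 <= s by exact: le_trans rs.
have t0 : 0 <= t by exact: le_trans st.
have [->|tnu] := eqVneq u t.
  by under eq_fun do rewrite subrr !mulr0; rewrite sl_E_cst.
have ut : 0 < u - t by rewrite subr_gt0 lt_neqAle eq_sym tnu.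
pose v (i : 'I_2) := if i == 0 then r else s.
have vt i : 0 <= v i <= t.
  by rewrite /v; case: ifP => _; rewrite ?r0 ?s0 ?st//=; exact: le_trans rs st.
have pf : plip (fun x : 'rV[R]_2 => x 0 1 - x 0 0).
  by apply: plip_sub; exact: plip_coord.
have := brownian_indep_rv GB' t0 ut vt pf.
rewrite addrC subrK => ind.
have e : (fun w => vec (fun i => B' (v i)) w 0 1 - vec (fun i => B' (v i)) w 0 0) =
    (fun w => B' s w - B' r w).
  by apply/funext => w; rewrite !mxE.
rewrite e in ind; apply: (indep_rv_cross _ _ ind).
- by apply: H_sub; exact: HB'.
- by apply: H_sub; apply: HB' => //; exact: le_trans tu.
- by apply: increment_mean => //; exact: le_trans tu.
Qed.

Lemma increments_cross12 (r s t u : R) : 0 <= r -> 0 <= s -> 0 <= t -> 0 <= u ->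
  forall c : R, E (fun w => c * ((B1 s w - B1 r w) * (B2 u w - B2 t w))) = 0.
Proof.
move=> r0 s0 t0 u0 c; have [HB1 _ _] := GB1; have [HB2 _ _] := GB2.
pose v (x y : R) (i : 'I_2) := if i == 0 then x else y.
have v0 x y i : 0 <= x -> 0 <= y -> 0 <= v x y i by rewrite /v; case: ifP.
have pf : plip (fun x : 'rV[R]_2 => x 0 1 - x 0 0).
  by apply: plip_sub; exact: plip_coord.
have e (B' : R -> S -> R) x y :
    (fun w => vec (fun i => B' (v x y i)) w 0 1 - vec (fun i => B' (v x y i)) w 0 0) =
    (fun w => B' y w - B' x w).
  by apply/funext => w; rewrite !mxE.
have := @indep12 2 2 (v r s) (v t u) _ _ (fun i => v0 r s i r0 s0)
  (fun i => v0 t u i t0 u0) pf pf.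
rewrite /= !e => -[ind|ind].
  apply: (indep_rv_cross _ _ ind); last exact: increment_mean.
    by apply: H_sub; exact: HB1.
  by apply: H_sub; exact: HB2.
under eq_fun do rewrite (mulrC (B1 s _ - _)).
apply: (indep_rv_cross _ _ ind); last exact: increment_mean.
  by apply: H_sub; exact: HB2.
by apply: H_sub; exact: HB1.
Qed.

(** Each increment splits into a [B1] part and a [B2] part, and each of the four products has
    expectation 0; sub-additivity leaves an inequality, which suffices for an upper bound. Time
    being reversed for [B2], the two intervals exchange their roles there. *)
Lemma increments_cross2 (r s t u : R) : r <= s -> s <= t -> t <= u ->
  forall c : R, E (fun w => c * ((B s w - B r w) * (B u w - B t w))) <= 0.
Proof.
move=> rs st tu c; have [HB1 _ _] := GB1; have [HB2 _ _] := GB2.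
pose U1 w := B1 (ppart s) w - B1 (ppart r) w.
pose U2 w := B2 (ppart (- s)) w - B2 (ppart (- r)) w.
pose V1 w := B1 (ppart u) w - B1 (ppart t) w.
pose V2 w := B2 (ppart (- u)) w - B2 (ppart (- t)) w.
have HU1 : H U1 by apply: H_sub; exact: HB1 (ppart_ge0 _).
have HU2 : H U2 by apply: H_sub; exact: HB2 (ppart_ge0 _).
have HV1 : H V1 by apply: H_sub; exact: HB1 (ppart_ge0 _).
have HV2 : H V2 by apply: H_sub; exact: HB2 (ppart_ge0 _).
have p0 := ppart_ge0.
have -> : (fun w => c * ((B s w - B r w) * (B u w - B t w))) =
   (fun w => (c * (U1 w * V1 w) + c * (U2 w * V2 w)) +
             (c * (U1 w * V2 w) + c * (U2 w * V1 w))).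
  by apply/funext => w; rewrite !BE /U1 /U2 /V1 /V2; ring.
have Hc U V : H U -> H V -> H (fun w => c * (U w * V w)).
  by move=> HU HV; apply: sl_H_scale; exact: H_mul.
have z1 : E (fun w => c * (U1 w * V1 w)) = 0.
  by apply: (increments_cross GB1); rewrite ?p0/= ?ppart_le.
have z2 : E (fun w => c * (U2 w * V2 w)) = 0.
  have -> : (fun w => c * (U2 w * V2 w)) = (fun w => c *
     ((B2 (ppart (- t)) w - B2 (ppart (- u)) w) * (B2 (ppart (- r)) w - B2 (ppart (- s)) w))).
    by apply/funext => w; rewrite /U2 /V2; ring.
  by apply: (increments_cross GB2); rewrite ?p0/= ?ppart_le// lerN2.
have z3 : E (fun w => c * (U1 w * V2 w)) = 0 by exact: increments_cross12.
have z4 : E (fun w => c * (U2 w * V1 w)) = 0.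
  by under eq_fun do rewrite (mulrC (U2 _)); exact: increments_cross12.
apply: (le_trans (sl_E_add (sl_H_add (Hc _ _ HU1 HV1) (Hc _ _ HU2 HV2))
  (sl_H_add (Hc _ _ HU1 HV2) (Hc _ _ HU2 HV1)))).
have := sl_E_add (Hc _ _ HU1 HV1) (Hc _ _ HU2 HV2).
have := sl_E_add (Hc _ _ HU1 HV2) (Hc _ _ HU2 HV1).
rewrite z1 z2 z3 z4; lra.
Qed.

Section product.
Variables (n : nat) (t a c : nat -> R).
Hypothesis tm : {homo t : i j / (i <= j)%N >-> i <= j}.
Hypothesis ac : forall i, 0 <= a i * c i.
Local Notation X := (sumB B n t a).
Local Notation Y := (sumB B n t c).
Local Notation s := (\sum_(i < n) a i * c i * (t i.+1 - t i)).

Let D i w := B (t i.+1) w - B (t i) w.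

Let HD i : H (D i).
Proof. by apply: H_sub; exact: H_B. Qed.

(* Expanding the product, the cross terms have nonpositive expectation and the
   diagonal ones are squares of increments. *)
Lemma sumB_prod_le (e : R) : E (fun w => e * (X w * Y w)) <=
  \sum_(i < n) (t i.+1 - t i) *
    (if 0 <= e * (a i * c i) then e * (a i * c i) * shi ^+ 2
     else e * (a i * c i) * slo ^+ 2).
Proof.
have -> : (fun w => e * (X w * Y w)) =
    (fun w => \sum_(i < n) \sum_(j < n) e * (a i * c j) * (D i w * D j w)).
  apply/funext => w; rewrite /sumB big_distrlr mulr_sumr; apply: eq_bigr => i _.
  rewrite mulr_sumr; apply: eq_bigr => j _; rewrite /D/=; ring.
have Hij i j : H (fun w => e * (a i * c j) * (D i w * D j w)).
  by apply: sl_H_scale; exact: H_mul.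
apply: (le_trans (E_sum _ _)) => [i|]; first exact: H_sum.
apply: ler_sum => i _; apply: (le_trans (E_sum _ _)) => [j|]; first exact: Hij.
rewrite (bigD1 i)//= -[leRHS]addr0; apply: lerD.
  have hi : has_law (D i) (Num.sqrt (t i.+1 - t i)).
    pose u k := t (i + k)%N.
    have um : {homo u : k l / (k <= l)%N >-> k <= l}.
      by move=> k l kl; apply: tm; rewrite leq_add2l.
    have eD : sumB B 1 u (fun=> 1) = D i.
      by apply/funext => w; rewrite /sumB big_ord1 mul1r /u addn0 addn1.
    have := sumB_law 1 (fun=> 1) um.
    by rewrite eD big_ord1 expr1n mul1r /u addn0 addn1.
  have := has_law_sqr HX0 Xvhi Xvlo (e * (a i * c i)) hi lohi.
  rewrite sqr_sqrtr ?subr_ge0; last exact: tm.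
  by under eq_fun do rewrite expr2; move=> ->.
apply: sumr_le0 => j ji.
have [ij|] := ltnP i j.
  apply: increments_cross2; apply: tm => //.
rewrite leq_eqVlt => /orP[/eqP e'|ji'].
  by move: ji; rewrite -val_eqE/= e' eqxx.
under eq_fun do rewrite (mulrC (D i _)).
by apply: increments_cross2; apply: tm.
Qed.

Let s0 : 0 <= s.
Proof. by apply: sumr_ge0 => i _; rewrite mulr_ge0// subr_ge0; exact: tm. Qed.

Let HX : H X. Proof. by apply: H_sumB => i; exact: H_B. Qed.
Let HY : H Y. Proof. by apply: H_sumB => i; exact: H_B. Qed.

Let sqrE (f : nat -> R) e : E (fun w => e * sumB B n t f w ^+ 2) =
  (\sum_(i < n) f i ^+ 2 * (t i.+1 - t i)) *
  (if 0 <= e then e * shi ^+ 2 else e * slo ^+ 2).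
Proof.
rewrite (has_law_sqr HX0 Xvhi Xvlo e (sumB_law n f tm) lohi) sqr_sqrtr//.
by apply: sumr_ge0 => i _; rewrite mulr_ge0 ?sqr_ge0// subr_ge0; exact: tm.
Qed.

(** Polarization 4XY = (X + Y)^2 - (X - Y)^2 together with E[U] - E[V] <= E[U - V]. This bounds the
    product from below, where expansion bounds it from above. *)
Let polar (e : R) : `|e| = 1 -> E (fun w => e * sumB B n t (fun i => a i + c i) w ^+ 2) -
   E (fun w => e * sumB B n t (fun i => a i - c i) w ^+ 2) <= 4 * E (fun w => e * (X w * Y w)).
Proof.
move=> e1; rewrite -sl_E_scale//; last by apply: sl_H_scale; exact: H_mul.
have HS f : H (fun w => e * sumB B n t f w ^+ 2).
  by apply: sl_H_scale; apply: H_exp; apply: H_sumB => i; exact: H_B.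
apply: (le_trans (E_sub (HS _) (HS _))); rewrite le_eqVlt; apply/orP; left; apply/eqP.
congr (sl_E S); apply/funext => w.
have -> : sumB B n t (fun i => a i + c i) w = X w + Y w.
  by rewrite /sumB -big_split; apply: eq_bigr => i _; rewrite mulrDl.
have -> : sumB B n t (fun i => a i - c i) w = X w - Y w.
  by rewrite /sumB -sumrB; apply: eq_bigr => i _; rewrite mulrBl.
by ring.
Qed.

Let polar_sum : \sum_(i < n) (a i + c i) ^+ 2 * (t i.+1 - t i) -
  \sum_(i < n) (a i - c i) ^+ 2 * (t i.+1 - t i) = 4 * s.
Proof. by rewrite -sumrB mulr_sumr; apply: eq_bigr => i _; ring. Qed.

(** Since all [a i * c i] are nonnegative, every diagonal term selects the same variance, and the
    bounds from expansion and polarization coincide. With the sign reversed, the lower variance is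
    selected throughout. *)
Lemma sumB_prod : E (fun w => X w * Y w) = shi ^+ 2 * s.
Proof.
apply/eqP; rewrite eq_le; apply/andP; split.
  have := sumB_prod_le 1; under eq_fun do rewrite mul1r.
  move=> h; apply: (le_trans h); rewrite mulr_sumr; apply: ler_sum => i _.
  by rewrite mul1r ac le_eqVlt; apply/orP; left; apply/eqP; ring.
have := polar (normr1 R); rewrite !sqrE ler01 mul1r -mulrBl polar_sum.
by under [X in _ <= 4 * E X]eq_fun do rewrite mul1r; lra.
Qed.

Lemma sumB_prodN : E (fun w => - (X w * Y w)) = - (slo ^+ 2 * s).
Proof.
apply/eqP; rewrite eq_le; apply/andP; split.
  have := sumB_prod_le (-1); under eq_fun do rewrite mulN1r.
  move=> h; apply: (le_trans h); rewrite -mulrN -sumrN mulr_sumr; apply: ler_sum => i _.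
  rewrite mulN1r oppr_ge0; case: ifPn => [ac0|_].
    have -> : a i * c i = 0 by apply/eqP; rewrite eq_le ac0 ac.
    by rewrite !(mul0r, oppr0, mulr0).
  by rewrite le_eqVlt; apply/orP; left; apply/eqP; ring.
have := polar (normrN1 R); rewrite !sqrE oppr_ge0 ler10 mulN1r -mulrBl polar_sum.
by under [X in _ <= 4 * E X]eq_fun do rewrite mulN1r; lra.
Qed.

End product.

End two_sided.
End brownian.

(** * The completion of the space of random variables *)

Section cvg0.
Variable R : realType.

Lemma cvg0P (u : nat -> R) : (forall n, 0 <= u n) ->
  (u n @[n --> \oo] --> 0) <->
  (forall e : R, 0 < e -> exists N, forall n, (N <= n)%N -> u n < e).
Proof.
move=> u0; split=> [/cvgrPdist_lt h e e0|h].
  have [N _ HN] := h e e0; exists N => n Nn.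
  by have := HN n Nn; rewrite sub0r normrN ger0_norm.
apply/cvgrPdist_lt => e e0; have [N HN] := h e e0.
exists N => // n /= Nn; rewrite sub0r normrN ger0_norm//; exact: HN.
Qed.

Lemma split_le (a b p q d : R) : a < p + d / 2 -> b < q + d / 2 -> a + b <= p + q + d.
Proof. lra. Qed.

Lemma le_sqr_add (a b c x y z : R) : 0 <= a -> 0 <= b -> 0 <= c ->
  c ^+ 2 = z -> a ^+ 2 = x -> b ^+ 2 = y -> z <= x + 2 * (a * b) + y -> c <= a + b.
Proof.
move=> a0 b0 c0 <- <- <- h; rewrite -(@ler_pXn2r _ 2)// ?nnegrE ?addr_ge0//.
by apply: (le_trans h); rewrite le_eqVlt; apply/orP; left; apply/eqP; ring.
Qed.

Lemma half_lt (a b e : R) : a < e / 2 -> b < e / 2 -> a + b < e.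
Proof. lra. Qed.

Lemma third_lt (a b e : R) : 0 < e -> a <= e / 3 -> b < e / 3 -> a + b < e.
Proof. lra. Qed.

Lemma cauchy_cvgn (u : nat -> R) :
  (forall e : R, 0 < e -> exists N, forall j k, (N <= j)%N -> (N <= k)%N ->
     `|u j - u k| < e) -> cvgn u.
Proof.
move=> h; apply/cauchy_cvgP/cauchyP => e e0.
have [N HN] := h e e0; exists (u N).
exists N => // n /= Nn; rewrite /ball/=; exact: HN.
Qed.

End cvg0.

Section Gnorm.
Variables (R : realType) (S : sublinear R).
Implicit Types X Y Z : S -> R.
Local Notation E := (sl_E S).
Local Notation H := (sl_H S).

Lemma E_sqr_ge0 X : H X -> 0 <= E (fun w => X w ^+ 2).
Proof. by move=> HX; apply: E_ge0 => [|w]; [exact: H_exp|exact: sqr_ge0]. Qed.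

Lemma Gnorm_ge0 p X : 0 <= Gnorm p X.
Proof. exact: powR_ge0. Qed.

Lemma Gnorm_opp p X : Gnorm p (fun w => - X w) = Gnorm p X.
Proof. by rewrite /Gnorm; under eq_fun do rewrite normrN. Qed.

Lemma Gnorm_normr p X : Gnorm p (fun w => `|X w|) = Gnorm p X.
Proof. by rewrite /Gnorm; under eq_fun do rewrite normr_id. Qed.

Local Opaque Gnorm.

Lemma E_cauchy_schwarz X Y : H X -> H Y ->
  E (fun w => X w * Y w) <= Gnorm 2 X * Gnorm 2 Y.
Proof.
move=> HX HY; rewrite !Gnorm2//.
set a := Num.sqrt _; set b := Num.sqrt _.
have a0 : 0 <= a by exact: sqrtr_ge0.
have b0 : 0 <= b by exact: sqrtr_ge0.
have aE : a ^+ 2 = E (fun w => X w ^+ 2) by rewrite sqr_sqrtr// E_sqr_ge0.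
have bE : b ^+ 2 = E (fun w => Y w ^+ 2) by rewrite sqr_sqrtr// E_sqr_ge0.
(* The weights in Young's inequality are quotients of the two norms. These may be 0, so both are
   enlarged by [d], which then tends to 0. *)
have h (d : R) : 0 < d -> E (fun w => X w * Y w) <= (a + d) * (b + d).
  move=> d0; set x := a + d; set y := b + d.
  have x0 : 0 < x by rewrite ltr_wpDl.
  have y0 : 0 < y by rewrite ltr_wpDl.
  have p0 : 0 <= y / (2 * x) by rewrite divr_ge0// ?mulr_ge0// ltW.
  have q0 : 0 <= x / (2 * y) by rewrite divr_ge0// ?mulr_ge0// ltW.
  have H1 : H (fun w => y / (2 * x) * X w ^+ 2) by apply: sl_H_scale; exact: H_exp.
  have H2 : H (fun w => x / (2 * y) * Y w ^+ 2) by apply: sl_H_scale; exact: H_exp.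
  apply: (@le_trans _ _ (E (fun w => y / (2 * x) * X w ^+ 2 + x / (2 * y) * Y w ^+ 2))).
    apply: sl_E_mono => [||w]; [exact: H_mul|exact: sl_H_add|].
    rewrite -subr_ge0.
    have -> : y / (2 * x) * X w ^+ 2 + x / (2 * y) * Y w ^+ 2 - X w * Y w =
        (y * X w - x * Y w) ^+ 2 / (2 * x * y) by field; rewrite !lt0r_neq0.
    by rewrite divr_ge0 ?sqr_ge0// !mulr_ge0// ltW.
  apply: (le_trans (sl_E_add H1 H2)).
  rewrite !sl_E_scale//; try exact: H_exp.
  rewrite -aE -bE.
  apply: (@le_trans _ _ (y / (2 * x) * x ^+ 2 + x / (2 * y) * y ^+ 2)).
    apply: lerD; apply: ler_wpM2l => //; apply: lerXn2r; rewrite ?nnegrE//.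
    - exact: ltW.
    - by rewrite /x lerDl ltW.
    - exact: ltW.
    - by rewrite /y lerDl ltW.
  by rewrite le_eqVlt; apply/orP; left; apply/eqP; field; rewrite !lt0r_neq0.
apply: le_addeps => r r0.
pose c := a + b + 1; have c0 : 0 < c by rewrite /c ltr_wpDl// addr_ge0.
pose d := Num.min 1 (r / c).
have d0 : 0 < d by rewrite /d lt_min ltr01 divr_gt0.
apply: (le_trans (h d d0)).
have d1 : d <= 1 by rewrite /d ge_min lexx.
have dc : d * c <= r by rewrite -ler_pdivlMr// /d ge_min lexx orbT.
have : d * d <= d by rewrite ger_pMr.
have -> : (a + d) * (b + d) = a * b + (d * (a + b) + d * d) by ring.
rewrite lerD2l; move: dc; rewrite /c mulrDr mulr1; lra.
Qed.

Lemma Gnorm2_sqr X : H X -> Gnorm 2 X ^+ 2 = E (fun w => X w ^+ 2).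
Proof. by move=> HX; rewrite Gnorm2// sqr_sqrtr// E_sqr_ge0. Qed.

Lemma Gnorm2_triangle X Y : H X -> H Y ->
  Gnorm 2 (fun w => X w + Y w) <= Gnorm 2 X + Gnorm 2 Y.
Proof.
move=> HX HY; have HXY := sl_H_add HX HY.
apply: (le_sqr_add (Gnorm_ge0 2 X) (Gnorm_ge0 2 Y) (Gnorm_ge0 2 (fun w => X w + Y w))
  (Gnorm2_sqr HXY) (Gnorm2_sqr HX) (Gnorm2_sqr HY)).
have -> : (fun w => (X w + Y w) ^+ 2) =
    (fun w => (X w ^+ 2 + 2 * (X w * Y w)) + Y w ^+ 2).
  by apply/funext => w; ring.
have HM : H (fun w => 2 * (X w * Y w)) by apply: sl_H_scale; exact: H_mul.
have HX2 : H (fun w => X w ^+ 2) by exact: H_exp.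
have HY2 : H (fun w => Y w ^+ 2) by exact: H_exp.
apply: (le_trans (sl_E_add (sl_H_add HX2 HM) HY2)); rewrite lerD2r.
apply: (le_trans (sl_E_add HX2 HM)); rewrite lerD2l sl_E_scale//; last exact: H_mul.
by apply: ler_wpM2l; [exact: ler0n|exact: E_cauchy_schwarz].
Qed.

Lemma Gnorm1_triangle X Y : H X -> H Y ->
  Gnorm 1 (fun w => X w + Y w) <= Gnorm 1 X + Gnorm 1 Y.
Proof.
move=> HX HY; rewrite !Gnorm1//; last exact: sl_H_add.
have HX' := H_norm HX; have HY' := H_norm HY.
apply: le_trans (sl_E_add HX' HY'); apply: sl_E_mono => [||w].
- by apply: H_norm; exact: sl_H_add.
- exact: sl_H_add.
- exact: ler_normD.
Qed.

Lemma Gnorm_dist p X Y : Gnorm p (fun w => X w - Y w) = Gnorm p (fun w => Y w - X w).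
Proof.
rewrite -(Gnorm_opp p (fun w => Y w - X w)); congr Gnorm; apply/funext => w.
by rewrite opprB.
Qed.

End Gnorm.

Section LG_theory.
Variables (R : realType) (S : sublinear R) (p : R).
Local Notation H := (sl_H S).
Local Notation N := (Gnorm p).
Hypothesis N_triangle : forall X Y : S -> R, H X -> H Y ->
  N (fun w => X w + Y w) <= N X + N Y.
Implicit Types (X : LG S p) (Y Z : S -> R).

Local Opaque Gnorm LG_dist.

Let N_ge0 Y : 0 <= N Y.
Proof. exact: Gnorm_ge0. Qed.

Let N_tri (U V W : S -> R) : H U -> H V -> H W ->
  N (fun w => U w - W w) <= N (fun w => U w - V w) + N (fun w => V w - W w).
Proof.
move=> HU HV HW; have := N_triangle (H_sub HU HV) (H_sub HV HW).
rewrite (_ : (fun w => U w - V w + (V w - W w)) = (fun w => U w - W w)).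
  exact: id.
by apply/funext => w; rewrite addrA subrK.
Qed.

Lemma LG_dist_cvg Y X : H Y ->
  N (fun w => Y w - X k w) @[k --> \oo] --> LG_dist Y X.
Proof.
move=> HY; apply: (@cauchy_cvgn R) => e e0; have [M HM] := LG_cauchy X e0.
exists M => j k Mj Mk; apply: le_lt_trans (HM j k Mj Mk).
have HX := LG_H X.
have h1 := N_tri HY (HX j) (HX k); have h2 := N_tri HY (HX k) (HX j).
rewrite [N (fun w => X k w - X j w)]Gnorm_dist in h2.
rewrite ler_norml; apply/andP; split.
  rewrite lerNl opprB lerBlDl; exact: h1.
rewrite lerBlDl; exact: h2.
Qed.

Lemma LG_dist_ge0 Y X : H Y -> 0 <= LG_dist Y X.
Proof.
move=> HY; have h := LG_dist_cvg (X := X) HY.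
by apply: (limr_ge (cvgP _ h)); apply: nearW => k.
Qed.

Lemma LG_dist_le Y X (c : R) : H Y ->
  (exists M, forall k, (M <= k)%N -> N (fun w => Y w - X k w) <= c) -> LG_dist Y X <= c.
Proof.
move=> HY [M HM]; have h := LG_dist_cvg (X := X) HY.
by apply: (limr_le (cvgP _ h)); exists M => // k /= ?; exact: HM.
Qed.

Lemma LG_dist_lt Y X (c : R) : H Y -> LG_dist Y X < c ->
  exists M, forall k, (M <= k)%N -> N (fun w => Y w - X k w) < c.
Proof.
move=> HY hc; have := LG_dist_cvg (X := X) HY.
move=> /cvgrPdist_lt/(_ (c - LG_dist Y X)); rewrite subr_gt0 => /(_ hc)[M _ HM].
exists M => k Mk; have := HM k Mk => /=.
by rewrite ltr_norml opprB ltrD2l ltrN2 => /andP[].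
Qed.

Lemma LG_dist_triangle Y Z X : H Y -> H Z ->
  LG_dist Z X <= N (fun w => Z w - Y w) + LG_dist Y X.
Proof.
move=> HY HZ; apply: le_addeps => d d0.
have [M HM] : exists M, forall k, (M <= k)%N -> N (fun w => Y w - X k w) < LG_dist Y X + d.
  by apply: LG_dist_lt => //; rewrite ltrDl.
apply: LG_dist_le => //; exists M => k Mk.
apply: (le_trans (N_tri HZ HY (LG_H X k))); rewrite -addrA lerD2l.
exact: ltW (HM k Mk).
Qed.

Lemma LG_dist_triangle2 Y Z X : H Y -> H Z ->
  N (fun w => Z w - Y w) <= LG_dist Z X + LG_dist Y X.
Proof.
move=> HY HZ; apply: le_addeps => d d0; have d2 : 0 < d / 2 by rewrite divr_gt0.
have [M HM] : exists M, forall k, (M <= k)%N -> N (fun w => Y w - X k w) < LG_dist Y X + d / 2.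
  by apply: LG_dist_lt => //; rewrite ltrDl.
have [M' HM'] : exists M, forall k, (M <= k)%N -> N (fun w => Z w - X k w) < LG_dist Z X + d / 2.
  by apply: LG_dist_lt => //; rewrite ltrDl.
pose k := maxn M M'.
have h := HM k (leq_maxl _ _); have h' := HM' k (leq_maxr _ _).
apply: (le_trans (N_tri HZ (LG_H X k) HY)).
rewrite [X in _ + X]Gnorm_dist; exact: (split_le h' h).
Qed.

Lemma LG_cvgP (Y : nat -> S -> R) X : (forall n, H (Y n)) -> LG_cvg Y X <->
  (forall e : R, 0 < e -> exists M, forall n, (M <= n)%N -> LG_dist (Y n) X < e).
Proof. by move=> HY; apply: cvg0P => n; exact: LG_dist_ge0. Qed.

Lemma LG_cvg_self X : LG_cvg X X.
Proof.
apply/LG_cvgP; first exact: LG_H.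
move=> e e0; have e2 : 0 < e / 2 by rewrite divr_gt0.
have [M HM] := LG_cauchy X e2; exists M => n Mn.
apply: (@le_lt_trans _ _ (e / 2)); last by lra.
apply: LG_dist_le; first exact: LG_H.
by exists M => k Mk; exact/ltW/HM.
Qed.

Lemma LG_cvg_cauchy (Y : nat -> S -> R) X : (forall n, H (Y n)) -> LG_cvg Y X ->
  forall e : R, 0 < e -> exists M, forall j k, (M <= j)%N -> (M <= k)%N ->
  N (fun w => Y j w - Y k w) < e.
Proof.
move=> HY /(LG_cvgP _ HY) h e e0; have e2 : 0 < e / 2 by rewrite divr_gt0.
have [M HM] := h _ e2; exists M => j k Mj Mk.
apply: (le_lt_trans (LG_dist_triangle2 X (HY k) (HY j))).
exact: (half_lt (HM _ Mj) (HM _ Mk)).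
Qed.

(** The two sequences are compared at unrelated indices, because they will be the integrals of two
    unrelated approximations of one integrand. *)
Lemma LG_cvg_close (Y Z : nat -> S -> R) X : (forall n, H (Y n)) -> (forall n, H (Z n)) ->
  LG_cvg Y X -> (forall e : R, 0 < e -> exists M, forall n, (M <= n)%N ->
    exists M', forall m, (M' <= m)%N -> N (fun w => Z n w - Y m w) <= e) -> LG_cvg Z X.
Proof.
move=> HY HZ /(LG_cvgP _ HY) h hd; apply/(LG_cvgP _ HZ) => e e0.
have e3 : 0 < e / 3 by rewrite divr_gt0.
have [M HM] := h _ e3; have [K HK] := hd _ e3.
exists K => n Kn; have [M' HM'] := HK n Kn.
pose m := maxn M M'.
apply: (le_lt_trans (LG_dist_triangle X (HY m) (HZ n))).
exact: (third_lt e0 (HM' m (leq_maxr _ _)) (HM m (leq_maxl _ _))).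
Qed.

End LG_theory.

Section LG2.
Variables (R : realType) (S : sublinear R).
Local Notation E := (sl_E S).
Local Notation H := (sl_H S).

Lemma LG_cvg_scale (Y : nat -> S -> R) (X : LG S 2) c : (forall n, H (Y n)) ->
  LG_cvg Y X -> LG_cvg (fun n w => c * Y n w) (scaleL2 c X).
Proof.
move=> HY h.
have e n : LG_dist (fun w => c * Y n w) (scaleL2 c X) = `|c| * LG_dist (Y n) X.
  apply: cvg_lim => //; rewrite /=.
  have -> : (fun k => Gnorm 2 (fun w => c * Y n w - c * X k w)) =
      (fun k => `|c| * Gnorm 2 (fun w => Y n w - X k w)).
    apply/funext => k; rewrite -Gnorm2_scale; last by apply: H_sub => //; exact: LG_H.
    by congr Gnorm; apply/funext => w; rewrite mulrBr.
  apply: cvgMr; apply: (LG_dist_cvg (@Gnorm2_triangle _ S)); exact: HY.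
rewrite /LG_cvg; under eq_fun do rewrite e.
by rewrite -(mulr0 `|c|); apply: cvgMr.
Qed.

Local Opaque Gnorm LG_dist.

(** * Expectations of test functions in the completion *)

Section LG_expect.
Variables (n : nat) (X : 'I_n -> LG S 2) (Z : nat -> 'I_n -> S -> R).
Hypotheses (HZ : forall k i, H (Z k i)) (ZX : forall i, LG_cvg (fun k => Z k i) (X i)).
Hypothesis moments : forall m, exists M : R, forall k i, E (fun w => `|Z k i w| ^+ m) <= M.

(** The sup norm is attained by a coordinate unless the vector is 0; the summand 1 covers an empty
    vector with exponent 0. *)
Lemma vec_norm_exp (Y : 'I_n -> S -> R) w m :
  `|vec Y w| ^+ m <= 1 + \sum_i `|Y i w| ^+ m.
Proof.
have s0 : 0 <= \sum_i `|Y i w| ^+ m by apply: sumr_ge0 => i _; rewrite exprn_ge0.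
have : `|vec Y w| <= 0 \/ exists i, `|vec Y w| <= `|Y i w|.
  have := lexx `|vec Y w|; rewrite [X in _ <= X]/Num.norm /= mx_normrE.
  move=> /bigmax_geP[h|[[i j] _ h]]; [by left|right].
  by exists j; move: h; rewrite /= mxE.
move=> [|[i h]].
  rewrite normr_le0 => /eqP ->; rewrite normr0; case: m s0 => [|m] s0.
    by rewrite expr0 lerDl.
  by rewrite expr0n addr_ge0.
apply: (le_trans (lerXn2r _ _ _ h)); rewrite ?nnegrE//.
rewrite (bigD1 i)//= addrCA lerDl addr_ge0//.
by apply: sumr_ge0 => j _; rewrite exprn_ge0.
Qed.

(** Cauchy-Schwarz separates the polynomial weight from the increment of [Z], which is small in L^2.
    The square of the weight at two points is bounded by fourth powers of weights at one point,
    hence the moments of order 4m. *)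
Lemma comp_cauchy (phi : 'rV[R]_n -> R) : plip phi -> forall e : R, 0 < e ->
  exists M : nat, forall j k, (M <= j)%N -> (M <= k)%N ->
    Gnorm 1 (fun w => phi (vec (Z j) w) - phi (vec (Z k) w)) < e.
Proof.
move=> pphi; have := pphi => -[C [m [C0 phiC]]] e e0.
have Hphi k : H (fun w => phi (vec (Z k) w)) by apply: H_plip.
have Hv k : H (fun w => `|vec (Z k) w|) by apply: (H_plip (HZ k)); exact: plip_norm.
have H1v k l : H (fun w => (1 + `|vec (Z k) w|) ^+ l).
  by apply: H_exp; apply: sl_H_add => //; exact: sl_H_cst.
pose W j k w := ((1 + `|vec (Z j) w|) * (1 + `|vec (Z k) w|)) ^+ m.
have HW j k : H (W j k).
  apply: H_exp; apply: H_mul.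
    by have := H1v j 1%N; under eq_fun do rewrite expr1.
  by have := H1v k 1%N; under eq_fun do rewrite expr1.
have [M0 HM0] := moments (4 * m).
have v1 k : E (fun w => (1 + `|vec (Z k) w|) ^+ (4 * m)) <= 2 ^+ (4 * m) * (2 + n%:R * M0).
  have Hs : H (fun w => \sum_i `|Z k i w| ^+ (4 * m)).
    by apply: H_sum => i; apply: H_exp; exact: H_norm.
  have Hs2 : H (fun w => \sum_i `|Z k i w| ^+ (4 * m) + 2).
    by apply: sl_H_add => //; exact: sl_H_cst.
  apply: (@le_trans _ _ (E (fun w => 2 ^+ (4 * m) * (\sum_i `|Z k i w| ^+ (4 * m) + 2)))).
    apply: sl_E_mono => [||w]; [exact: H1v|exact: sl_H_scale|].
    apply: (le_trans (pow1D_le _ (normr_ge0 _))); apply: ler_wpM2l; first exact: exprn_ge0.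
    by have := vec_norm_exp (Z k) w (4 * m); lra.
  rewrite sl_E_scale ?exprn_ge0//; apply: ler_wpM2l; first exact: exprn_ge0.
  rewrite E_addc// addrC lerD2l; apply: (le_trans (E_sum _ _)) => [i|].
    by apply: H_exp; exact: H_norm.
  apply: (@le_trans _ _ (\sum_(i < n) M0)); first by apply: ler_sum => i _; exact: HM0.
  by rewrite sumr_const card_ord mulr_natl.
have [K HK] : exists K : R, forall j k, Gnorm 2 (W j k) <= K.
  exists (Num.sqrt (2 ^+ (4 * m) * (2 + n%:R * M0))) => j k.
  rewrite Gnorm2//; apply: ler_wsqrtr.
  apply: (@le_trans _ _ (E (fun w => 2^-1 * ((1 + `|vec (Z j) w|) ^+ (4 * m) +
      (1 + `|vec (Z k) w|) ^+ (4 * m))))).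
    apply: sl_E_mono => [||w]; [exact: H_exp|by apply: sl_H_scale; exact: sl_H_add|].
    have e4 (x : R) : x ^+ (4 * m) = ((x ^+ m) ^+ 2) ^+ 2 by rewrite -[4%N]/(2 * 2)%N mulnC !exprM.
    rewrite /W !e4 exprMn [leLHS]exprMn.
    have := sqr_ge0 ((((1 + `|vec (Z j) w|) ^+ m) ^+ 2) - (((1 + `|vec (Z k) w|) ^+ m) ^+ 2)).
    by move: (((1 + `|vec (Z j) w|) ^+ m) ^+ 2) (((1 + `|vec (Z k) w|) ^+ m) ^+ 2) => x y; nra.
  rewrite sl_E_scale//; last exact: sl_H_add.
  have := sl_E_add (H1v j (4 * m)%N) (H1v k (4 * m)%N).
  by have := v1 j; have := v1 k; lra.
have K0 : 0 <= K by apply: le_trans (HK 0%N 0%N); exact: Gnorm_ge0.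
pose d := e / (C * K * n%:R + 1).
have c1 : 0 < C * K * n%:R + 1 by rewrite ltr_wpDl// !mulr_ge0.
have d0 : 0 < d by rewrite divr_gt0.
have cau i := LG_cvg_cauchy (@Gnorm2_triangle _ S) (fun k => HZ k i) (ZX i) d0.
have [Mi HMi] := choice cau.
exists (\max_i Mi i) => j k Mj Mk.
have le i : Gnorm 2 (fun w => Z j i w - Z k i w) <= d.
  by apply/ltW/HMi; [apply: leq_trans Mj|apply: leq_trans Mk]; exact: leq_bigmax.
rewrite Gnorm1; last exact: H_sub.
have HD i : H (fun w => `|Z j i w - Z k i w|) by apply: H_norm; exact: H_sub.
have HWD i : H (fun w => W j k w * `|Z j i w - Z k i w|) by exact: H_mul.
apply: (@le_lt_trans _ _ (E (fun w => C * \sum_i W j k w * `|Z j i w - Z k i w|))).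
  apply: sl_E_mono => [||w].
  - by apply: H_norm; exact: H_sub.
  - by apply: sl_H_scale; exact: H_sum.
  - apply: (le_trans (phiC _ _)); rewrite -mulrA; apply: ler_wpM2l => //.
    rewrite -mulr_sumr; apply: ler_wpM2l.
      by rewrite exprn_ge0// mulr_ge0// addr_ge0.
    have -> : vec (Z j) w - vec (Z k) w = vec (fun i w => Z j i w - Z k i w) w.
      by apply/rowP => i; rewrite !mxE.
    exact: vec_norm_le.
rewrite sl_E_scale//; last exact: H_sum.
apply: (@le_lt_trans _ _ (C * (n%:R * (K * d)))).
  apply: ler_wpM2l => //; apply: (le_trans (E_sum _ HWD)).
  apply: (@le_trans _ _ (\sum_(i < n) K * d)).
    apply: ler_sum => i _; apply: (le_trans (E_cauchy_schwarz (HW j k) (HD i))).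
    apply: ler_pM; [exact: Gnorm_ge0|exact: Gnorm_ge0|exact: HK|].
    by rewrite Gnorm_normr; exact: le.
  by rewrite sumr_const card_ord mulr_natl.
have -> : C * (n%:R * (K * d)) = (C * K * n%:R) * d by ring.
by rewrite /d mulrA ltr_pdivrMr// mulrC ltr_pM2l// ltrDl.
Qed.

(** The sequence [phi (vec (Z k))] is itself a representative of phi(X) in L^1_G, so the extended
    expectation is the limit of the expectations. *)
Lemma LG_expect_lim (phi : 'rV[R]_n -> R) r : plip phi ->
  E (fun w => phi (vec (Z k) w)) @[k --> \oo] --> r -> LG_expect X phi r.
Proof.
move=> pphi Er.
have Hphi k : H (fun w => phi (vec (Z k) w)) by apply: H_plip.
exists (@MkLG R S 1 (fun k w => phi (vec (Z k) w)) Hphi (comp_cauchy pphi)).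
  exists Z; split=> //.
  exact: (LG_cvg_self (@Gnorm1_triangle _ S) (MkLG Hphi (comp_cauchy pphi))).
exact: cvg_lim.
Qed.

End LG_expect.
End LG2.

(** * Step functions on a common grid *)

Section step_sums.
Variable R : realType.
Local Notation mu := (@lebesgue_measure R).
Implicit Types (f g : step R) (b : R -> R).

(** With [b] abstract, a refinement of the grid is proved once and applies both to a step function
    and to its integral. *)
Definition sum_incr (n : nat) (t a : nat -> R) (b : R -> R) : R :=
  \sum_(i < n) a i * (b (t i.+1) - b (t i)).

Definition step_sum f b : R := sum_incr (step_n f) (step_t f) (step_a f) b.

Lemma step_integralE (S : sublinear R) (B : R -> S -> R) f w :
  step_integral B f w = step_sum f (fun t => B t w).
Proof. by []. Qed.

(* The values of a step function have the same form as its integral, with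
   [fun t => 1_(x <= t)] in place of the Brownian path. *)
Lemma step_funE f x : step_fun f x = step_sum f (fun t => (x <= t)%R%:R).
Proof.
apply: eq_bigr => i _; congr (_ * _); rewrite indicE.
have lt := @step_lt _ f i (ltn_ord i).
rewrite (_ : (x \in `]step_t f i, step_t f i.+1]%classic) =
  (step_t f i < x <= step_t f i.+1)); last first.
  by apply/idP/idP; [rewrite inE/= in_itv/=|move=> h; rewrite inE/= in_itv/=].
have [h|h] := ltP (step_t f i) x; last first.
  by rewrite (le_trans h (ltW lt)) subrr.
by rewrite subr0.
Qed.

(** [step_t] is unconstrained beyond [step_n], so the grid is frozen there to be monotone on all
    indices. *)
Lemma step_homo f : {homo (fun i => step_t f (minn i (step_n f))) : i j / (i <= j)%N >-> i <= j}.
Proof.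
apply: homo_leq => [//|? ? ?|i]; first exact: le_trans.
have [ni|ni] := leqP (step_n f) i.
  by rewrite !(minn_idPr _)// (leq_trans ni).
rewrite !(minn_idPl _) ?(ltnW ni)//; exact/ltW/step_lt.
Qed.

Lemma step_sum_homo f : exists t, {homo t : i j / (i <= j)%N >-> i <= j} /\
  forall b, step_sum f b = sum_incr (step_n f) t (step_a f) b.
Proof.
exists (fun i => step_t f (minn i (step_n f))); split; first exact: step_homo.
move=> b; apply: eq_bigr => i _; have ni := ltn_ord i.
by rewrite !(minn_idPl _)// ltnW.
Qed.

(** Each increment of [b] over an old interval telescopes over the points of [s] in it; the
    coefficient on a new cell collects the [a i] whose interval contains the cell. *)
Lemma sum_incr_refine (n : nat) (t a : nat -> R) (s : seq R) :
  {homo t : i j / (i <= j)%N >-> i <= j} -> sorted <=%R s -> uniq s ->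
  (forall i, (i <= n)%N -> t i \in s) ->
  exists c, forall b, sum_incr n t a b = sum_incr (size s).-1 (nth 0 s) c b.
Proof.
move=> tm ss us ts.
pose k i := index (t i) s.
have kn i : (i <= n)%N -> nth 0 s (k i) = t i by move=> /ts; exact: nth_index.
have ks i : (i <= n)%N -> (k i < size s)%N by move=> /ts; rewrite index_mem.
have km i : (i < n)%N -> (k i <= k i.+1)%N.
  move=> ni; rewrite leqNgt; apply/negP => lt.
  have lt' : nth 0 s (k i.+1) < nth 0 s (k i).
    have : sorted <%R s by rewrite lt_sorted_uniq_le us.
    move/(sorted_ltn_nth lt_trans); apply => //; rewrite inE ks// ltnW//.
  by move: lt'; rewrite !kn// 1?ltnW// ltNge tm.
exists (fun j => \sum_(i < n) a i * (k i <= j < k i.+1)%:R) => b.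
rewrite /sum_incr; under [RHS]eq_bigr do rewrite mulr_suml.
rewrite exchange_big/=; apply: eq_bigr => i _.
have ni := ltn_ord i.
have -> : b (t i.+1) - b (t i) = \sum_(k i <= j < k i.+1) (b (nth 0 s j.+1) - b (nth 0 s j)).
  by rewrite (telescope_sumr (fun j => b (nth 0 s j)) (km _ ni)) !kn// ltnW.
rewrite mulr_sumr.
have kl : (k i.+1 <= (size s).-1)%N.
  by have := ks _ ni; case: (size s).
rewrite (big_nat_widen _ _ _ _ _ kl) (big_nat_widenl _ _ _ _ _ (leq0n (k i))).
rewrite big_mkord big_mkcond; apply: eq_bigr => j _ /=.
by rewrite andbC; case: ifP; rewrite ?mulr1 ?mulr0 ?mul0r.
Qed.

Lemma step_refine f g : exists n t a c, {homo t : i j / (i <= j)%N >-> i <= j} /\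
  forall b, step_sum f b = sum_incr n t a b /\ step_sum g b = sum_incr n t c b.
Proof.
have [tf [tfm ef]] := step_sum_homo f; have [tg [tgm eg]] := step_sum_homo g.
pose s0 := [seq tf i | i <- iota 0 (step_n f).+1] ++ [seq tg i | i <- iota 0 (step_n g).+1].
pose s := sort <=%R (undup s0).
have ss : sorted <=%R s by apply: sort_sorted; exact: le_total.
have us : uniq s by rewrite sort_uniq undup_uniq.
have sf i : (i <= step_n f)%N -> tf i \in s.
  move=> h; rewrite mem_sort mem_undup mem_cat; apply/orP; left.
  by apply: map_f; rewrite mem_iota.
have sg i : (i <= step_n g)%N -> tg i \in s.
  move=> h; rewrite mem_sort mem_undup mem_cat; apply/orP; right.
  by apply: map_f; rewrite mem_iota.
have [a ea] := sum_incr_refine (step_a f) tfm ss us sf.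
have [c ec] := sum_incr_refine (step_a g) tgm ss us sg.
pose t i := nth 0 s (minn i (size s).-1).
have tE u b : sum_incr (size s).-1 (nth 0 s) u b = sum_incr (size s).-1 t u b.
  apply: eq_bigr => i _; have ni := ltn_ord i.
  by rewrite /t !(minn_idPl _)// ltnW.
exists (size s).-1, t, a, c; split; last by move=> b; rewrite ef eg ea ec !tE.
have [/nilP s0'|sn] := boolP (nilp s).
  by move=> i j ij; rewrite /t s0' !nth_nil.
have sp : (0 < size s)%N by rewrite lt0n.
move=> i j ij; rewrite /t; apply: (sorted_leq_nth le_trans (@lexx _ _)) => //.
- by rewrite inE -[X in (_ < X)%N](prednK sp) ltnS geq_minr.
- by rewrite inE -[X in (_ < X)%N](prednK sp) ltnS geq_minr.
- by rewrite leq_min geq_minr andbT (leq_trans (geq_minl _ _)).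
Qed.

Lemma Lnorm2E (h : R -> R) (r : R) : 0 <= r ->
  (\int[mu]_x ((h x ^+ 2)%:E) = r%:E)%E ->
  ('N[mu]_2%:E[EFin \o h] = (Num.sqrt r)%:E)%E.
Proof.
move=> r0 hr; rewrite unlock/=.
have -> : (\int[mu]_x ((`|h x|%:E) `^ 2) = r%:E)%E.
  rewrite -hr; apply: eq_integral => x _.
  by rewrite poweR_EFin -[2]/(2%:R) powR_mulrn// real_normK ?num_real.
by rewrite poweR_EFin powR12_sqrt.
Qed.

Lemma Lnorm2_grid (n : nat) (t a : nat -> R) : {homo t : i j / (i <= j)%N >-> i <= j} ->
  ('N[mu]_2%:E[EFin \o (fun x => sum_incr n t a (fun t => (x <= t)%R%:R))] =
    (Num.sqrt (\sum_(i < n) a i ^+ 2 * (t i.+1 - t i)))%:E)%E.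
Proof.
move=> tm; apply: Lnorm2E.
  by apply: sumr_ge0 => i _; rewrite mulr_ge0 ?sqr_ge0// subr_ge0; exact: tm.
pose A i : set R := `]t i, t i.+1]%classic.
have AE i x : (x <= t i.+1)%R%:R - (x <= t i)%R%:R = \1_(A i) x :> R.
  rewrite /A indicE (_ : (x \in _) = (t i < x <= t i.+1)); last first.
    by apply/idP/idP; [rewrite inE/= in_itv/=|move=> h; rewrite inE/= in_itv/=].
  have [h|h] := ltP (t i) x; first by rewrite subr0.
  by rewrite (le_trans h (tm _ _ (leqnSn i))) subrr.
have disj i j x : (i < j)%N -> \1_(A i) x * \1_(A j) x = 0 :> R.
  move=> ij; rewrite -!AE.
  have tij := tm i.+1 j ij; have [xi|xi] := leP x (t i.+1).
    by rewrite (le_trans xi tij) (le_trans (le_trans xi tij) (tm _ _ (leqnSn j))) subrr mulr0.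
  have [xi'|_] := leP x (t i); last by rewrite subrr mul0r.
  by have := le_trans xi' (tm _ _ (leqnSn i)); rewrite leNgt xi.
transitivity (\int[mu]_x (\sum_(i < n) (a i ^+ 2 * \1_(A i) x)%:E))%E.
  apply: eq_integral => x _; rewrite sumEFin; congr EFin.
  rewrite /sum_incr; under eq_bigr do rewrite AE.
  rewrite expr2 big_distrlr/=; apply: eq_bigr => i _.
  rewrite (bigD1 i)//= big1 ?addr0.
    rewrite mulrACA -expr2 indicE; congr (_ * _).
    by case: (_ \in _); rewrite ?mulr1 ?mulr0.
  move=> j ji; rewrite mulrACA.
  have [ij|ij|/eqP] := ltngtP i j; last by rewrite eq_sym val_eqE (negbTE ji).
    by rewrite disj ?mulr0.
  by rewrite (mulrC (\1_(A i) x)) disj ?mulr0.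
rewrite ge0_integral_sum//=; last 2 first.
- move=> i; apply/measurable_EFinP; apply: measurable_funM => //.
  by apply: measurable_indic; exact: measurable_itv.
- by move=> i x _; rewrite lee_fin mulr_ge0 ?sqr_ge0.
rewrite -sumEFin; apply: eq_bigr => i _.
under eq_integral do rewrite EFinM.
rewrite ge0_integralZl_EFin ?sqr_ge0//; last first.
  by apply/measurable_EFinP; apply: measurable_indic; exact: measurable_itv.
have mA : measurable (A i : set (measurableTypeR R)) by exact: measurable_itv.
rewrite integral_indic// setIT [RHS]EFinM; congr (_ * _)%E.
rewrite /A [LHS]lebesgue_measure_itv/= lte_fin; case: ifPn => [//|].
rewrite -leNgt => h; have -> : t i.+1 = t i by apply/le_anti; rewrite h tm.
by rewrite subrr.
Qed.

Lemma measurable_step_fun f : measurable_fun [set: R] (step_fun f).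
Proof.
rewrite /step_fun; apply: measurable_sum => i.
apply: measurable_funM => //; by apply: measurable_indic; exact: measurable_itv.
Qed.

End step_sums.

Section G_isometry.
Variables (R : realType) (S : sublinear R) (slo shi : R) (B : R -> S -> R).
Hypothesis GB : two_sided_G_brownian slo shi B.
Hypothesis hs : 0 <= slo <= shi.
Local Notation mu := (@lebesgue_measure R).
Implicit Types (f g : step R).

(** The increment over [0, 1] is G-normal; the space realizing it with an independent copy provides
    the reference variable [X0]. *)
Lemma brownian_realization : exists (S0 : sublinear R) (X0 Xb0 : S0 -> R),
  [/\ sl_H S0 X0, sl_H S0 Xb0, independent_copy X0 Xb0,
   (forall a b : R, 0 <= a -> 0 <= b ->
        same_distr (law1 (fun w => a * X0 w + b * Xb0 w))
                   (law1 (fun w => Num.sqrt (a ^+ 2 + b ^+ 2) * X0 w))) &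
   sl_E S0 (fun t => X0 t ^+ 2) = shi ^+ 2 /\
   sl_E S0 (fun t => - X0 t ^+ 2) = - slo ^+ 2].
Proof.
have [B1 [B2 [[HB B0 inc] _ _ _ _]]] := GB.
have [[[S0 [X0 [Xb0 [HX0 HXb0 XF ic GX]]]] Fhi Flo] _] := inc 0 1 (lexx _) ltr01.
exists S0, X0, Xb0; split=> //; rewrite !mul1r in Fhi Flo.
have p2 : plip (fun x : R => x ^+ 2) by apply: plip_exp; exact: plip_id.
have /same_distr1P h := XF; have h1 := h _ p2; have h2 := h _ (plip_opp p2).
rewrite (law1E X0 (fun x => x ^+ 2)) in h1; rewrite (law1E X0 (fun x => - x ^+ 2)) in h2.
by rewrite h1 h2 Fhi Flo opprK.
Qed.

Section with_realization.
Variables (S0 : sublinear R) (X0 Xb0 : S0 -> R).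
Hypotheses (HX0 : sl_H S0 X0) (HXb0 : sl_H S0 Xb0) (ic0 : independent_copy X0 Xb0).
Hypothesis GX0 : forall a b : R, 0 <= a -> 0 <= b ->
        same_distr (law1 (fun w => a * X0 w + b * Xb0 w))
                   (law1 (fun w => Num.sqrt (a ^+ 2 + b ^+ 2) * X0 w)).
Hypotheses (Xvhi : sl_E S0 (fun t => X0 t ^+ 2) = shi ^+ 2)
  (Xvlo : sl_E S0 (fun t => - X0 t ^+ 2) = - slo ^+ 2).

Let lohi : slo ^+ 2 <= shi ^+ 2.
Proof.
case/andP: hs => s0 ss; apply: lerXn2r; rewrite ?nnegrE//; exact: le_trans ss.
Qed.

Lemma H_brownian t : sl_H S (B t).
Proof.
by have [B1 [B2 [G1 G2 _ p1 p2]]] := GB; exact: (H_B G1 G2 p1 p2).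
Qed.

Lemma H_step f : sl_H S (step_integral B f).
Proof.
apply: H_sum => i; apply: sl_H_scale; apply: H_sub; exact: H_brownian.
Qed.

Lemma grid_law n (t a : nat -> R) : {homo t : i j / (i <= j)%N >-> i <= j} ->
  has_law X0 (fun w => sum_incr n t a (fun t => B t w))
    (Num.sqrt (\sum_(i < n) a i ^+ 2 * (t i.+1 - t i))).
Proof.
have [B1 [B2 [G1 G2 ind p1 p2]]] := GB.
exact: (sumB_law HX0 HXb0 ic0 GX0 Xvhi Xvlo G1 G2 ind p1 p2 n a).
Qed.

Lemma has_law_Gnorm2 (Z : S -> R) (c : R) : sl_H S Z -> 0 <= c -> has_law X0 Z c ->
  Gnorm 2 Z = shi * c.
Proof.
move=> HZ c0 hZ; have := has_law_sqr HX0 Xvhi Xvlo 1 hZ lohi.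
rewrite ler01 mul1r; under eq_fun do rewrite mul1r.
rewrite Gnorm2// => ->; rewrite -exprMn sqrtr_sqr ger0_norm 1?mulrC// mulr_ge0//.
by case/andP: hs; exact: le_trans.
Qed.

Lemma step_law f : exists2 d : R, 0 <= d &
  has_law X0 (step_integral B f) d /\ ('N[mu]_2%:E[EFin \o step_fun f] = d%:E)%E.
Proof.
have [t [tm e]] := step_sum_homo f.
exists (Num.sqrt (\sum_(i < step_n f) step_a f i ^+ 2 * (t i.+1 - t i))).
  exact: sqrtr_ge0.
split.
  have -> : step_integral B f = (fun w => sum_incr (step_n f) t (step_a f) (fun t => B t w)).
    by apply/funext => w; rewrite step_integralE e.
  exact: grid_law.
rewrite -Lnorm2_grid//; congr (Lnorm _ _ (_ \o _)); apply/funext => x.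
by rewrite step_funE e.
Qed.

(** On a common grid the difference is again a step function, and the factor in the law of its
    integral is the L^2 norm. Naming the common value [d] states the isometry although one norm is
    real and the other extended real. *)
Lemma step_isometry f g : exists2 d : R, 0 <= d &
  Gnorm 2 (fun w => step_integral B f w - step_integral B g w) = shi * d /\
  ('N[mu]_2%:E[EFin \o (step_fun f \- step_fun g)%R] = d%:E)%E.
Proof.
have [n [t [a [c [tm e]]]]] := step_refine f g.
have eB b : step_sum f b - step_sum g b = sum_incr n t (fun i => a i - c i) b.
  have [-> ->] := e b; rewrite /sum_incr -sumrB.
  by apply: eq_bigr => i _; rewrite mulrBl.
exists (Num.sqrt (\sum_(i < n) (a i - c i) ^+ 2 * (t i.+1 - t i))).
  exact: sqrtr_ge0.
split.
  apply: has_law_Gnorm2; first by apply: H_sub; exact: H_step.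
    exact: sqrtr_ge0.
  have -> : (fun w => step_integral B f w - step_integral B g w) =
      (fun w => sum_incr n t (fun i => a i - c i) (fun t => B t w)).
    by apply/funext => w; rewrite !step_integralE eB.
  exact: grid_law.
rewrite -(Lnorm2_grid n (fun i => a i - c i) tm); congr (Lnorm _ _ (_ \o _)).
by apply/funext => x; rewrite -eB -!step_funE.
Qed.

End with_realization.
End G_isometry.

(** * Approximation by step functions *)

Section L2_norm.
Variable R : realType.
Local Notation mu := (@lebesgue_measure R).
Local Notation N2 h := ('N[mu]_2%:E[EFin \o h])%E.
Implicit Types (h f g : R -> R).

Lemma ecvg0_lt (u : nat -> \bar R) : (u n @[n --> \oo] --> 0)%E ->
  forall e : R, 0 < e -> exists M, forall n, (M <= n)%N -> (u n < e%:E)%E.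
Proof.
move=> /fine_cvgP[[M1 _ h1] /cvgrPdist_lt h2] e e0; have [M2 _ h3] := h2 e e0.
exists (maxn M1 M2) => n; rewrite geq_max => /andP[n1 n2].
have fn := h1 n n1; have := h3 n n2; rewrite /= sub0r normrN => h.
by rewrite -[X in (X < _)%E](fineK fn) lte_fin; apply: le_lt_trans h; exact: ler_norm.
Qed.

Lemma Lnorm2_lt h (e : R) : 0 < e ->
  (\int[mu]_x ((h x ^+ 2)%:E) < (e ^+ 2)%:E)%E -> (N2 h < e%:E)%E.
Proof.
move=> e0 he.
have i0 : (0 <= \int[mu]_x ((h x ^+ 2)%:E))%E.
  by apply: integral_ge0 => x _; rewrite lee_fin sqr_ge0.
have fi : (\int[mu]_x ((h x ^+ 2)%:E))%E \is a fin_num.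
  by rewrite ge0_fin_numE//; exact: lt_trans he (ltry _).
have r0 := fine_ge0 i0.
rewrite (Lnorm2E r0 (esym (fineK fi))) lte_fin -[X in _ < X]ger0_norm ?(ltW e0)//.
by rewrite -sqrtr_sqr ltr_sqrt ?exprn_gt0// -lte_fin fineK.
Qed.

Lemma Lnorm2_triangle f g h : measurable_fun [set: measurableTypeR R] f ->
  measurable_fun [set: measurableTypeR R] g -> measurable_fun [set: measurableTypeR R] h ->
  (N2 (f \- h)%R <= N2 (f \- g)%R + N2 (g \- h)%R)%E.
Proof.
move=> mf mg mh.
have -> : (f \- h)%R = ((f \- g) \+ (g \- h))%R.
  by apply/funext => x /=; rewrite addrA subrK.
by apply: minkowski_EFin; [exact: measurable_funB|exact: measurable_funB|rewrite ler1n].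
Qed.

Lemma Lnorm2_dist f g : (N2 (f \- g)%R = N2 (g \- f)%R)%E.
Proof.
rewrite -oppe_Lnorm; congr (Lnorm _ _ _); apply/funext => x /=.
by rewrite -[in RHS]opprB.
Qed.

End L2_norm.

Section grid_step.
Variable R : realType.

Lemma indic_itv_oc (a b x : R) : \1_(`]a, b]%classic) x = (a < x <= b)%R%:R :> R.
Proof.
rewrite indicE; congr (_%:R); congr nat_of_bool.
by apply/idP/idP; [rewrite inE/= in_itv/=|move=> h; rewrite inE/= in_itv/=].
Qed.

Local Notation mu := (@lebesgue_measure R).
Local Notation N2 h := ('N[mu]_2%:E[EFin \o h])%E.

Section grid.
Variables (N k : nat).
Let t (i : nat) : R := - N%:R + i%:R / k.+1%:R.

Let t_lt i j : (i < j)%N -> t i < t j.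
Proof.
by move=> ij; rewrite /t ltrD2l ltr_pM2r ?invr_gt0 ?ltr0n// ltr_nat.
Qed.

Let t_le i j : (i <= j)%N -> t i <= t j.
Proof.
by rewrite leq_eqVlt => /orP[/eqP -> //|/t_lt /ltW].
Qed.

(** Values are sampled at right end points and only then clamped: near a singularity the samples are
    unbounded, and the clamp supplies a dominating function as the mesh shrinks. The same [N] and
    [k] give the same grid for every [f]. *)
Definition grid_step (f : R -> R) : step R :=
  @Step R (N.*2 * k.+1)%N t (fun i => clamp N%:R (f (t i.+1))) (fun i _ => t_lt (ltnSn i)).

Lemma grid_step_eval (f : R -> R) (x : R) : exists2 r : R, `|r - x| <= k.+1%:R^-1 &
  step_fun (grid_step f) x = (- N%:R < x <= N%:R)%R%:R * clamp N%:R (f r).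
Proof.
have k0 : 0 < k.+1%:R :> R by rewrite ltr0n.
have tn : t (N.*2 * k.+1)%N = N%:R.
  by rewrite /t natrM mulfK ?lt0r_neq0// -addnn natrD addKr.
have t0 : t 0 = - N%:R by rewrite /t mul0r addr0.
have ind i := indic_itv_oc (t i) (t i.+1) x.
have [/andP[x1 x2]|nx] := boolP (- N%:R < x <= N%:R)%R; last first.
  exists x; first by rewrite subrr normr0 invr_ge0 ltW.
  rewrite mul0r /step_fun big1// => i _; rewrite ind.
  have -> : (t i < x <= t i.+1)%R = false; last by rewrite mulr0.
  apply/negP => /andP[h1 h2]; move/negP: nx; apply; apply/andP; split.
    by apply: le_lt_trans h1; rewrite -t0 t_le.
  by apply: (le_trans h2); rewrite -tn t_le//; exact: ltn_ord.
have ex : exists i, (x <= t i)%R by exists (N.*2 * k.+1)%N; rewrite tn.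
(* The cell containing [x] ends at the first grid point not to the left of [x]; this is not [t 0],
   so the cell has index [m.-1]. *)
pose m := ex_minn ex.
have [m0 [xm mmin]] : (0 < m)%N /\ (x <= t m)%R /\ forall j, (x <= t j)%R -> (m <= j)%N.
  rewrite /m; case: ex_minnP => j xj jmin; split=> //.
  by rewrite lt0n; apply/negP => /eqP j0; move: xj; rewrite j0 t0 leNgt x1.
have mn : (m <= N.*2 * k.+1)%N by apply: mmin; rewrite tn.
have xm' : t m.-1 < x.
  rewrite ltNge; apply/negP => /mmin; rewrite leqNgt prednK//.
  by rewrite leqnn.
exists (t m).
  rewrite ger0_norm ?subr_ge0//.
  have : t m - t m.-1 = k.+1%:R^-1.
    rewrite /t -[in LHS](prednK m0) -natr1/= mulrDl mul1r; ring.
  by move=> <-; rewrite lerD2l lerN2 ltW.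
have lm : (m.-1 < N.*2 * k.+1)%N by rewrite prednK.
rewrite mul1r /step_fun (bigD1 (Ordinal lm))//= big1.
  by rewrite ind (prednK m0) xm' xm mulr1 addr0.
move=> i; rewrite -val_eqE/= => im; rewrite ind.
have -> : (t i < x <= t i.+1)%R = false; last by rewrite mulr0.
apply/negP => /andP[h1 h2]; move/negP: im; apply.
rewrite eqn_leq; apply/andP; split.
  by rewrite -ltnS prednK// ltnNge; apply/negP => /t_le h; move: h1; rewrite ltNge (le_trans xm h).
by rewrite -ltnS prednK//; exact: mmin.
Qed.

End grid.

Section approx.
Variable f : R -> R.
Hypothesis fm : measurable_fun [set: measurableTypeR R] f.
Hypothesis f2 : (\int[mu]_x ((f x ^+ 2)%:E) < +oo)%E.
Variables p q : R.
Hypothesis fc : forall x, x != p -> x != q -> {for x, continuous f}.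

Let c (N : nat) x : R := (- N%:R < x <= N%:R)%R%:R * clamp N%:R (f x).

Lemma clamp_continuous (n : R) : continuous (clamp n).
Proof. by apply: (@lip_continuous _ _ 1) => x y; rewrite mul1r clamp_lip. Qed.

Let mc N : measurable_fun [set: measurableTypeR R] (c N).
Proof.
apply: measurable_funM; last first.
  apply: (@measurableT_comp _ _ _ _ _ _ (clamp N%:R)) => //.
  by apply: continuous_measurable_fun; exact: clamp_continuous.
have -> : (fun x : R => (- N%:R < x <= N%:R)%R%:R) = \1_(`]- N%:R, N%:R]%classic) :> (R -> R).
  by apply/funext => x; rewrite indic_itv_oc.
by apply: measurable_indic; exact: measurable_itv.
Qed.

Lemma clamp_sub_sqr (n x : R) : 0 <= n -> (clamp n x - x) ^+ 2 <= x ^+ 2.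
Proof.
move=> n0; rewrite -[leLHS]real_normK ?num_real// -[leRHS]real_normK ?num_real//.
apply: lerXn2r; rewrite ?nnegrE//.
have := clamp_le x n0; have := clamp_same_sign x n0.
have [x0|x0] := leP 0 x.
  have [->|xn0] := eqVneq x 0.
    by rewrite normr0 normr_le0 => _ /eqP->; rewrite subrr normr0.
  have xp : 0 < x by rewrite lt_neqAle eq_sym xn0.
  rewrite pmulr_lge0// => c0; rewrite (ger0_norm c0) (ger0_norm x0) => cx.
  by rewrite ler0_norm; lra.
rewrite nmulr_lge0// => c0; rewrite (ler0_norm c0) (ltr0_norm x0) => cx.
by rewrite ger0_norm; lra.
Qed.

Let trunc_sub_sqr (N : nat) x : (c N x - f x) ^+ 2 <= f x ^+ 2.
Proof.
rewrite /c; case: (_ < _ <= _)%R; first by rewrite mul1r clamp_sub_sqr.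
by rewrite mul0r sub0r sqrrN.
Qed.

Let sqr_meas (g : R -> R) : measurable_fun [set: measurableTypeR R] g ->
  measurable_fun [set: measurableTypeR R] (fun x => (g x ^+ 2)%:E).
Proof. by move=> mg; apply/measurable_EFinP; exact: measurable_funX. Qed.

(** At each point the truncation is eventually exact, and clamping moves values towards 0, so the
    squared error is dominated by f^2. *)
Lemma truncation_L2 (e : R) : 0 < e ->
  exists M, forall N, (M <= N)%N -> (N2 (c N \- f)%R < e%:E)%E.
Proof.
move=> e0.
have fi : mu.-integrable setT (fun x => (f x ^+ 2)%:E).
  apply/integrableP; split; first exact: sqr_meas.
  by under eq_integral do rewrite gee0_abs ?lee_fin ?sqr_ge0//.
have m1 N : measurable_fun [set: measurableTypeR R] (fun x => ((c N x - f x) ^+ 2)%:E).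
  by apply: sqr_meas; exact: measurable_funB.
have cv : {ae mu, forall x, [set: measurableTypeR R] x ->
    ((c N x - f x) ^+ 2)%:E @[N --> \oo] --> (0%:E : \bar R)}.
  apply: aeW => x _; apply: cvg_near_cst.
  pose M := (Num.truncn (`|x| + `|f x|)).+1.
  exists M => // N /= MN.
  have hN : `|x| + `|f x| < N%:R.
    apply: lt_le_trans (_ : M%:R <= _); first exact: truncnS_gt.
    by rewrite ler_nat.
  have xN : `|x| < N%:R by apply: le_lt_trans hN; rewrite lerDl.
  have fN : `|f x| <= N%:R by apply/ltW; apply: le_lt_trans hN; rewrite lerDr.
  rewrite /c clampE//; move: xN; rewrite ltr_norml => /andP[h1 h2].
  by rewrite h1 (ltW h2) mul1r subrr expr0n.
have dom : {ae mu, forall (x : measurableTypeR R) (N : nat), [set: measurableTypeR R] x ->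
    (`|((c N x - f x) ^+ 2)%:E| <= (f x ^+ 2)%:E)%E}.
  apply: aeW => x N _; rewrite gee0_abs ?lee_fin ?sqr_ge0//; exact: trunc_sub_sqr.
have [_ _ h] := dominated_convergence measurableT m1 (measurable_cst _) cv fi dom.
rewrite integral0 in h.
have [M HM] := ecvg0_lt h (exprn_gt0 2 e0).
by exists M => N MN; apply: Lnorm2_lt => //; exact: HM.
Qed.

(** For fixed [N] all functions are bounded by [N] on a bounded interval and vanish outside, which
    dominates them; sampling converges at every point of continuity, that is, off the null set of
    [p] and [q]. *)
Lemma grid_L2 (N : nat) (e : R) : 0 < e ->
  exists M, forall k, (M <= k)%N -> (N2 (step_fun (grid_step N k f) \- c N)%R < e%:E)%E.
Proof.
move=> e0.
pose g k x := ((step_fun (grid_step N k f) x - c N x) ^+ 2)%:E.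
have mg k : measurable_fun [set: measurableTypeR R] (g k).
  by apply: sqr_meas; apply: measurable_funB => //; exact: measurable_step_fun.
pose A : set (measurableTypeR R) := `]- N%:R, N%:R]%classic.
have mA : measurable A by exact: measurable_itv.
have bi : mu.-integrable setT (fun x => ((2 * N%:R) ^+ 2)%:E * (\1_A x)%:E)%E.
  apply: integrableZl => //.
  apply/integrableP; split; first by apply/measurable_EFinP; exact: measurable_indic.
  under eq_integral do rewrite gee0_abs ?lee_fin//.
  rewrite integral_indic// setIT /A [X in (X < _)%E]lebesgue_measure_itv/=.
  by case: ifP => _; rewrite ?ltry// -EFinB ltry.
have cE x : c N x = \1_A x * clamp N%:R (f x).
  by rewrite /c -indic_itv_oc.
have AE x : (- N%:R < x <= N%:R)%R%:R = \1_A x :> R by rewrite -indic_itv_oc.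
have cv : {ae mu, forall x, [set: measurableTypeR R] x -> g k x @[k --> \oo] --> (0%:E : \bar R)}.
  exists [set p; q]; split.
  - by apply: measurableU; exact: measurable_set1.
  - apply: countable_lebesgue_measure0; apply: finite_set_countable.
    exact: finite_set2.
  move=> x /= nx; apply: contrapT => npq; apply: nx => _.
  have xp : x != p by apply/eqP => e'; apply: npq; left.
  have xq : x != q by apply/eqP => e'; apply: npq; right.
  have fcx := fc xp xq.
  have ccx : {for x, continuous (fun y => clamp N%:R (f y))}.
    by apply: continuous_comp => //; exact: clamp_continuous.
  apply/fine_cvgP; split; first by apply: nearW.
  apply/cvgrPdist_lt => d d0 /=.
  have sd : 0 < Num.sqrt d by rewrite sqrtr_gt0.
  move: ccx => /cvgrPdist_lt/(_ _ sd) [r /= r0 hr].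
  have [M hM] := archi_div 1 (divr_gt0 r0 (ltr0Sn R 1)).
  exists M => // k /= Mk; rewrite sub0r normrN ger0_norm ?sqr_ge0//.
  have [y yx ->] := grid_step_eval N k f x.
  rewrite /c -mulrBr exprMn.
  have ynear : `|x - y| < r.
    rewrite distrC; apply: (le_lt_trans yx); apply: (@le_lt_trans _ _ (r / 2)).
      rewrite -div1r; apply: le_trans hM; rewrite !div1r lef_pV2 ?posrE ?ltr0n//.
      by rewrite ler_nat ltnS.
    by lra.
  have := hr y ynear; rewrite /= distrC => h.
  apply: (@le_lt_trans _ _ ((clamp N%:R (f y) - clamp N%:R (f x)) ^+ 2)).
    by case: (_ < _ <= _)%R; rewrite ?expr1n ?mul1r// expr0n mul0r sqr_ge0.
  rewrite -real_normK ?num_real// -[ltRHS]sqr_sqrtr ?(ltW d0)//.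
  by rewrite ltr_pXn2r ?nnegrE// ltW.
have dom : {ae mu, forall (x : measurableTypeR R) (k : nat), [set: measurableTypeR R] x ->
    (`|g k x| <= ((2 * N%:R) ^+ 2)%:E * (\1_A x)%:E)%E}.
  apply: aeW => x k _; rewrite gee0_abs ?lee_fin ?sqr_ge0//.
  have [y _ ->] := grid_step_eval N k f x; rewrite AE cE -mulrBr exprMn mulrC.
  have -> : \1_A x ^+ 2 = \1_A x :> R.
    by rewrite indicE; case: (_ \in _); rewrite ?expr1n ?expr0n.
  apply: ler_wpM2r => //.
  rewrite -[X in X <= _]real_normK ?num_real//; apply: lerXn2r; rewrite ?nnegrE ?mulr_ge0//.
  apply: (le_trans (ler_normB _ _)); rewrite mulr_natl mulr2n.
  by apply: lerD; apply: clamp_bounded.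
have [_ _ h] := dominated_convergence measurableT mg (measurable_cst _) cv bi dom.
rewrite integral0 in h.
have [M HM] := ecvg0_lt h (exprn_gt0 2 e0).
by exists M => k Mk; apply: Lnorm2_lt => //; exact: HM.
Qed.

Lemma grid_step_dense (e : R) : 0 < e -> exists M, forall N, (M <= N)%N ->
  exists K, forall k, (K <= k)%N -> (N2 (step_fun (grid_step N k f) \- f)%R < e%:E)%E.
Proof.
move=> e0; have e2 : 0 < e / 2 by rewrite divr_gt0.
have [M HM] := truncation_L2 e2; exists M => N MN.
have [K HK] := grid_L2 N e2; exists K => k Kk.
have ms : measurable_fun [set: measurableTypeR R] (step_fun (grid_step N k f)).
  exact: measurable_step_fun.
apply: (le_lt_trans (Lnorm2_triangle ms (mc N) fm)).
rewrite (_ : e%:E = (e / 2)%:E + (e / 2)%:E)%E; last by rewrite -EFinD -splitr.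
by apply: lteD; [exact: HK|exact: HM].
Qed.

End approx.
End grid_step.

(** * The beta integral and the reflection formula *)

Section calculus.
Variable R : realType.
Implicit Types (f g : R -> R) (x : R).

(** The rules that follow are restated for functions written pointwise, so that a derivative can be
    assembled by unification; this lemma then brings it into the wanted form. *)
Lemma deriv_eq f x (a b : R) : is_derive x 1 f a -> a = b -> is_derive x 1 f b.
Proof. by move=> h <-. Qed.

Lemma deriv_cst (c x : R) : is_derive x 1 (fun=> c) 0.
Proof. exact: is_derive_cst. Qed.

Lemma deriv_id x : is_derive x 1 (fun y : R => y) 1.
Proof. exact: is_derive_id. Qed.

Lemma deriv_add f g x a b : is_derive x 1 f a -> is_derive x 1 g b ->
  is_derive x 1 (fun y => f y + g y) (a + b).
Proof. exact: is_deriveD. Qed.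

Lemma deriv_opp f x a : is_derive x 1 f a -> is_derive x 1 (fun y => - f y) (- a).
Proof. exact: is_deriveN. Qed.

Lemma deriv_mul f g x a b : is_derive x 1 f a -> is_derive x 1 g b ->
  is_derive x 1 (fun y => f y * g y) (f x * b + g x * a).
Proof. by move=> h1 h2; exact: is_deriveM. Qed.

Lemma deriv_inv f x a : f x != 0 -> is_derive x 1 f a ->
  is_derive x 1 (fun y => (f y)^-1) (- (f x) ^- 2 * a).
Proof. by move=> f0 h; exact: is_deriveV. Qed.

Lemma deriv_comp f g x a b : is_derive (g x) 1 f a -> is_derive x 1 g b ->
  is_derive x 1 (fun y => f (g y)) (a * b).
Proof. by move=> h1 h2; exact: is_derive1_comp. Qed.

Lemma deriv_exp f x a : is_derive x 1 f a ->
  is_derive x 1 (fun y => expR (f y)) (expR (f x) * a).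
Proof. by move=> h; apply: deriv_comp; exact: is_derive_expR. Qed.

Lemma deriv_sin f x a : is_derive x 1 f a ->
  is_derive x 1 (fun y => sin (f y)) (cos (f x) * a).
Proof. by move=> h; apply: deriv_comp; exact: is_derive_sin. Qed.

Lemma deriv_cos f x a : is_derive x 1 f a ->
  is_derive x 1 (fun y => cos (f y)) (- sin (f x) * a).
Proof. by move=> h; apply: deriv_comp; exact: is_derive_cos. Qed.

Lemma deriv_powR f x (p : R) a : 0 < f x -> is_derive x 1 f a ->
  is_derive x 1 (fun y => f y `^ p) (p * f x `^ (p - 1) * a).
Proof. by move=> f0 h; apply: (deriv_comp (f := fun y => y `^ p)); exact: is_derive1_powR. Qed.

Lemma deriv_sqr f x a : is_derive x 1 f a ->
  is_derive x 1 (fun y => f y ^+ 2) (2 * f x * a).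
Proof.
move=> h; apply: deriv_eq (deriv_mul h h) _; ring.
Qed.

Lemma deriv_continuous f x a : is_derive x 1 f a -> {for x, continuous f}.
Proof.
by case=> h _; apply: differentiable_continuous; exact/derivable1_diffP.
Qed.

End calculus.

Ltac deriv := repeat first
  [ apply: deriv_cst | apply: deriv_id | apply: deriv_add | apply: deriv_opp
  | apply: deriv_sqr | apply: deriv_mul | apply: deriv_inv | apply: deriv_exp | apply: deriv_sin
  | apply: deriv_cos | apply: deriv_powR ].

(** * Substitutions and improper integrals *)

Section affine.
Variable R : realType.
Local Notation mu := (@lebesgue_measure R).

(** The image of Lebesgue measure under the affine map, multiplied by [c], agrees with Lebesgue
    measure on half-open intervals, hence everywhere. *)
Lemma ge0_integral_affine (c b : R) (f : R -> \bar R) : 0 < c ->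
  measurable_fun [set: measurableTypeR R] f -> (forall x, (0 <= f x)%E) ->
  (c%:E * \int[mu]_x f (c * x + b)%R = \int[mu]_x f x)%E.
Proof.
move=> c0 mf f0.
pose phi : measurableTypeR R -> measurableTypeR R := fun x => c * x + b.
have mphi : measurable_fun [set: measurableTypeR R] phi.
  by apply: measurable_funD => //; exact: measurable_funM.
pose phi_mixin := isMeasurableFun.Build _ _ _ _ _ mphi.
pose phi' : {mfun _ >-> _} := HB.pack phi phi_mixin.
have c0' : 0 <= c := ltW c0.
pose k : {nonneg R} := NngNum c0'.
have E (A : set (measurableTypeR R)) : measurable A ->
    mu A = mscale k (pushforward mu phi') A.
  move=> mA; apply: lebesgue_measure_unique => //= _ [[u v]] _ <-.
  rewrite /mscale/= /pushforward.
  have -> : phi @^-1` `]u, v] = `](u - b) / c, (v - b) / c]%classic.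
    apply/seteqP; split=> x /=; rewrite !in_itv/= ltr_pdivrMr// ler_pdivlMr// mulrC.
      by rewrite ltrBlDr lerBrDr.
    by rewrite ltrBlDr lerBrDr.
  rewrite !lebesgue_measure_itv/= !lte_fin ltr_pM2r ?invr_gt0// ltrD2r.
  case: ifPn => _; last by rewrite mule0.
  rewrite -!EFinB -EFinM; congr EFin; field.
  by rewrite lt0r_neq0.
have pf : (\int[pushforward mu phi']_y f y = \int[mu]_x f (c * x + b)%R)%E.
  by rewrite (ge0_integral_pushforward mphi)//.
rewrite -pf.
have -> : (\int[mu]_x f x = \int[mscale k (pushforward mu phi')]_x f x)%E.
  by move=> m; apply: eq_measure_integral => A mA _; exact: E.
by rewrite ge0_integral_mscale.
Qed.

Lemma ge0_integral_opp (f : R -> \bar R) :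
  measurable_fun [set: measurableTypeR R] f -> (forall x, (0 <= f x)%E) ->
  (\int[mu]_x f (- x)%R = \int[mu]_x f x)%E.
Proof.
move=> mf f0.
have -> : (\int[mu]_x f x =
   \int[pushforward mu (-%R : measurableTypeR R -> measurableTypeR R)]_x f x)%E.
  by apply: eq_measure_integral => A mA _; exact/esym/lebesgue_measureN.
by rewrite ge0_integral_pushforward.
Qed.

End affine.

Section improper.
Variable R : realType.
Local Notation mu := (@lebesgue_measure R).

(** The fundamental theorem on each [a n, b n], followed by monotone convergence. Splitting the
    derivative into two nonnegative parts makes this an integration by parts in which integrability
    of [f1] is a conclusion. *)
Lemma improper_FTC (a b : nat -> R) (f1 f2 F : R -> R) (l0 l1 i2 : R) :
  {homo a : m n / (m <= n)%N >-> n <= m} -> {homo b : m n / (m <= n)%N >-> m <= n} ->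
  (forall n, a n < b n) ->
  let D := \bigcup_n (`[a n, b n]%classic : set R) in
  (forall x, D x -> {for x, continuous f1}) -> (forall x, D x -> {for x, continuous f2}) ->
  (forall x, D x -> 0 <= f1 x) -> (forall x, D x -> 0 <= f2 x) ->
  (forall x, D x -> is_derive x 1 F (f1 x - f2 x)) ->
  F (a n) @[n --> \oo] --> l0 -> F (b n) @[n --> \oo] --> l1 ->
  (\int[mu]_(x in D) (f2 x)%:E = i2%:E)%E ->
  (\int[mu]_(x in D) (f1 x)%:E = (i2 + (l1 - l0))%:E)%E.
Proof.
move=> am bm ab D c1 c2 p1 p2 dF Fa Fb I2.
have sub n : `[a n, b n]%classic `<=` D by move=> x ?; exists n.
have cw n (f : R -> R) : (forall x, D x -> {for x, continuous f}) -> {within `[a n, b n], continuous f}.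
  move=> cf; apply: continuous_in_subspaceT => x /set_mem/sub; exact: cf.
have int n (f : R -> R) : (forall x, D x -> {for x, continuous f}) ->
    mu.-integrable `[a n, b n] (EFin \o f).
  move=> cf; apply: continuous_compact_integrable; first exact: segment_compact.
  exact: cw.
have h n : (\int[mu]_(x in `[a n, b n]) (f1 x)%:E =
    \int[mu]_(x in `[a n, b n]) (f2 x)%:E + (F (b n) - F (a n))%:E)%E.
  have Dx x : x \in `]a n, b n[ -> D x.
    by move=> xab; apply: (sub n); exact: subset_itv_oo_cc.
  have cF x : D x -> {for x, continuous F} by move=> /dF; exact: deriv_continuous.
  have Da : D (a n) by apply: (sub n); rewrite /= in_itv/= lexx ltW.
  have Db : D (b n) by apply: (sub n); rewrite /= in_itv/= lexx ltW.
  have cw12 : {within `[a n, b n], continuous (fun x => f1 x - f2 x)}.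
    by apply: cw => x Dx'; apply: cvgB; [exact: c1|exact: c2].
  have dF12 : derivable_oo_LRcontinuous F (a n) (b n).
    split.
    - by move=> x /Dx /dF[].
    - by apply: cvg_at_right_filter; exact: cF.
    - by apply: cvg_at_left_filter; exact: cF.
  have F'12 : {in `]a n, b n[, derive1 F =1 (fun x => f1 x - f2 x)}.
    by move=> x /Dx /dF[_ <-]; rewrite derive1E.
  have := continuous_FTC2 (ab n) cw12 dF12 F'12.
  have -> : (\int[mu]_(x in `[a n, b n]) (f1 x - f2 x)%:E =
     \int[mu]_(x in `[a n, b n]) (f1 x)%:E - \int[mu]_(x in `[a n, b n]) (f2 x)%:E)%E.
    by rewrite -integralB//; exact: int.
  have fi : (\int[mu]_(x in `[a n, b n]) (f2 x)%:E)%E \is a fin_num.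
    by apply: integrable_fin_num => //; exact: int.
  rewrite EFinB; move: fi.
  move: (\int[mu]_(x in _) (f1 x)%:E)%E (\int[mu]_(x in _) (f2 x)%:E)%E => J1 J2 fi <-.
  by rewrite addeC subeK.
have nd : nondecreasing_seq (fun n => `[a n, b n]%classic : set R).
  move=> m n mn; apply/subsetPset => x /=; rewrite !in_itv/= => /andP[x1 x2].
  by rewrite (le_trans (am _ _ mn) x1) (le_trans x2 (bm _ _ mn)).
have cvI (f : R -> R) : (forall x, D x -> {for x, continuous f}) -> (forall x, D x -> 0 <= f x) ->
   (\int[mu]_(x in `[a n, b n]) (f x)%:E @[n --> \oo] --> \int[mu]_(x in D) (f x)%:E)%E.
  move=> cf pf; apply: ge0_nondecreasing_set_cvg_integral => //.
  - by move=> n; exact: (measurable_int mu (int n f cf)).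
  - by move=> n x /sub Dx; rewrite lee_fin pf.
have C1 := cvI f1 c1 p1; have := cvI f2 c2 p2; rewrite I2 => C2.
have C3 : (\int[mu]_(x in `[a n, b n]) (f1 x)%:E @[n --> \oo] --> (i2 + (l1 - l0))%:E)%E.
  under eq_fun do rewrite h.
  rewrite EFinD; apply: cvgeD => //.
  by apply: cvg_EFin; [exact: nearW|exact: cvgB].
by rewrite -(cvg_lim _ C1)// (cvg_lim _ C3).
Qed.

(** Starting at 2 makes [a n < b n] strict already for n = 0. *)
Let a (n : nat) : R := n.+2%:R^-1.
Let b (n : nat) : R := n.+2%:R.

Lemma pos_bigcup : \bigcup_n (`[a n, b n]%classic : set R) = `]0, +oo[%classic.
Proof.
apply/seteqP; split=> x /=.
  move=> [n _]; rewrite /= !in_itv/= andbT => /andP[+ _]; apply: lt_le_trans.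
  by rewrite invr_gt0 ltr0n.
rewrite in_itv/= andbT => x0.
pose n := Num.truncn (x + x^-1); exists n => //=.
have : x + x^-1 <= b n.
  by apply/ltW/(lt_le_trans (truncnS_gt _)); rewrite /b ler_nat.
have xi0 : 0 < x^-1 by rewrite invr_gt0.
move=> h; rewrite in_itv/=; apply/andP; split; last by apply: le_trans h; rewrite lerDl ltW.
rewrite /a -[x]invrK lef_pV2 ?posrE ?ltr0n//.
by apply: le_trans h; rewrite lerDr ltW.
Qed.

Lemma improper_FTC0y (f1 f2 F : R -> R) (l0 l1 i2 : R) :
  (forall x : R, 0 < x -> {for x, continuous f1}) -> (forall x : R, 0 < x -> {for x, continuous f2}) ->
  (forall x : R, 0 < x -> 0 <= f1 x) -> (forall x : R, 0 < x -> 0 <= f2 x) ->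
  (forall x : R, 0 < x -> is_derive x 1 F (f1 x - f2 x)) ->
  F x @[x --> 0^'+] --> l0 -> F x @[x --> +oo] --> l1 ->
  (\int[mu]_(x in `]0%R, +oo[) (f2 x)%:E = i2%:E)%E ->
  (\int[mu]_(x in `]0%R, +oo[) (f1 x)%:E = (i2 + (l1 - l0))%:E)%E.
Proof.
move=> c1 c2 p1 p2 dF F0 Fy I2; rewrite -pos_bigcup in I2 *.
have D0 x : (\bigcup_n (`[a n, b n]%classic : set R)) x -> 0 < x.
  by rewrite pos_bigcup /= in_itv/= andbT.
apply: (improper_FTC (F := F) (f2 := f2)) => //.
- move=> m n mn; rewrite /a lef_pV2 ?posrE ?ltr0n//.
  by rewrite ler_nat.
- by move=> m n mn; rewrite /b ler_nat.
- move=> n; rewrite /a /b; apply: (@lt_le_trans _ _ 1); last by rewrite ler1n.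
  by rewrite invf_lt1 ?ltr0n// ltr1n.
- by move=> x /D0; exact: c1.
- by move=> x /D0; exact: c2.
- by move=> x /D0; exact: p1.
- by move=> x /D0; exact: p2.
- by move=> x /D0; exact: dF.
- move/cvg_at_rightP : F0; apply; split=> [n|]; first by rewrite /a invr_gt0 ltr0n.
  have := @cvg_harmonic R; rewrite -(cvg_shiftS (@harmonic R)); exact.
- apply: (cvg_comp _ _ _ Fy); rewrite /b.
  have /cvgryPge h := @cvgr_idn R.
  apply/cvgryPge => A; have [N _ HN] := h A.
  by exists N => // n /= Nn; apply: HN => /=; rewrite (leq_trans Nn)// -addn2 leq_addr.
Qed.

End improper.

(** * The Gamma function *)

Section gamma.
Variable R : realType.
Local Notation mu := (@lebesgue_measure R).
Implicit Types (x y t : R).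

Lemma cvg_opp0 (T : Type) (F : set_system T) {FF : Filter F} (f : T -> R) :
  f z @[z --> F] --> (0 : R) -> - f z @[z --> F] --> (0 : R).
Proof. by move=> h; rewrite -[X in _ --> X](@oppr0 R); exact: cvgN. Qed.

Lemma powR_expRN_cvg0 x : t `^ x * expR (- t) @[t --> +oo] --> (0 : R).
Proof.
pose n := (Num.truncn x).+1.
have xn : x <= n%:R by exact/ltW/truncnS_gt.
pose K : R := (n.+1)`!%:R.
have K0 : 0 < K by rewrite ltr0n fact_gt0.
apply/cvgrPdist_lt => e e0; near=> t.
have t1 : 1 <= t by near: t; exact: nbhs_pinfty_ge.
have t0 : 0 < t by exact: lt_le_trans t1.
have tK : K / e < t by near: t; apply: nbhs_pinfty_gt; exact: num_real.
rewrite sub0r normrN ger0_norm ?mulr_ge0 ?powR_ge0 ?expR_ge0//.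
have h1 : t `^ x <= t ^+ n by rewrite -powR_mulrn ?(ltW t0)//; apply: ler_powR.
have h2 : t ^+ n.+1 / K <= expR t.
  by apply: le_trans (expR_ge1Dxn n (ltW t0)); rewrite lerDr.
rewrite expRN ltr_pdivrMr ?expR_gt0//.
apply: (le_lt_trans h1); apply: (@lt_le_trans _ _ (e * (t ^+ n.+1 / K))); last first.
  by apply: ler_wpM2l => //; exact: ltW.
rewrite exprS mulrA mulrA ltr_pdivlMr// mulrC ltr_pM2r ?exprn_gt0//.
by move: tK; rewrite ltr_pdivrMr// mulrC.
Unshelve. all: by end_near. Qed.

Lemma powR_expRN_cvg0_at0 x : 0 < x -> t `^ x * expR (- t) @[t --> 0^'+] --> (0 : R).
Proof.
move=> x0; rewrite -[X in _ --> X](mul0r (expR (- 0) : R)); apply: cvgM.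
  exact: (powR_cvg0 x0).
apply: cvg_at_right_filter.
apply: (@continuous_comp _ _ _ (fun t => - t) (@expR R)).
  exact: cvgN.
exact: continuous_expR.
Qed.

(** Kept in the extended reals because [Gamma] is the real part of this integral and says nothing
    about it until finiteness is known. *)
Definition gammaE x : \bar R :=
  (\int[mu]_(t in `]0%R, +oo[) (t `^ (x - 1) * expR (- t))%:E)%E.

Lemma gammaE_ge0 x : (0 <= gammaE x)%E.
Proof. by apply: integral_ge0 => t _; rewrite lee_fin mulr_ge0 ?powR_ge0 ?expR_ge0. Qed.

Let deriv_F x t : 0 < t -> is_derive t 1 (fun t => t `^ x * expR (- t))
  (x * (t `^ (x - 1) * expR (- t)) - t `^ x * expR (- t)).
Proof.
move=> t0; apply: deriv_eq; first by deriv.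
by rewrite mulr1; ring.
Qed.

Let cont x t : 0 < t -> {for t, continuous (fun t => t `^ x * expR (- t))}.
Proof. by move=> /(deriv_F x) /deriv_continuous. Qed.

Let contc c x t : 0 < t -> {for t, continuous (fun t => c * (t `^ x * expR (- t)))}.
Proof. by move=> t0; apply: continuousM; [exact: cvg_cst|exact: cont]. Qed.

Let f_ge0 x t : 0 <= t `^ x * expR (- t).
Proof. by rewrite mulr_ge0 ?powR_ge0 ?expR_ge0. Qed.

Lemma measurable_powR_expRN (x : R) : measurable_fun [set: measurableTypeR R]
  (fun t => t `^ x * expR (- t)).
Proof.
apply: measurable_funM; first exact: measurable_powR.
by apply: (@measurableT_comp _ _ _ _ _ _ (@expR R)) => //; exact: measurable_expR.
Qed.

Lemma gammaE_scale x c : 0 <= c ->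
  (\int[mu]_(t in `]0%R, +oo[) (c * (t `^ (x - 1) * expR (- t)))%:E = c%:E * gammaE x)%E.
Proof.
move=> c0; under eq_integral do rewrite EFinM.
rewrite ge0_integralZl_EFin//.
- by move=> t _; rewrite lee_fin.
- apply/measurable_EFinP; apply: measurable_funTS; exact: measurable_powR_expRN.
Qed.

Lemma gammaE_up x i : 0 < x -> (gammaE x = i%:E -> gammaE (x + 1) = (x * i)%:E)%E.
Proof.
move=> x0 gx; rewrite /gammaE addrK.
have := @improper_FTC0y R (fun t => t `^ x * expR (- t))
  (fun t => x * (t `^ (x - 1) * expR (- t))) (fun t => - (t `^ x * expR (- t))) 0 0 (x * i).
rewrite subrr addr0; apply => //.
- by move=> t; exact: cont.
- by move=> t; exact: contc.
- by move=> t _; rewrite mulr_ge0// ltW.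
- move=> t t0; apply: deriv_eq (deriv_opp (deriv_F x t0)) _; ring.
- by apply: cvg_opp0; exact: powR_expRN_cvg0_at0.
- by apply: cvg_opp0; exact: powR_expRN_cvg0.
- by rewrite gammaE_scale ?(ltW x0)// gx.
Qed.

Lemma gammaE_down x i : 0 < x -> (gammaE (x + 1) = i%:E -> x%:E * gammaE x = i%:E)%E.
Proof.
move=> x0; rewrite {1}/gammaE addrK => gx.
rewrite -gammaE_scale ?(ltW x0)//.
have := @improper_FTC0y R (fun t => x * (t `^ (x - 1) * expR (- t)))
  (fun t => t `^ x * expR (- t)) (fun t => t `^ x * expR (- t)) 0 0 i.
rewrite subrr addr0; apply => //.
- by move=> t; exact: contc.
- by move=> t; exact: cont.
- by move=> t _; rewrite mulr_ge0// ltW.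
- by move=> t; exact: deriv_F.
- exact: powR_expRN_cvg0_at0.
- exact: powR_expRN_cvg0.
Qed.

Lemma gammaE1 : gammaE 1 = 1%E.
Proof.
rewrite /gammaE subrr.
have := @improper_FTC0y R (fun t => t `^ 0 * expR (- t)) (fun=> 0)
  (fun t => - expR (- t)) (-1) 0 0.
rewrite add0r sub0r opprK; apply => //.
- by move=> t; exact: cont.
- by move=> t _; exact: cvg_cst.
- move=> t t0; apply: deriv_eq.
  by rewrite powRr0 subr0; ring.
- apply: cvg_at_right_filter; rewrite -[X in _ --> X]/(- 1) -[X in - X](@expR0 R) -{2}(@oppr0 R).
  apply: cvgN; apply: (@continuous_comp _ _ _ (fun t => - t) (@expR R)).
    exact: cvgN.
  exact: continuous_expR.
- apply: cvg_opp0; have := powR_expRN_cvg0 0.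
  by under eq_fun do rewrite powRr0 mul1r.
- by rewrite integral0_eq.
Qed.

Lemma gammaE_nat n : exists i : R, gammaE n.+1%:R = i%:E.
Proof.
elim: n => [|n [i ih]]; first by exists 1; exact: gammaE1.
by exists (n.+1%:R * i); rewrite -natr1; apply: gammaE_up => //; rewrite ltr0n.
Qed.

(** For y >= 1 the power t^(y - 1) is at most 1 + t^n with n the integer part of y, so the values at
    integers suffice. For smaller positive arguments the functional equation, read downwards,
    excludes infinity. *)
Lemma gammaE_fin x : 0 < x -> gammaE x \is a fin_num.
Proof.
have h1 y : 1 <= y -> gammaE y \is a fin_num.
  move=> y1; pose n := Num.truncn y.
  have [i gi] := gammaE_nat n.
  rewrite ge0_fin_numE ?gammaE_ge0//.
  apply: (@le_lt_trans _ _ (gammaE 1 + gammaE n.+1%:R)%E); last by rewrite gammaE1 gi ltry.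
  rewrite /gammaE -ge0_integralD//=; last 4 first.
  - by move=> t _; rewrite lee_fin.
  - by apply/measurable_EFinP/measurable_funTS; exact: measurable_powR_expRN.
  - by move=> t _; rewrite lee_fin.
  - by apply/measurable_EFinP/measurable_funTS; exact: measurable_powR_expRN.
  apply: ge0_le_integral => //=.
  - by move=> t _; rewrite lee_fin.
  - by apply/measurable_EFinP/measurable_funTS; exact: measurable_powR_expRN.
  - apply/measurable_EFinP/measurable_funTS; apply: measurable_funD; exact: measurable_powR_expRN.
  move=> t; rewrite in_itv/= andbT => t0; rewrite lee_fin -mulrDl.
  apply: ler_wpM2r; first exact: expR_ge0.
  rewrite subrr powRr0; have [t1|t1] := leP t 1.
    apply: (@le_trans _ _ 1); last by rewrite lerDl powR_ge0.
    rewrite -[leRHS](congr1 (@^~ (y - 1)) (powR1 R)); apply: ge0_ler_powR => //; rewrite ?nnegrE ?(ltW t0)//.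
    by rewrite subr_ge0.
  apply: (@le_trans _ _ (t `^ (n.+1%:R - 1))); last by rewrite lerDr.
  by apply: ler_powR; rewrite ?(ltW t1)// lerD2r; exact/ltW/truncnS_gt.
move=> x0; have := h1 (x + 1); rewrite lerDr => /(_ (ltW x0)) fx.
have := gammaE_down x0 (esym (fineK fx)); have := gammaE_ge0 x.
by case: (gammaE x) => [r| |] //; rewrite gt0_muley ?lte_fin.
Qed.

Lemma GammaE x : 0 < x -> gammaE x = (Gamma x)%:E.
Proof. by move=> x0; rewrite /Gamma /Rintegral fineK//; exact: gammaE_fin. Qed.

Lemma GammaS x : 0 < x -> Gamma (x + 1) = x * Gamma x.
Proof.
move=> x0; have := gammaE_up x0 (GammaE x0); rewrite GammaE ?addr_gt0//.
by case.
Qed.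

Lemma Gamma1 : Gamma (1 : R) = 1.
Proof. by have := GammaE (@ltr01 R); rewrite gammaE1 => -[]. Qed.

Lemma Gamma_gt0 x : 0 < x -> 0 < Gamma x.
Proof.
move=> x0; rewrite -lte_fin -GammaE//.
(* On [1, 2] the logarithm lies in [0, 1], so t^(x - 1) is at least exp(-|x - 1|), and exp(-t) is at
   least exp(-2). *)
pose c : R := expR (- 2 - `|x - 1|).
have c0 : 0 < c by exact: expR_gt0.
apply: (@lt_le_trans _ _ (\int[mu]_(t in `[1%R, 2%R]) c%:E)%E).
  rewrite integral_cst//= lebesgue_measure_itv/= lte_fin ltr1n -EFinB -EFinM lte_fin.
  by rewrite mulr_gt0// subr_gt0 ltr1n.
apply: (@le_trans _ _ (\int[mu]_(t in `[1%R, 2%R]) (t `^ (x - 1) * expR (- t))%:E)%E).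
  apply: ge0_le_integral => //=.
  - by move=> t _; rewrite lee_fin ltW.
  - by apply/measurable_EFinP/measurable_funTS; exact: measurable_powR_expRN.
  move=> t; rewrite in_itv/= => /andP[t1 t2]; rewrite lee_fin /c expRD mulrC.
  apply: ler_pM; rewrite ?expR_ge0//; last by rewrite ler_expR lerN2.
  have t0 : 0 < t by exact: lt_le_trans t1.
  rewrite /powR gt_eqF// ler_expR.
  have l0 : 0 <= ln t by exact: ln_ge0.
  have l1 : ln t <= 1.
    by have := @le_ln1Dx R (t - 1); rewrite (_ : 1 + (t - 1) = t); [lra|ring].
  have := ler_norm (- (x - 1)); rewrite normrN; have := normr_ge0 (x - 1).
  nra.
apply: ge0_subset_integral => //=.
- by apply/measurable_EFinP/measurable_funTS; exact: measurable_powR_expRN.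
- by move=> t _; rewrite lee_fin.
- move=> t /=; rewrite !in_itv/= => /andP[t1 _]; rewrite andbT.
  exact: lt_le_trans t1.
Qed.

End gamma.

Local Opaque Gamma.

Section beta.
Variable R : realType.
Local Notation mu := (@lebesgue_measure R).
Implicit Types (x y t s v : R).

Lemma pos_pow_ge0 x a : 0 <= pos_pow x a.
Proof. by rewrite /pos_pow; case: ifP => // _; exact: powR_ge0. Qed.

Lemma pos_powE x a : 0 < x -> pos_pow x a = x `^ a.
Proof. by rewrite /pos_pow => ->. Qed.

Lemma pos_pow_le0 x a : x <= 0 -> pos_pow x a = 0.
Proof. by rewrite /pos_pow ltNge => ->. Qed.

Lemma measurable_pos_pow a : measurable_fun [set: measurableTypeR R] (fun x => pos_pow x a).
Proof.
rewrite /pos_pow; apply: measurable_fun_ifT.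
- exact: measurable_fun_ltr.
- exact: measurable_powR.
- exact: measurable_cst.
Qed.

Lemma pos_powM x y a : 0 < x -> pos_pow (x * y) a = x `^ a * pos_pow y a.
Proof.
move=> x0; rewrite /pos_pow pmulr_rgt0//; case: ifPn => [y0|_]; last by rewrite mulr0.
by rewrite powRM// ltW.
Qed.

Lemma integral_pos (f : R -> R) :
  (\int[mu]_(t in `]0%R, +oo[) (f t)%:E = \int[mu]_t (if 0 < t then f t else 0)%:E)%E.
Proof.
rewrite integral_mkcond; apply: eq_integral => t _.
by rewrite patchE mem_setE /= in_itv/= andbT; case: ifP.
Qed.

(** Moves the half line into the integrand, since Tonelli's theorem and the affine substitution are
    applied on the whole line. *)
Lemma integral_pos_pow (f : R -> R) a :
  (\int[mu]_(t in `]0%R, +oo[) (t `^ a * f t)%:E = \int[mu]_t (pos_pow t a * f t)%:E)%E.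
Proof.
rewrite integral_pos; apply: eq_integral => t _.
by rewrite /pos_pow; case: ifP => // _; rewrite mul0r.
Qed.

Lemma measurable_pos_pow_exp a c :
  measurable_fun [set: measurableTypeR R] (fun t => pos_pow t a * expR (- (c * t))).
Proof.
apply: measurable_funM; first exact: measurable_pos_pow.
apply: (@measurableT_comp _ _ _ _ _ _ (@expR R)) => //.
by apply: measurableT_comp => //; exact: measurable_funM.
Qed.

Lemma Gamma_scale x c : 0 < x -> 0 < c ->
  (\int[mu]_t (pos_pow t (x - 1) * expR (- (c * t)))%:E = (c `^ (- x) * Gamma x)%:E)%E.
Proof.
move=> x0 c0; have := GammaE x0; rewrite /gammaE integral_pos_pow => gx.
have m : measurable_fun [set: measurableTypeR R] (fun t => (pos_pow t (x - 1) * expR (- t))%:E).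
  apply/measurable_EFinP; apply: measurable_funM; first exact: measurable_pos_pow.
  by apply: (@measurableT_comp _ _ _ _ _ _ (@expR R)).
have p t : (0 <= (pos_pow t (x - 1) * expR (- t))%:E)%E.
  by rewrite lee_fin mulr_ge0 ?pos_pow_ge0 ?expR_ge0.
have := ge0_integral_affine 0 c0 m p; rewrite gx => h.
set I := (X in X = _).
have E : (\int[mu]_t (pos_pow (c * t + 0) (x - 1) * expR (- (c * t + 0)))%:E =
    (c `^ (x - 1))%:E * I)%E.
  rewrite /I -ge0_integralZl_EFin ?powR_ge0//; last 2 first.
  - by move=> t _; rewrite lee_fin mulr_ge0 ?pos_pow_ge0 ?expR_ge0.
  - by apply/measurable_EFinP; exact: measurable_pos_pow_exp.
  apply: eq_integral => t _; rewrite addr0 -EFinM; congr EFin.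
  by rewrite pos_powM// mulrA.
rewrite E in h; rewrite EFinM -h !muleA -!EFinM.
rewrite [X in X%:E](_ : _ = 1) ?mul1e//.
rewrite -mulrA -{2}(powRr1 (ltW c0)) -powRD; last by rewrite (gt_eqF c0) implybT.
rewrite -powRD; last by rewrite (gt_eqF c0) implybT.
by rewrite [X in _ `^ X](_ : _ = 0) ?powRr0//; ring.
Qed.

(** The double integral of s^(x+y-1) v^(x-1) exp(-s(1+v)) is computed in both orders: integrating
    first in v gives Gamma(x) Gamma(y), first in s gives Gamma(x+y) times the beta integral. *)
Lemma beta_Gamma x y : 0 < x -> 0 < y ->
  (\int[mu]_(v in `]0%R, +oo[) (v `^ (x - 1) * (1 + v) `^ (- (x + y)))%:E =
   (Gamma x * Gamma y / Gamma (x + y))%:E)%E.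
Proof.
move=> x0 y0; have xy0 : 0 < x + y by exact: addr_gt0.
pose h (z : measurableTypeR R * measurableTypeR R) : \bar R :=
  (pos_pow z.1 (x + y - 1) * (pos_pow z.2 (x - 1) * expR (- (z.1 * (1 + z.2)))))%:E.
have mh : measurable_fun [set: measurableTypeR R * measurableTypeR R] h.
  apply/measurable_EFinP; apply: measurable_funM.
    by apply: (@measurableT_comp _ _ _ _ _ _ (fun t => pos_pow t (x + y - 1))) => //; exact: measurable_pos_pow.
  apply: measurable_funM.
    by apply: (@measurableT_comp _ _ _ _ _ _ (fun t => pos_pow t (x - 1))) => //; exact: measurable_pos_pow.
  apply: (@measurableT_comp _ _ _ _ _ _ (@expR R)) => //.
  by apply: measurableT_comp => //; apply: measurable_funM => //; apply: measurable_funD.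
have h0 z : (0 <= h z)%E by rewrite lee_fin !mulr_ge0 ?pos_pow_ge0 ?expR_ge0.
have := fubini_tonelli (m1 := mu) (m2 := mu) h mh h0.
rewrite /fubini_F /fubini_G /h /=.
have -> : (\int[mu]_s \int[mu]_v (pos_pow s (x + y - 1) * (pos_pow v (x - 1) * expR (- (s * (1 + v)))))%:E =
    \int[mu]_s (Gamma x * (pos_pow s (y - 1) * expR (- (1 * s))))%:E)%E.
  apply: eq_integral => s _; have [s0|s0] := ltP 0 s; last first.
    by rewrite !pos_pow_le0// mul0r mulr0 integral0_eq// => v _; rewrite mul0r.
  have E v : pos_pow s (x + y - 1) * (pos_pow v (x - 1) * expR (- (s * (1 + v)))) =
      pos_pow s (x + y - 1) * expR (- s) * (pos_pow v (x - 1) * expR (- (s * v))).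
    by rewrite mulrDr mulr1 opprD expRD; ring.
  under eq_integral do rewrite E EFinM.
  rewrite ge0_integralZl_EFin ?mulr_ge0 ?pos_pow_ge0 ?expR_ge0//; last 2 first.
  - by move=> t _; rewrite lee_fin mulr_ge0 ?pos_pow_ge0 ?expR_ge0.
  - by apply/measurable_EFinP; exact: measurable_pos_pow_exp.
  rewrite Gamma_scale// -EFinM mul1r; congr EFin; rewrite !pos_powE//.
  rewrite (_ : x + y - 1 = x + (y - 1)); last by ring.
  rewrite powRD; last by rewrite (gt_eqF s0) implybT.
  rewrite powRN; field; exact/lt0r_neq0/powR_gt0.
have -> : (\int[mu]_v \int[mu]_s (pos_pow s (x + y - 1) * (pos_pow v (x - 1) * expR (- (s * (1 + v)))))%:E =
    \int[mu]_v (Gamma (x + y) * (pos_pow v (x - 1) * (1 + v) `^ (- (x + y))))%:E)%E.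
  apply: eq_integral => v _; have [v0|v0] := ltP 0 v; last first.
    rewrite (@pos_pow_le0 v)// mul0r mulr0 integral0_eq// => s _.
    by rewrite mul0r mulr0.
  have E s : pos_pow s (x + y - 1) * (pos_pow v (x - 1) * expR (- (s * (1 + v)))) =
      pos_pow v (x - 1) * (pos_pow s (x + y - 1) * expR (- ((1 + v) * s))).
    by rewrite mulrCA (mulrC s).
  under eq_integral do rewrite E EFinM.
  have v1 : 0 < 1 + v by exact: addr_gt0.
  rewrite ge0_integralZl_EFin ?pos_pow_ge0//; last 2 first.
  - by move=> t _; rewrite lee_fin mulr_ge0 ?pos_pow_ge0 ?expR_ge0.
  - by apply/measurable_EFinP; exact: measurable_pos_pow_exp.
  by rewrite Gamma_scale// -EFinM; congr EFin; ring.
under eq_integral do rewrite EFinM.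
rewrite ge0_integralZl_EFin ?(ltW (Gamma_gt0 _))//; last 2 first.
- by move=> t _; rewrite lee_fin mulr_ge0 ?pos_pow_ge0 ?expR_ge0.
- by apply/measurable_EFinP; exact: measurable_pos_pow_exp.
rewrite Gamma_scale// powR1 mul1r -EFinM.
under [in X in _ = X -> _]eq_integral do rewrite EFinM.
rewrite ge0_integralZl_EFin ?(ltW (Gamma_gt0 _))//; last 2 first.
- by move=> t _; rewrite lee_fin mulr_ge0 ?pos_pow_ge0 ?powR_ge0.
- apply/measurable_EFinP/measurable_funM; first exact: measurable_pos_pow.
  apply: (@measurableT_comp _ _ _ _ _ _ (fun t => t `^ (- (x + y)))) => //.
  by apply: measurable_funD.
rewrite -integral_pos_pow => e.
have g0 := Gamma_gt0 xy0.
rewrite mulrC EFinM e muleA -EFinM mulVf ?mul1e//; exact/lt0r_neq0.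
Qed.

End beta.

Section square_substitution.
Variable R : realType.
Local Notation mu := (@lebesgue_measure R).

Let a (n : nat) : R := n.+2%:R^-1.
Let b (n : nat) : R := n.+2%:R.

Let a_gt0 n : 0 < a n. Proof. by rewrite invr_gt0 ltr0n. Qed.

Let ab n : a n <= b n.
Proof.
rewrite /a /b; apply: (@le_trans _ _ 1); last by rewrite ler1n.
by rewrite invf_le1 ?ltr0n// ler1n.
Qed.

Let am : {homo a : m n / (m <= n)%N >-> n <= m}.
Proof. by move=> m n mn; rewrite /a lef_pV2 ?posrE ?ltr0n// ler_nat. Qed.

Let bm : {homo b : m n / (m <= n)%N >-> m <= n}.
Proof. by move=> m n mn; rewrite /b ler_nat. Qed.

Lemma ge0_integral_pos_cvg (G : R -> R) (u v : nat -> R) :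
  (forall x : R, 0 < x -> {for x, continuous G}) -> (forall x : R, 0 < x -> 0 <= G x) ->
  {homo u : m n / (m <= n)%N >-> n <= m} -> {homo v : m n / (m <= n)%N >-> m <= n} ->
  \bigcup_n (`[u n, v n]%classic : set R) = `]0, +oo[%classic ->
  (\int[mu]_(x in `[u n, v n]) (G x)%:E @[n --> \oo] --> \int[mu]_(x in `]0%R, +oo[) (G x)%:E)%E.
Proof.
move=> cG G0 um vm uv.
have D0 n x : `[u n, v n]%classic x -> 0 < x.
  move=> h; have : (\bigcup_n (`[u n, v n]%classic : set R)) x by exists n.
  by rewrite uv /= in_itv/= andbT.
rewrite -uv; apply: ge0_nondecreasing_set_cvg_integral => //.
- move=> m n mn; apply/subsetPset => x /=; rewrite !in_itv/= => /andP[x1 x2].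
  by rewrite (le_trans (um _ _ mn) x1) (le_trans x2 (vm _ _ mn)).
- move=> n; apply: (@measurable_int _ _ _ mu).
  apply: continuous_compact_integrable; first exact: segment_compact.
  by apply: continuous_in_subspaceT => x /set_mem/D0; exact: cG.
- by move=> n x /D0 x0; rewrite lee_fin G0.
Qed.

Lemma ge0_integral_sqr (G : R -> R) :
  (forall x : R, 0 < x -> {for x, continuous G}) -> (forall x : R, 0 < x -> 0 <= G x) ->
  (\int[mu]_(x in `]0%R, +oo[) (G x)%:E =
   \int[mu]_(x in `]0%R, +oo[) (G (x ^+ 2) * (2 * x))%:E)%E.
Proof.
move=> cG G0.
have dF (x : R) : is_derive x 1 (fun x : R => x ^+ 2) (2 * x).
  by apply: deriv_eq (deriv_sqr (deriv_id x)) _; rewrite mulr1.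
have dE : derive1 (fun x : R => x ^+ 2) = (fun x => 2 * x).
  by apply/funext => x; rewrite derive1E; have [_ ->] := dF x.
have cF (x : R) : {for x, continuous (fun x : R => x ^+ 2)} by exact: deriv_continuous (dF x).
have cF' (x : R) : {for x, continuous (fun x : R => 2 * x)}.
  by apply: cvgM; [exact: cvg_cst|exact: cvg_id].
have C1 : (\int[mu]_(x in `[(a n ^+ 2)%R, (b n ^+ 2)%R]) (G x)%:E @[n --> \oo] -->
    \int[mu]_(x in `]0%R, +oo[) (G x)%:E)%E.
  apply: ge0_integral_pos_cvg => //.
  - by move=> m n mn; rewrite ler_sqr ?nnegrE ?(ltW (a_gt0 _))//; exact: am.
  - by move=> m n mn; rewrite ler_sqr ?nnegrE ?ler0n//; exact: bm.
  apply/seteqP; split=> x /=.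
    move=> [n _]; rewrite /= !in_itv/= andbT => /andP[+ _]; apply: lt_le_trans.
    by rewrite exprn_gt0.
  rewrite in_itv/= andbT => x0.
  have : (\bigcup_n (`[a n, b n]%classic : set R)) (Num.sqrt x).
    by rewrite pos_bigcup /= in_itv/= andbT sqrtr_gt0.
  move=> [n _]; rewrite /= in_itv/= => /andP[h1 h2]; exists n => //=.
  rewrite in_itv/= -(sqr_sqrtr (ltW x0)) !ler_sqr ?nnegrE ?sqrtr_ge0 ?ler0n ?(ltW (a_gt0 _))//.
  by rewrite h1 h2.
have C2 : (\int[mu]_(x in `[a n, b n]) (G (x ^+ 2) * (2 * x))%:E @[n --> \oo] -->
    \int[mu]_(x in `]0%R, +oo[) (G (x ^+ 2) * (2 * x))%:E)%E.
  apply: ge0_integral_pos_cvg => //.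
  - move=> x x0; apply: cvgM; last exact: cF'.
    apply: (@continuous_comp _ _ _ (fun x : R => x ^+ 2) G); first exact: cF.
    by apply: cG; rewrite exprn_gt0.
  - by move=> x x0; rewrite mulr_ge0 ?G0 ?exprn_gt0// mulr_ge0// ltW.
  - exact: pos_bigcup.
have E n : (\int[mu]_(x in `[(a n ^+ 2)%R, (b n ^+ 2)%R]) (G x)%:E =
    \int[mu]_(x in `[a n, b n]) (G (x ^+ 2) * (2 * x))%:E)%E.
  rewrite (@integration_by_substitution_increasing _ (fun x : R => x ^+ 2)) ?dE//.
  - move=> x y; rewrite !in_itv/= => /andP[x1 _] /andP[y1 _] xy.
    by rewrite ltr_sqr ?nnegrE ?(le_trans (ltW (a_gt0 n)))//.
  - by move=> x _; exact: cF'.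
  - by apply: cvgP; apply: cvg_at_right_filter; exact: cF'.
  - by apply: cvgP; apply: cvg_at_left_filter; exact: cF'.
  - split.
    + by move=> x _; have [] := dF x.
    + by apply: cvg_at_right_filter; exact: cF.
    + by apply: cvg_at_left_filter; exact: cF.
  - apply: continuous_in_subspaceT => x; rewrite inE /= in_itv/= => /andP[x1 _].
    by apply: cG; apply: lt_le_trans x1; rewrite exprn_gt0.
rewrite -(cvg_lim _ C1)// -(cvg_lim _ C2)//.
by congr (limn _); apply/funext => n; exact: E.
Qed.

End square_substitution.

(** * The reflection formula by rotating the ray of integration *)

Section reflection.
Variable R : realType.
Local Notation mu := (@lebesgue_measure R).

Lemma powRN_cvg0 (p : R) : 0 < p -> v `^ (- p) @[v --> +oo] --> (0 : R).
Proof.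
move=> p0; apply/cvgrPdist_lt => e e0; near=> v.
have v0 : 0 < v by near: v; apply: nbhs_pinfty_gt; exact: num_real.
have ve : e `^ (- p^-1) < v by near: v; apply: nbhs_pinfty_gt; exact: num_real.
rewrite sub0r normrN ger0_norm ?powR_ge0// powRN invf_plt ?posrE ?powR_gt0//.
have -> : e^-1 = (e `^ (- p^-1)) `^ p.
  by rewrite -powRrM mulNr mulVf ?lt0r_neq0// -powR_inv1 ?(ltW e0).
by apply: gt0_ltr_powR => //; rewrite nnegrE ?powR_ge0 ?(ltW v0).
Unshelve. all: by end_near. Qed.

Lemma beta_Gamma1 (x : R) : 0 < x < 1 ->
  (\int[mu]_(v in `]0%R, +oo[) (v `^ (x - 1) / (1 + v))%:E = (Gamma x * Gamma (1 - x))%:E)%E.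
Proof.
move=> /andP[x0 x1]; have y0 : 0 < 1 - x by rewrite subr_gt0.
have := beta_Gamma x0 y0.
rewrite (_ : x + (1 - x) = 1); last by ring.
rewrite Gamma1 divr1 => <-; apply: eq_integral => v; rewrite inE /= in_itv/= andbT => v0.
by rewrite powR_inv1// addr_ge0// ltW.
Qed.

Section rotation.
Variable x : R.
Hypothesis x01 : 0 < x < 1.
Let x0 : 0 < x. Proof. by case/andP: x01. Qed.
Let x1 : x < 1. Proof. by case/andP: x01. Qed.
Local Notation P := (`]0, +oo[%classic : set R).

Let w (t : R) : R := x * (t - pi / 2).
Let D (t v : R) : R := 1 + 2 * v * cos t + v ^+ 2.
(* Up to the constant phase e^(-i x pi/2), [A t] and [B t] are -Im and v Re of
   the integrand z^(x-1)/(1+z) dz/dv on the ray z = v e^(it); by the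
   Cauchy-Riemann equations [dA] is both dA/dt and -dB/dv. *)
Let A (t v : R) : R := v `^ (x - 1) * (v * sin (t - w t) - sin (w t)) / D t v.
Let B (t v : R) : R := v `^ x * (cos (w t) + v * cos (t - w t)) / D t v.
Let dA (t v : R) : R := v `^ (x - 1) *
  ((v * (1 - x) * cos (t - w t) - x * cos (w t)) / D t v +
   (v * sin (t - w t) - sin (w t)) * (2 * v * sin t) / D t v ^+ 2).
(** A common dominating function for [A t] and [dA t]. The constant is 3 * 4: the two terms of [dA]
    contribute 1 and 2 times (1 + v) / D, and [quot_le] bounds this quotient by 4 / (1 + v). *)
Let G (v : R) : R := 12 * (v `^ (x - 1) / (1 + v)).

(** [D t v] is |1 + z|^2 at z = v e^(it). Letting cos t go down to -1/2 leaves room for a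
    neighbourhood of t = pi / 2, where differentiation under the integral sign takes place. *)
Let D_ge (t v : R) : - 2^-1 <= cos t -> 0 < v -> (1 + v ^+ 2) / 2 <= D t v.
Proof.
rewrite /D => ct v0; have : - v <= 2 * v * cos t.
  have : 0 <= 2 * v * (cos t + 2^-1).
    by apply: mulr_ge0; [rewrite mulr_ge0// ltW|rewrite -lerBlDr sub0r].
  by rewrite mulrDr (mulrC 2 v) -(mulrA v 2 2^-1) divff ?pnatr_eq0// mulr1; lra.
by have := sqr_ge0 (1 - v); lra.
Qed.

Let D_gt0 (t v : R) : - 2^-1 <= cos t -> 0 < v -> 0 < D t v.
Proof.
move=> ct v0; apply: lt_le_trans (D_ge ct v0).
by rewrite divr_gt0// ltr_pwDl// sqr_ge0.
Qed.

Let dw (t : R) : is_derive t 1 w x.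
Proof.
by apply: deriv_eq (deriv_mul (deriv_cst x t) (deriv_add (deriv_id t) (deriv_cst _ t))) _; ring.
Qed.

Let deriv_A (t v : R) : - 2^-1 <= cos t -> 0 < v ->
  is_derive t 1 (fun t => A t v) (dA t v).
Proof.
move=> ct v0; have D0 := lt0r_neq0 (D_gt0 ct v0); rewrite /A /dA.
have h1 := deriv_sin (deriv_add (deriv_id t) (deriv_opp (dw t))).
have h2 := deriv_opp (deriv_sin (dw t)).
have h3 : is_derive t 1 (fun t => D t v) (2 * v * - sin t).
  apply: deriv_eq (deriv_add (deriv_add (deriv_cst 1 t)
    (deriv_mul (deriv_cst (2 * v) t) (deriv_cos (deriv_id t)))) (deriv_cst (v ^+ 2) t)) _.
  by ring.
have h4 := deriv_mul (deriv_mul (deriv_cst (v `^ (x - 1)) t)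
   (deriv_add (deriv_mul (deriv_cst v t) h1) h2)) (deriv_inv (f := fun t => D t v) D0 h3).
by apply: deriv_eq h4 _; field.
Qed.

Let deriv_B (t v : R) : - 2^-1 <= cos t -> 0 < v ->
  is_derive v 1 (fun v => B t v) (- dA t v).
Proof.
move=> ct v0; have D0 := lt0r_neq0 (D_gt0 ct v0); rewrite /B /dA.
have h1 : is_derive v 1 (fun v => D t v) (2 * cos t + 2 * v).
  apply: deriv_eq (deriv_add (deriv_add (deriv_cst 1 v)
    (deriv_mul (deriv_mul (deriv_cst 2 v) (deriv_id v)) (deriv_cst (cos t) v)))
    (deriv_sqr (deriv_id v))) _.
  by ring.
have h2 := deriv_mul (deriv_mul (deriv_powR x v0 (deriv_id v))
   (deriv_add (deriv_cst (cos (w t)) v) (deriv_mul (deriv_id v) (deriv_cst (cos (t - w t)) v))))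
   (deriv_inv D0 h1).
have vx : v `^ x = v * v `^ (x - 1).
  rewrite -{2}(powRr1 (ltW v0)) -powRD; last by rewrite (gt_eqF v0) implybT.
  by congr (_ `^ _); ring.
apply: deriv_eq h2 _; rewrite vx.
move: D0; rewrite /D cosB sinB; move: (v `^ _) (cos (w t)) (sin (w t)) => q c s D0.
have st : sin t ^+ 2 = 1 - cos t ^+ 2 by rewrite -(cos2Dsin2 t); ring.
apply/eqP; rewrite -subr_eq0; apply/eqP.
(* The two sides differ by a multiple of cos^2 + sin^2 - 1; the rest is an identity of rational
   functions. *)
rewrite (_ : _ - _ = q * (2 * v ^+ 2) * c * (cos t ^+ 2 + sin t ^+ 2 - 1) / (1 + 2 * v * cos t + v ^+ 2) ^+ 2).
  by rewrite cos2Dsin2 subrr mulr0 mul0r.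
by field.
Qed.

Let cos_ge (a t : R) : 0 <= a <= pi / 2 -> `|t - a| < 2^-1 -> - 2^-1 <= cos t.
Proof.
move=> /andP[a0 a1] ta.
have ca : 0 <= cos a.
  by apply: cos_ge0_pihalf; rewrite a1 andbT (le_trans _ a0)// oppr_le0 divr_ge0// pi_ge0.
have [z _ e] := mvt_all (fun y => is_derive_cos y) a t.
have : `|cos t - cos a| <= `|t - a|.
  by rewrite e normrM normrN ler_piMl// sin_max.
move=> h; have := le_lt_trans h ta; rewrite ltr_norml => /andP[h1 _].
by rewrite ltrBrDr in h1; apply/ltW/(le_lt_trans _ h1); rewrite lerDl.
Qed.

Let quot_le (t v : R) : - 2^-1 <= cos t -> 0 < v -> (1 + v) / D t v <= 4 / (1 + v).
Proof.
move=> ct v0; have D1 := D_ge ct v0; have D0 := D_gt0 ct v0.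
have v1 : 0 < 1 + v by exact: addr_gt0.
rewrite ler_pdivrMr// mulrAC ler_pdivlMr//.
rewrite ler_pdivrMr// in D1; move: (D t v) D1 => d D1; have := sqr_ge0 (1 - v); nra.
Qed.

Let num_le (v y z : R) : 0 < v -> `|y| <= 1 -> `|z| <= 1 -> `|v * y + z| <= 1 + v.
Proof.
move=> v0 y1 z1; apply: (le_trans (ler_normD _ _)); rewrite addrC lerD//.
by rewrite normrM (gtr0_norm v0) ler_piMr// ltW.
Qed.

Let A_le (t v : R) : - 2^-1 <= cos t -> 0 < v -> `|A t v| <= G v.
Proof.
move=> ct v0; have D0 := D_gt0 ct v0; have v1 : 0 < 1 + v by exact: addr_gt0.
rewrite /A /G !normrM (ger0_norm (powR_ge0 _ _)) normfV (gtr0_norm D0).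
rewrite -!mulrA [leRHS]mulrCA ler_wpM2l ?powR_ge0//.
apply: (@le_trans _ _ ((1 + v) / D t v)).
  rewrite ler_wpM2r ?invr_ge0 ?(ltW D0)//.
  by apply: num_le => //; rewrite ?normrN sin_max.
apply: (le_trans (quot_le ct v0)).
by rewrite ler_wpM2r ?invr_ge0 ?(ltW v1)// ler_nat.
Qed.

Let dA_le (t v : R) : - 2^-1 <= cos t -> 0 < v -> `|dA t v| <= G v.
Proof.
move=> ct v0; have D0 := D_gt0 ct v0; have v1 : 0 < 1 + v by exact: addr_gt0.
rewrite /dA /G normrM (ger0_norm (powR_ge0 _ _)) [leRHS]mulrCA ler_wpM2l ?powR_ge0//.
have h := quot_le ct v0; have D1 := D_ge ct v0.
apply: (@le_trans _ _ (3 * ((1 + v) / D t v))); last first.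
  by apply: (@le_trans _ _ (3 * (4 / (1 + v)))); [rewrite ler_pM2l|rewrite mulrA -natrM].
apply: (le_trans (ler_normD _ _)).
have -> : 3 * ((1 + v) / D t v) = (1 + v) / D t v + 2 * ((1 + v) / D t v) by ring.
apply: lerD.
  rewrite normrM normfV (gtr0_norm D0) ler_wpM2r ?invr_ge0 ?(ltW D0)//.
  rewrite -mulrA; apply: num_le => //.
    rewrite normrM (le_trans (ler_piMr _ (cos_max _)))// gtr0_norm ?subr_gt0//.
    by rewrite gerDl oppr_le0 ltW.
  by rewrite normrN normrM (le_trans (ler_piMr _ (cos_max _)))// gtr0_norm// ltW.
rewrite expr2 invfM.
have -> : (v * sin (t - w t) - sin (w t)) * (2 * v * sin t) * ((D t v)^-1 / D t v) =
   (2 * v / D t v * sin t) * ((v * sin (t - w t) - sin (w t)) / D t v) by ring.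
rewrite normrM; apply: ler_pM => //.
  rewrite normrM (le_trans (ler_piMr _ (sin_max _)))// ger0_norm; last first.
    by rewrite divr_ge0 ?mulr_ge0 ?(ltW D0) ?(ltW v0).
  rewrite ler_pdivrMr//; move: (D t v) D1 => d D1.
  by have := sqr_ge0 (1 - v); nra.
rewrite normrM normfV (gtr0_norm D0) ler_wpM2r ?invr_ge0 ?(ltW D0)//.
by apply: num_le => //; rewrite ?normrN sin_max.
Qed.

Let B_le (t v : R) : - 2^-1 <= cos t -> 0 < v -> `|B t v| <= 4 * (v `^ x / (1 + v)).
Proof.
move=> ct v0; have D0 := D_gt0 ct v0; have v1 : 0 < 1 + v by exact: addr_gt0.
rewrite /B !normrM (ger0_norm (powR_ge0 _ _)) normfV (gtr0_norm D0).
rewrite -!mulrA [leRHS]mulrCA ler_wpM2l ?powR_ge0//.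
apply: (le_trans _ (quot_le ct v0)).
rewrite ler_wpM2r ?invr_ge0 ?(ltW D0)// addrC.
by apply: num_le => //; exact: cos_max.
Qed.

Let contA (t v : R) : - 2^-1 <= cos t -> 0 < v -> {for v, continuous (A t)}.
Proof.
move=> ct v0; apply: (@deriv_continuous _ (A t)); rewrite /A /D; deriv => //.
exact: lt0r_neq0 (D_gt0 ct v0).
Qed.

Let contdA (t v : R) : - 2^-1 <= cos t -> 0 < v -> {for v, continuous (dA t)}.
Proof.
move=> ct v0; have D0 := lt0r_neq0 (D_gt0 ct v0).
have [a n1] : exists a, is_derive v 1 (fun v => v * (1 - x) * cos (t - w t) - x * cos (w t)) a.
  by eexists; deriv.
have [b n2] : exists b, is_derive v 1
    (fun v => (v * sin (t - w t) - sin (w t)) * (2 * v * sin t)) b by eexists; deriv.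
have [c n3] : exists c, is_derive v 1 (fun v => D t v) c by eexists; rewrite /D; deriv.
have D2 : D t v ^+ 2 != 0 by rewrite expf_neq0.
exact: deriv_continuous (deriv_mul (deriv_powR (x - 1) v0 (deriv_id v)) (deriv_add
  (deriv_mul n1 (deriv_inv D0 n3))
  (deriv_mul n2 (deriv_inv (f := fun v => D t v ^+ 2) D2 (deriv_sqr n3))))).
Qed.

Let contG (v : R) : 0 < v -> {for v, continuous G}.
Proof.
move=> v0; have v1 : 1 + v != 0 by rewrite lt0r_neq0// addr_gt0.
exact: deriv_continuous (deriv_mul (deriv_cst 12 v)
  (deriv_mul (deriv_powR (x - 1) v0 (deriv_id v))
    (deriv_inv v1 (deriv_add (deriv_cst 1 v) (deriv_id v))))).
Qed.

Let mP : measurable (P : set (measurableTypeR R)). Proof. exact: measurable_itv. Qed.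

Let measP (f : R -> R) : (forall v : R, 0 < v -> {for v, continuous f}) ->
  measurable_fun (P : set (measurableTypeR R)) f.
Proof.
move=> cf; apply: open_continuous_measurable_fun; first exact: interval_open.
by move=> v; rewrite inE /= in_itv/= andbT; exact: cf.
Qed.

Let IG : (\int[mu]_(v in P) (G v)%:E = (12 * (Gamma x * Gamma (1 - x)))%:E)%E.
Proof.
rewrite EFinM -(beta_Gamma1 x01) -ge0_integralZl_EFin//.
- by move=> v; rewrite /= in_itv/= andbT => v0; rewrite lee_fin divr_ge0 ?powR_ge0// addr_ge0// ltW.
- apply/measurable_EFinP; apply: measP => v v0.
  apply: (@deriv_continuous _ (fun v => v `^ (x - 1) / (1 + v))); deriv => //.
  by rewrite lt0r_neq0// addr_gt0.
Qed.

Let G_ge0 (v : R) : 0 < v -> 0 <= G v.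
Proof. by move=> v0; rewrite /G mulr_ge0// divr_ge0 ?powR_ge0// addr_ge0// ltW. Qed.

Let intG : mu.-integrable P (EFin \o G).
Proof.
apply/integrableP; split; first by apply/measurable_EFinP; apply: measP.
have -> : (\int[mu]_(v in P) `|(EFin \o G) v| = \int[mu]_(v in P) (G v)%:E)%E.
  apply: eq_integral => v.
  by rewrite inE /= in_itv/= andbT => v0; rewrite ger0_norm ?G_ge0.
by rewrite IG ltry.
Qed.

Let int_dom (f : R -> R) : (forall v : R, 0 < v -> {for v, continuous f}) ->
  (forall v : R, 0 < v -> `|f v| <= G v) -> mu.-integrable P (EFin \o f).
Proof.
move=> cf fG; apply: (le_integrable mP _ _ intG).
- by apply/measurable_EFinP; exact: measP.
- move=> v; rewrite /= in_itv/= andbT => v0.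
  by rewrite lee_fin (ger0_norm (G_ge0 v0)) fG.
Qed.

(** The integrand is the derivative of -[B t], which tends to 0 at both ends because 0 < x < 1.
    Adding [G] makes it nonnegative as [improper_FTC0y] requires, and the integral of [G]
    cancels. *)
Let int_dA (t : R) : - 2^-1 <= cos t -> \int[mu]_(v in P) dA t v = 0.
Proof.
move=> ct.
have IdA : mu.-integrable P (EFin \o dA t).
  by apply: int_dom => v v0; [exact: contdA|exact: dA_le].
have limB (F : set_system R) (FF : Filter F) (b : R -> R) :
    (\forall v \near F, 0 < v) -> (forall v, 0 < v -> v `^ x / (1 + v) <= b v) ->
    b v @[v --> F] --> (0 : R) -> - B t v @[v --> F] --> (0 : R).
  move=> F0 hb b0; apply: cvg_opp0.
  have b4 : 4 * b v @[v --> F] --> (0 : R).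
    by rewrite -[X in _ --> X](mulr0 4); apply: cvgM => //; exact: cvg_cst.
  have b4' : - (4 * b v) @[v --> F] --> (0 : R) by exact: cvg_opp0.
  apply: (squeeze_cvgr _ b4' b4).
  near=> v; have v0 : 0 < v by near: v.
  by rewrite -ler_norml (le_trans (B_le ct v0))// ler_pM2l// hb.
have := @improper_FTC0y R (fun v => dA t v + G v) G (fun v => - B t v) 0 0
  (12 * (Gamma x * Gamma (1 - x))).
rewrite subrr addr0 => h.
have {}h : (\int[mu]_(v in P) (dA t v + G v)%:E = (12 * (Gamma x * Gamma (1 - x)))%:E)%E.
  apply: h => //.
  - by move=> v v0; apply: cvgD; [exact: contdA|exact: contG].
  - by move=> v v0; have := dA_le ct v0; rewrite ler_norml => /andP[]; rewrite lerNl; lra.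
  - by move=> v v0; apply: deriv_eq (deriv_opp (deriv_B ct v0)) _; ring.
  - apply: (limB _ _ (fun v => v `^ x)).
    + exact: nbhs_right_gt.
    + by move=> v v0; rewrite ler_pdivrMr ?addr_gt0// ler_peMr ?powR_ge0// lerDl ltW.
    + exact: powR_cvg0.
  - apply: (limB _ _ (fun v => v `^ (- (1 - x)))).
    + by apply: nbhs_pinfty_gt; exact: num_real.
    + move=> v v0; rewrite ler_pdivrMr ?addr_gt0//.
      rewrite mulrDr mulr1 -{4}(powRr1 (ltW v0)) -powRD; last by rewrite (gt_eqF v0) implybT.
      by rewrite (_ : - (1 - x) + 1 = x) ?lerDr ?powR_ge0//; ring.
    + by apply: powRN_cvg0; rewrite subr_gt0.
have : \int[mu]_(v in P) (dA t v + G v) = \int[mu]_(v in P) dA t v + \int[mu]_(v in P) G v.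
  by apply: RintegralD.
by rewrite {1 3}/Rintegral h IG /= => /eqP; rewrite -subr_eq subrr => /eqP.
Unshelve. all: by end_near. Qed.

Let intNG : mu.-integrable P (EFin \o (fun v => `|G v|)).
Proof.
apply: (le_integrable mP _ _ intG); last by move=> v _ /=; rewrite lee_fin normr_id.
apply/measurable_EFinP; apply: measurableT_comp => //.
by have /integrableP[/measurable_EFinP] := intG.
Qed.

Let Phi (t : R) : R := \int[mu]_(v in P) A t v.

Let intA (t : R) : - 2^-1 <= cos t -> mu.-integrable P (EFin \o A t).
Proof. by move=> ct; apply: int_dom => v v0; [exact: contA|exact: A_le]. Qed.

(** Within distance 1/2 of [a] the cosine stays above -1/2, so [G] dominates the partial derivative
    uniformly; the integral of [dA] is then 0. *)
Let deriv_Phi (a : R) : 0 <= a <= pi / 2 -> is_derive a 1 Phi 0.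
Proof.
move=> ha; pose I : set R := `]a - 2^-1, a + 2^-1[%classic.
have Ia : I a by rewrite /I /= in_itv/= ltrBlDr ltrDl invr_gt0 ltr0n andbb.
have cI t : I t -> - 2^-1 <= cos t.
  rewrite /I /= in_itv/= => /andP[h1 h2]; apply: (cos_ge ha).
  by rewrite ltr_norml ltrBrDl h1/= ltrBlDl.
have d1 (t v : R) : I t -> P v -> is_derive t 1 (fun t => A t v) (dA t v).
  by move=> /cI ct; rewrite /= in_itv/= andbT; exact: deriv_A.
have p1 (t v : R) : I t -> P v -> partial1of2 A t v = dA t v.
  by move=> It Pv; rewrite partial1of2E; have [_ ->] := d1 t v It Pv.
have i1 (t : R) : I t -> mu.-integrable P (EFin \o A t) by move=> /cI; exact: intA.
have d2 (t v : R) : I t -> P v -> derivable (A^~ v) t 1.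
  by move=> It Pv; have [] := d1 t v It Pv.
have b1 (t v : R) : I t -> P v -> `|partial1of2 A t v| <= `|G v|.
  move=> It Pv; rewrite p1//; move: Pv; rewrite /= in_itv/= andbT => v0.
  by rewrite (ger0_norm (G_ge0 v0)); apply: dA_le => //; exact: cI.
have G0 v : 0 <= `|G v| by [].
apply: DeriveDef.
  exact: (derivable_under_integral mP Ia i1 d2 G0 intNG b1).
rewrite -derive1E /Phi (differentiation_under_integral mP Ia i1 d2 G0 intNG b1).
rewrite -[RHS](int_dA (cI a Ia)); apply: eq_Rintegral => v /set_mem Pv; exact: p1.
Qed.

(** [Phi] is constant on [0, pi / 2]. At t = 0 it is sin(x pi / 2) times the integral of v^(x-1) /
    (1 + v). At t = pi / 2 the phase [w] vanishes, leaving v^x / (1 + v^2), and u = v^2 turns twice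
    its integral into the beta integral at (x + 1) / 2. *)
Lemma Gamma_duplication :
  2 * sin (x * (pi / 2)) * (Gamma x * Gamma (1 - x)) =
  Gamma ((x + 1) / 2) * Gamma ((1 - x) / 2).
Proof.
have pi2 : (0 : R) < pi / 2 by rewrite divr_gt0 ?pi_gt0.
have E : Phi (pi / 2) = Phi 0.
  have dP t : t \in `]0, pi / 2[ -> is_derive t 1 Phi 0.
    by rewrite in_itv/= => /andP[h1 h2]; apply: deriv_Phi; rewrite !ltW.
  have cP : {within `[0, pi / 2], continuous Phi}.
    apply: continuous_in_subspaceT => t; rewrite inE /= in_itv/= => h.
    exact: deriv_continuous (deriv_Phi h).
  have [c _] := MVT pi2 dP cP.
  by rewrite mul0r => /eqP; rewrite subr_eq0 => /eqP.
have P0 : Phi 0 = sin (x * (pi / 2)) * (Gamma x * Gamma (1 - x)).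
  have int1 : mu.-integrable P (EFin \o (fun v => v `^ (x - 1) / (1 + v))).
    apply: int_dom => v v0.
      have v1 : 1 + v != 0 by rewrite lt0r_neq0// addr_gt0.
      exact: deriv_continuous (deriv_mul (deriv_powR (x - 1) v0 (deriv_id v))
        (deriv_inv v1 (deriv_add (deriv_cst 1 v) (deriv_id v)))).
    rewrite ger0_norm; last by rewrite divr_ge0 ?powR_ge0// addr_ge0// ltW.
    by rewrite /G ler_peMl// ?ler1n// divr_ge0 ?powR_ge0// addr_ge0// ltW.
  rewrite -[Gamma x * _]/(fine (Gamma x * Gamma (1 - x))%:E) -(beta_Gamma1 x01).
  rewrite -RintegralZl//; apply: eq_Rintegral => v; rewrite inE /= in_itv/= andbT => v0.
  have v1 : 1 + v != 0 by rewrite lt0r_neq0// addr_gt0.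
  rewrite /A /D /w cos0 !sub0r mulrN opprK sinN; move: (v `^ _) (sin _) => q s.
  have v2 : 1 + 2 * v * 1 + v ^+ 2 != 0.
    by rewrite (_ : _ + _ = (1 + v) ^+ 2) ?expf_neq0//; ring.
  by rewrite mulr1 in v2; field; rewrite v1.
pose g (u : R) : R := u `^ ((x + 1) / 2 - 1) / (1 + u).
have h0 : 0 < (x + 1) / 2 < 1 by move: x0 x1; lra.
have Ig : (\int[mu]_(v in `]0%R, +oo[) (g (v ^+ 2) * (2 * v))%:E =
    (Gamma ((x + 1) / 2) * Gamma ((1 - x) / 2))%:E)%E.
  rewrite -ge0_integral_sqr /g.
  - by rewrite (beta_Gamma1 h0); congr (_ * Gamma _)%:E; field.
  - move=> v v0; have v1 : 1 + v != 0 by rewrite lt0r_neq0// addr_gt0.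
    exact: deriv_continuous (deriv_mul (deriv_powR ((x + 1) / 2 - 1) v0 (deriv_id v))
        (deriv_inv v1 (deriv_add (deriv_cst 1 v) (deriv_id v)))).
  - by move=> v v0; rewrite divr_ge0 ?powR_ge0// addr_ge0// ltW.
rewrite -[RHS]/(fine (_)%:E) -Ig -mulrA -P0 -E /Phi.
rewrite -RintegralZl//; last by apply: intA; rewrite cos_pihalf oppr_le0 invr_ge0.
apply: eq_Rintegral => v; rewrite inE /= in_itv/= andbT => v0.
rewrite /A /D /w /g subrr mulr0 subr0 sin0 subr0 sin_pihalf cos_pihalf mulr0 addr0 mulr1.
have -> : (v ^+ 2) `^ ((x + 1) / 2 - 1) = v `^ (x - 1).
  rewrite -powR_mulrn ?(ltW v0)// -powRrM; congr (_ `^ _); by field.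
have v2 : 1 + v ^+ 2 != 0 by rewrite lt0r_neq0// ltr_pwDl// sqr_ge0.
by field.
Qed.

End rotation.

(** For 0 < b < 1/2 the duplication at 1 - 2b reads 2 cos(pi b) Gamma(1-2b) Gamma(2b) = Gamma(1-b)
    Gamma(b). Multiplying by b and using the functional equation gives a form that is even in b and
    holds at 0. *)
Lemma cos_Gamma (a : R) : - 2^-1 < a < 2^-1 ->
  cos (pi * a) * Gamma (1 - 2 * a) * Gamma (1 + 2 * a) = Gamma (1 - a) * Gamma (1 + a).
Proof.
have pos (b : R) : 0 < b < 2^-1 ->
    cos (pi * b) * Gamma (1 - 2 * b) * Gamma (1 + 2 * b) = Gamma (1 - b) * Gamma (1 + b).
  move=> hb; have := hb => /andP[b0 b1]; have b2 : 0 < 2 * b by rewrite mulr_gt0.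
  have x01 : 0 < 1 - 2 * b < 1 by lra.
  have := Gamma_duplication x01.
  rewrite (_ : (1 - 2 * b) * (pi / 2) = - (pi * b - pi / 2)); last by field.
  rewrite sinN sinBpihalf opprK (_ : 1 - (1 - 2 * b) = 2 * b); last by ring.
  rewrite (_ : (1 - 2 * b + 1) / 2 = 1 - b); last by field.
  rewrite (_ : 2 * b / 2 = b); last by field.
  rewrite [1 + 2 * b]addrC [1 + b]addrC (GammaS b2) (GammaS b0) => e.
  transitivity (b * (2 * cos (pi * b) * (Gamma (1 - 2 * b) * Gamma (2 * b)))); first by ring.
  by rewrite e mulrCA.
move=> /andP[a0 a1]; have [->|a_neq0] := eqVneq a 0.
  by rewrite !mulr0 subr0 addr0 cos0 Gamma1 !mulr1.
have [a_gt|a_le] := ltP 0 a; first by apply: pos; rewrite a_gt.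
have /pos : 0 < - a < 2^-1 by rewrite oppr_gt0 lt_neqAle a_neq0 a_le/= ltrNl.
rewrite !mulrN cosN !opprK mulrAC => ->; exact: mulrC.
Qed.

End reflection.

(** * The norm of the kernel *)

Section kernel_norm.
Variable R : realType.
Local Notation mu := (@lebesgue_measure R).

Lemma powR_incr_le (b u : R) : b <= 2 -> 1 <= u ->
  `|(1 + u) `^ b - u `^ b| <= 2 * `|b| * u `^ (b - 1).
Proof.
move=> b2 u1; have u0 : 0 < u by exact: lt_le_trans u1.
have dp (z : R) : z \in `]u, 1 + u[ -> is_derive z 1 (fun z => z `^ b) (b * z `^ (b - 1)).
  rewrite in_itv/= => /andP[z0 _]; apply: deriv_eq (deriv_powR b (lt_trans u0 z0) (deriv_id z)) _.
  by rewrite mulr1.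
have cp : {within `[u, 1 + u], continuous (fun z : R => z `^ b)}.
  apply: continuous_in_subspaceT => z; rewrite inE /= in_itv/= => /andP[z0 _].
  exact: deriv_continuous (deriv_powR b (lt_le_trans u0 z0) (deriv_id z)).
have uu : u < 1 + u by rewrite ltrDr.
have [z + ->] := MVT uu dp cp; rewrite in_itv/= => /andP[z1 z2].
have z0 : 0 < z by exact: lt_trans z1.
rewrite addrK mulr1 normrM (ger0_norm (powR_ge0 _ _)) (mulrC 2) -mulrA ler_wpM2l//.
(* The intermediate point lies in [u, 2u] as u >= 1. A nonnegative exponent b - 1 is at most 1, so
   the doubling costs at most a factor 2; a negative exponent costs nothing. *)
have [c0|c0] := leP 0 (b - 1).
  apply: (@le_trans _ _ ((2 * u) `^ (b - 1))).
    apply: ge0_ler_powR; rewrite ?nnegrE ?(ltW z0) ?mulr_ge0 ?(ltW u0)//.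
    by apply: (le_trans (ltW z2)); rewrite mulr_natl mulr2n lerD2r.
  rewrite powRM ?(ltW u0)// ler_wpM2r ?powR_ge0//.
  rewrite -[leRHS]powRr1//; apply: ler_powR; first by rewrite ler1n.
  by rewrite lerBlDr; move: b2; rewrite -natr1.
apply: (@le_trans _ _ (u `^ (b - 1))); last first.
  by rewrite ler_peMl ?powR_ge0// ler1n.
rewrite -(opprK (b - 1)) !(powRN _ (- _)) lef_pV2 ?posrE ?powR_gt0//.
by apply: ge0_ler_powR; rewrite ?nnegrE ?(ltW z0) ?(ltW u0) ?(ltW z1)// oppr_ge0 ltW.
Qed.

Variable a : R.
Hypothesis ha : - 2^-1 < a < 2^-1.
Let a_gt : - 2^-1 < a. Proof. by case/andP: ha. Qed.
Let a_lt : a < 2^-1. Proof. by case/andP: ha. Qed.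

Let f1 (u : R) : R := (2 * a + 1) * ((1 + u) `^ a - u `^ a) ^+ 2.
Let f2 (u : R) : R := (1 - a) * (u `^ a * (1 + u) `^ (a - 2)).
(* [F u] is u ((1+u)^a - u^a)^2 + (1+u)^(2a) - u^(a+1) (1+u)^(a-1), expanded
   so that every term but the first tends to 0 at 0. *)
Let F (u : R) : R := (1 + u) `^ (2 * a + 1) - 2 * (u `^ (a + 1) * (1 + u) `^ a)
  + u `^ (2 * a + 1) - u `^ (a + 1) * (1 + u) `^ (a - 1).

Let exps (u : R) : 0 < u -> [/\ u `^ (a + 1) = u `^ a * u,
  u `^ (2 * a) = u `^ a ^+ 2 & u `^ (2 * a + 1) = u `^ a ^+ 2 * u].
Proof.
move=> u0; have u1 : u != 0 by exact: lt0r_neq0.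
have h2 : u `^ (2 * a) = u `^ a ^+ 2.
  by rewrite (_ : 2 * a = a + a) ?powRD ?u1 ?implybT//; ring.
by split => //; rewrite powRD ?u1 ?implybT// powRr1 ?(ltW u0)// h2.
Qed.

Let expsp (p : R) : 0 < p -> [/\ p `^ a = p `^ (a - 2) * p ^+ 2, p `^ (a - 1) = p `^ (a - 2) * p,
  p `^ (2 * a) = (p `^ (a - 2)) ^+ 2 * p ^+ 4 & p `^ (2 * a + 1) = (p `^ (a - 2)) ^+ 2 * p ^+ 5].
Proof.
move=> p0; have p1 : p != 0 by exact: lt0r_neq0.
have h1 : p `^ a = p `^ (a - 2) * p ^+ 2.
  by rewrite -powR_mulrn ?(ltW p0)// -powRD ?p1 ?implybT// subrK.
have [_ h2 h3] := exps p0; split => //.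
- rewrite (_ : a - 1 = a - 2 + 1) ?powRD ?p1 ?implybT// ?powRr1 ?(ltW p0)//; ring.
- by rewrite h2 h1; ring.
- by rewrite h3 h1; ring.
Qed.

Let deriv_F (u : R) : 0 < u -> is_derive u 1 F (f1 u - f2 u).
Proof.
move=> u0; have p0 : 0 < 1 + u by exact: addr_gt0.
have du (b : R) : is_derive u 1 (fun u => u `^ b) (b * u `^ (b - 1)).
  by apply: deriv_eq (deriv_powR b u0 (deriv_id u)) _; rewrite mulr1.
have dp (b : R) : is_derive u 1 (fun u => (1 + u) `^ b) (b * (1 + u) `^ (b - 1)).
  by apply: deriv_eq (deriv_powR b p0 (deriv_add (deriv_cst 1 u) (deriv_id u))) _;
    rewrite add0r mulr1.
apply: deriv_eq (deriv_add (deriv_add (deriv_add (dp (2 * a + 1))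
  (deriv_opp (deriv_mul (deriv_cst 2 u) (deriv_mul (du (a + 1)) (dp a))))) (du (2 * a + 1)))
  (deriv_opp (deriv_mul (du (a + 1)) (dp (a - 1))))) _.
have [e1 e2 e3] := exps u0; have [e4 e5 e6 e7] := expsp p0.
rewrite /f1 /f2 !addrK (_ : a - 1 - 1 = a - 2); last by ring.
rewrite e1 e2 e4 e5 e6; move: (u `^ a) ((1 + u) `^ (a - 2)) => r s.
by ring.
Qed.

Let cvgF0 : F u @[u --> 0^'+] --> (1 : R).
Proof.
have p1 (b : R) : (1 + u) `^ b @[u --> 0^'+] --> (1 : R).
  have e : (1 + 0) `^ b = 1 :> R by rewrite addr0 powR1.
  rewrite -[X in _ --> X]e; apply: cvg_at_right_filter.
  have p0 : (0 : R) < 1 + 0 by rewrite addr0.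
  exact: deriv_continuous (deriv_powR b p0 (deriv_add (deriv_cst 1 0) (deriv_id 0))).
have h1 : 0 < a + 1 by move: a_gt; lra.
have h2 : 0 < 2 * a + 1 by move: a_gt; lra.
have e : 1 = 1 - 2 * (0 * 1) + 0 - 0 * 1 :> R by ring.
rewrite [X in _ --> X]e; apply: cvgB; last by apply: cvgM; [exact: (powR_cvg0 h1)|exact: p1].
apply: cvgD; last exact: (powR_cvg0 h2).
apply: cvgB; first exact: p1.
apply: cvgM; first exact: cvg_cst.
by apply: cvgM; [exact: (powR_cvg0 h1)|exact: p1].
Qed.

Let cvgFy : F u @[u --> +oo] --> (0 : R).
Proof.
pose c : R := 4 * `|a| ^+ 2 + 2 * `|a + 1|.
have lim : c * u `^ (- (1 - 2 * a)) @[u --> +oo] --> (0 : R).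
  rewrite -[X in _ --> X](mulr0 c); apply: cvgM; first exact: cvg_cst.
  by apply: powRN_cvg0; move: a_lt; lra.
have lim' : - (c * u `^ (- (1 - 2 * a))) @[u --> +oo] --> (0 : R) by exact: cvg_opp0.
apply: (squeeze_cvgr _ lim' lim); near=> u; rewrite -ler_norml.
have u1 : 1 <= u by near: u; exact: nbhs_pinfty_ge.
have u0 : 0 < u by exact: lt_le_trans u1.
have un : u != 0 by exact: lt0r_neq0.
have p0 : 0 < 1 + u by exact: addr_gt0.
(* The first power in [F] diverges at infinity. Regrouped, only increments of powers over [u, 1 + u]
   appear, each one order smaller than the power itself, and everything is O(u^(2a - 1)). *)
have -> : F u = u * ((1 + u) `^ a - u `^ a) ^+ 2 +
    (1 + u) `^ (a - 1) * ((1 + u) `^ (a + 1) - u `^ (a + 1)).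
  have [e1 e2 e3] := exps u0; have [e4 e5 e6 e7] := expsp p0; have [e8 _ _] := exps p0.
  rewrite /F e7 e8 e1 e3 e5 e4; move: (u `^ a) ((1 + u) `^ (a - 2)) => r s.
  by ring.
have i1 := @powR_incr_le a u (le_trans (ltW a_lt) _) u1.
have i2 := @powR_incr_le (a + 1) u _ u1.
have h1 : (2^-1 : R) <= 2.
  by apply: (@le_trans _ _ 1); [rewrite invf_le1 ?ler1n|rewrite ler1n].
have {}i1 := i1 h1; have {i2} := i2; rewrite addrK => i2.
have h2 : a + 1 <= 2 by move: a_lt; lra.
have {i2} := i2 h2; move: h1 h2 => _ _ i2.
rewrite [c * _]mulrDl; apply: (le_trans (ler_normD _ _)); apply: lerD.
  rewrite normrM (gtr0_norm u0) normrX.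
  apply: (@le_trans _ _ (u * (2 * `|a| * u `^ (a - 1)) ^+ 2)).
    by rewrite ler_wpM2l ?(ltW u0)// ler_sqr ?nnegrE ?mulr_ge0 ?powR_ge0.
  rewrite (_ : - (1 - 2 * a) = 1 + (a - 1) + (a - 1)); last by ring.
  rewrite !powRD ?un ?implybT// powRr1 ?(ltW u0)//.
  by rewrite le_eqVlt; apply/orP; left; apply/eqP; ring.
rewrite normrM (ger0_norm (powR_ge0 _ _)).
apply: (@le_trans _ _ (u `^ (a - 1) * (2 * `|a + 1| * u `^ a))).
  apply: ler_pM; rewrite ?powR_ge0//.
  rewrite -(opprK (a - 1)) !(powRN _ (- _)) lef_pV2 ?posrE ?powR_gt0//.
  apply: ge0_ler_powR; rewrite ?nnegrE ?(ltW p0) ?(ltW u0) ?lerDr//.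
  by move: a_lt; lra.
rewrite (_ : - (1 - 2 * a) = a + (a - 1)); last by ring.
rewrite !powRD ?un ?implybT//.
by rewrite le_eqVlt; apply/orP; left; apply/eqP; ring.
Unshelve. all: by end_near. Qed.

(** The squared L^2 norm of the kernel at time 1, with a = H - 1/2. *)
Definition kernel_cst : R := Gamma (1 + a) * Gamma (1 - 2 * a) / ((2 * a + 1) * Gamma (1 - a)).

(** The integral of [f2] is a beta integral with parameters a + 1 and 1 - 2a. The boundary value 1
    of [F] at 0 produces the subtracted term, which [integral_powR01] will compensate. *)
Lemma integral_powR_incr : (\int[mu]_(u in `]0%R, +oo[) (((1 + u) `^ a - u `^ a) ^+ 2)%:E =
  (kernel_cst - (2 * a + 1)^-1)%:E)%E.
Proof.
have h1 : 0 < a + 1 by move: a_gt; lra.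
have h2 : 0 < 1 - 2 * a by move: a_lt; lra.
have h3 : 0 < 2 * a + 1 by move: a_gt; lra.
have h4 : 0 < 1 - a by move: a_lt; lra.
have bt := beta_Gamma h1 h2; rewrite addrK in bt.
have I2 : (\int[mu]_(u in `]0%R, +oo[) (f2 u)%:E =
    ((1 - a) * (Gamma (a + 1) * Gamma (1 - 2 * a) / Gamma (a + 1 + (1 - 2 * a))))%:E)%E.
  rewrite EFinM -bt -ge0_integralZl_EFin ?(ltW h4)//.
  - by apply: eq_integral => u _; rewrite /f2 EFinM; congr (_ * (_ * _ `^ _)%:E)%E; ring.
  - by move=> u _; rewrite lee_fin mulr_ge0 ?powR_ge0.
  - apply/measurable_EFinP; apply: measurable_funTS; apply: measurable_funM; first exact: measurable_powR.
    apply: (@measurableT_comp _ _ _ _ _ _ (fun t => t `^ _)) => //.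
    by apply: measurable_funD.
have c1 (u : R) : 0 < u -> {for u, continuous f1}.
  move=> u0; have p0 : 0 < 1 + u by exact: addr_gt0.
  exact: deriv_continuous (deriv_mul (deriv_cst _ u) (deriv_sqr (deriv_add
    (deriv_powR a p0 (deriv_add (deriv_cst 1 u) (deriv_id u)))
    (deriv_opp (deriv_powR a u0 (deriv_id u)))))).
have c2 (u : R) : 0 < u -> {for u, continuous f2}.
  move=> u0; have p0 : 0 < 1 + u by exact: addr_gt0.
  exact: deriv_continuous (deriv_mul (deriv_cst _ u) (deriv_mul (deriv_powR a u0 (deriv_id u))
    (deriv_powR (a - 2) p0 (deriv_add (deriv_cst 1 u) (deriv_id u))))).
have := improper_FTC0y c1 c2 (F := F) _ _ deriv_F cvgF0 cvgFy I2.
have p1 (u : R) : 0 < u -> 0 <= f1 u by move=> _; rewrite /f1 mulr_ge0 ?sqr_ge0 ?ltW.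
have p2 (u : R) : 0 < u -> 0 <= f2 u by move=> _; rewrite /f2 !mulr_ge0 ?powR_ge0 ?ltW.
move=> /(_ p1 p2); rewrite /f1.
under eq_integral do rewrite EFinM.
rewrite ge0_integralZl_EFin ?(ltW h3)//; last 2 first.
- by move=> u _; rewrite lee_fin sqr_ge0.
- apply/measurable_EFinP; apply: measurable_funTS; apply: measurable_funX; apply: measurable_funB.
    apply: (@measurableT_comp _ _ _ _ _ _ (fun t => t `^ _)) => //.
    by apply: measurable_funD.
  exact: measurable_powR.
have h3n := lt0r_neq0 h3.
set J := (X in ((_ * X)%E = _ -> _)) => e.
transitivity ((2 * a + 1)^-1%:E * ((2 * a + 1)%:E * J))%E.
  by rewrite muleA -EFinM mulVf// mul1e.
rewrite e -EFinM; congr EFin.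
rewrite /kernel_cst (_ : a + 1 + (1 - 2 * a) = 1 - a + 1); last by ring.
rewrite (GammaS h4) [1 + a]addrC; field.
by rewrite h3n lt0r_neq0 ?Gamma_gt0// lt0r_neq0.
Qed.

Lemma integral_powR01 : (\int[mu]_(v in `]0%R, 1%R]) (v `^ (2 * a))%:E = ((2 * a + 1)^-1)%:E)%E.
Proof.
have h3 : 0 < 2 * a + 1 by move: a_gt; lra.
have h3n := lt0r_neq0 h3.
pose u (n : nat) : R := n.+2%:R^-1.
have uE : \bigcup_n (`[u n, 1]%classic : set R) = `]0, 1]%classic.
  apply/seteqP; split=> v /=.
    move=> [n _]; rewrite /= !in_itv/= => /andP[+ ->]; rewrite andbT; apply: lt_le_trans.
    by rewrite invr_gt0 ltr0n.
  rewrite in_itv/= => /andP[v0 v1].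
  have : (\bigcup_n (`[n.+2%:R^-1, n.+2%:R]%classic : set R)) v.
    by rewrite pos_bigcup /= in_itv/= v0.
  by move=> [n _]; rewrite /= in_itv/= => /andP[v2 _]; exists n => //=; rewrite in_itv/= v2.
have pos v : (\bigcup_n (`[u n, 1]%classic : set R)) v -> 0 < v.
  by rewrite uE /= in_itv/= => /andP[].
have dF (v : R) : 0 < v -> is_derive v 1 (fun v : R => (2 * a + 1)^-1 * v `^ (2 * a + 1)) (v `^ (2 * a) - 0).
  move=> v0; apply: deriv_eq (deriv_mul (deriv_cst _ v) (deriv_powR (2 * a + 1) v0 (deriv_id v))) _.
  by rewrite addrK mulr1 mulr0 addr0 mulrA mulVf// mul1r subr0.
have := @improper_FTC R u (fun=> 1) (fun v => v `^ (2 * a)) (fun=> 0)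
  (fun v => (2 * a + 1)^-1 * v `^ (2 * a + 1)) 0 (2 * a + 1)^-1 0.
rewrite subr0 add0r /= uE; apply.
- by move=> m n mn; rewrite /u lef_pV2 ?posrE ?ltr0n// ler_nat.
- by [].
- by move=> n; rewrite /u invf_lt1 ?ltr0n// ltr1n.
- by move=> v; rewrite /= in_itv/= => /andP[v0 _]; exact: deriv_continuous (deriv_powR _ v0 (deriv_id v)).
- by move=> v _; exact: cvg_cst.
- by move=> v _; exact: powR_ge0.
- by [].
- by move=> v; rewrite /= in_itv/= => /andP[v0 _]; exact: dF.
- rewrite -[X in _ --> X](mulr0 (2 * a + 1)^-1); apply: cvgM; first exact: cvg_cst.
  move/cvg_at_rightP : (powR_cvg0 h3); apply; split=> [n|]; first by rewrite /u invr_gt0 ltr0n.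
  have := @cvg_harmonic R; rewrite -(cvg_shiftS (@harmonic R)); exact.
- by rewrite powR1 mulr1; exact: cvg_cst.
- by rewrite integral0_eq.
Qed.

End kernel_norm.

Section kernel.
Variables (R : realType) (H : R).
Hypothesis hH : 0 < H < 1.
Local Notation mu := (@lebesgue_measure R).
Local Notation a := (H - 2^-1).
Local Notation K := (fGBm_kernel H).
Implicit Types s t u : R.

Let ha : - 2^-1 < a < 2^-1.
Proof.
move: hH => /andP[h0 h1]; apply/andP; split; first by rewrite ltrBrDr addNr.
by rewrite ltrBlDr (_ : 2^-1 + 2^-1 = 1) //; field.
Qed.

Lemma measurable_fGBm_kernel t : measurable_fun [set: measurableTypeR R] (K t).
Proof.
apply: measurable_funB.
  apply: (@measurableT_comp _ _ _ _ _ _ (fun u => pos_pow u a)); first exact: measurable_pos_pow.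
  exact: measurable_funB.
apply: (@measurableT_comp _ _ _ _ _ _ (fun u => pos_pow u a)) => //.
exact: measurable_pos_pow.
Qed.

Let msqr (f : R -> R) : measurable_fun [set: measurableTypeR R] f ->
  measurable_fun [set: measurableTypeR R] (fun u => (f u ^+ 2)%:E).
Proof. by move=> mf; apply/measurable_EFinP; exact: measurable_funX. Qed.

Let sqr_pos (f : R -> R) u : (0 <= (f u ^+ 2)%:E)%E.
Proof. by rewrite lee_fin sqr_ge0. Qed.

(** After u is replaced by -u, the kernel is (1 + u)^a - u^a for u > 0 and (1 + u)^a on ]-1, 0]; the
    latter piece is translated to ]0, 1]. *)
Let kernel_int1 : (\int[mu]_u (K 1 u ^+ 2)%:E = (kernel_cst a)%:E)%E.
Proof.
pose g u := (((1 + u) `^ a - u `^ a) ^+ 2)%:E.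
pose h v := (v `^ (2 * a))%:E.
have mg : measurable_fun [set: measurableTypeR R] g.
  apply: msqr; apply: measurable_funB; last exact: measurable_powR.
  by apply: (@measurableT_comp _ _ _ _ _ _ (fun t => t `^ _)) => //; apply: measurable_funD.
have mh : measurable_fun [set: measurableTypeR R] h.
  by apply/measurable_EFinP; exact: measurable_powR.
have mh01 : measurable_fun [set: measurableTypeR R] (h \_ `]0, 1]).
  by apply/(measurable_restrictT _ _).1 => //; exact: measurable_funTS.
have mgy : measurable_fun [set: measurableTypeR R] (g \_ `]0, +oo[).
  by apply/(measurable_restrictT _ _).1 => //; exact: measurable_funTS.
have h0 v : (0 <= (h \_ `]0%R, 1%R]) v)%E.
  by apply: erestrict_ge0 => w _; rewrite lee_fin powR_ge0.
have g0 v : (0 <= (g \_ `]0%R, +oo[) v)%E by apply: erestrict_ge0 => w _; exact: sqr_pos.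
rewrite -(ge0_integral_opp (msqr (measurable_fGBm_kernel 1)))//.
transitivity (\int[mu]_u ((g \_ `]0%R, +oo[) u + (h \_ `]0%R, 1%R]) (1 * u + 1)%R))%E.
  apply: eq_integral => u _; rewrite /fGBm_kernel !opprK mul1r [u + 1]addrC !patchE !mem_setE !in_itv/= andbT.
  rewrite gerDl /pos_pow -[point]/(0%E : \bar R); have [u0|u0] := ltP 0 u.
    by rewrite addr_gt0// andbF adde0.
  rewrite andbT add0e subr0; case: ifP => _; last by rewrite expr0n.
  by rewrite /h -powR_mulrn ?powR_ge0// -powRrM mulrC.
rewrite ge0_integralD//; last first.
  by apply: measurableT_comp => //; apply: measurable_funD => //; exact: measurable_funM.
rewrite -integral_mkcond integral_powR_incr//.
have := ge0_integral_affine 1 ltr01 mh01 h0; rewrite mul1e => ->.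
by rewrite -integral_mkcond integral_powR01// -EFinD subrK.
Qed.

(** A difference of two kernels is a translate of a kernel, which is the source of the stationarity
    of increments. *)
Lemma fGBm_kernel_diff s t u : K s u - K t u = K (s - t) (u - t).
Proof.
rewrite /fGBm_kernel (_ : s - t - (u - t) = s - u); last by ring.
by rewrite (opprB u t); ring.
Qed.

Lemma fGBm_kernel0 u : K 0 u = 0.
Proof. by rewrite /fGBm_kernel sub0r subrr. Qed.

Lemma fGBm_kernel_int t : (\int[mu]_u (K t u ^+ 2)%:E = (`|t| `^ (2 * H) * kernel_cst a)%:E)%E.
Proof.
have pos s : 0 < s -> (\int[mu]_u (K s u ^+ 2)%:E = (s `^ (2 * H) * kernel_cst a)%:E)%E.
  move=> s0; rewrite -(ge0_integral_affine 0 s0 (msqr (measurable_fGBm_kernel s)))//.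
  have E u : (K s (s * u + 0) ^+ 2)%:E = ((s `^ a ^+ 2)%:E * (K 1 u ^+ 2)%:E)%E.
    rewrite -EFinM addr0 /fGBm_kernel -mulrN -{1}(mulr1 s) -mulrDr !pos_powM// -mulrBr.
    by rewrite exprMn.
  under eq_integral do rewrite E.
  rewrite ge0_integralZl_EFin ?sqr_ge0//; last by apply: msqr; exact: measurable_fGBm_kernel.
  rewrite kernel_int1 -!EFinM mulrA; congr (_ * _)%:E.
  rewrite -powR_mulrn ?powR_ge0// -powRrM -{1}(powRr1 (ltW s0)) -powRD; last first.
    by rewrite (gt_eqF s0) implybT.
  by congr (_ `^ _); field.
have [t0|t0|<-] := ltgtP 0 t.
- by rewrite gtr0_norm// pos.
- rewrite (ltr0_norm t0) -(pos (- t)); last by rewrite oppr_gt0.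
  rewrite -[RHS](ge0_integral_affine (- t) ltr01 (msqr (measurable_fGBm_kernel (- t))))// mul1e.
  apply: eq_integral => u _; congr EFin.
  (* As the kernel at time 0 vanishes, the one at a negative time is, up to sign, a translate of the
     one at the opposite time. *)
  have := fGBm_kernel_diff 0 t u; rewrite fGBm_kernel0 !sub0r mul1r => <-.
  by rewrite sqrrN.
- rewrite normr0 powR0 ?mul0r; last by rewrite mulf_neq0// gt_eqF//; case/andP: hH.
  by rewrite integral0_eq// => u _; rewrite fGBm_kernel0 expr0n.
Qed.

Lemma fGBm_kernel_diff_int s t :
  (\int[mu]_u ((K s u - K t u) ^+ 2)%:E = (`|s - t| `^ (2 * H) * kernel_cst a)%:E)%E.
Proof.
rewrite -fGBm_kernel_int.
rewrite -[RHS](ge0_integral_affine (- t) ltr01 (msqr (measurable_fGBm_kernel (s - t))))// mul1e.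
by apply: eq_integral => u _; rewrite mul1r fGBm_kernel_diff.
Qed.

Lemma fGBm_kernel_continuous t u : u != 0 -> u != t -> {for u, continuous (K t)}.
Proof.
have cp (x : R) : x != 0 -> {for x, continuous (fun x => pos_pow x a)}.
  rewrite neq_lt => /orP[x0|x0].
    have : {near x, (fun=> 0) =1 (fun y : R => pos_pow y a)}.
      near=> y; rewrite pos_pow_le0// ltW//; near: y; exact: lt_nbhsl.
    move/near_eq_cvg/cvg_trans; rewrite /prop_for /continuous_at (pos_pow_le0 _ (ltW x0)); apply.
    exact: cvg_cst.
  have : {near x, (fun y => y `^ a) =1 (fun y : R => pos_pow y a)}.
    near=> y; rewrite pos_powE//; near: y; exact: lt_nbhsr.
  move/near_eq_cvg/cvg_trans; rewrite /prop_for /continuous_at pos_powE//; apply.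
  exact: deriv_continuous (deriv_powR a x0 (deriv_id x)).
move=> u0 ut; apply: cvgB.
  apply: (@continuous_comp _ _ _ (fun u => t - u) (fun x => pos_pow x a)).
    by apply: cvgB; [exact: cvg_cst|exact: cvg_id].
  by apply: cp; rewrite subr_eq0 eq_sym.
apply: (@continuous_comp _ _ _ (fun u => - u) (fun x => pos_pow x a)).
  by apply: cvgN; exact: cvg_id.
by apply: cp; rewrite oppr_eq0.
Unshelve. all: by end_near. Qed.

(** For u >= 0 the second power is absent. For u < 0 both kernels compare a power at r - u with the
    same power at the smaller point -u, so their sign depends only on the sign of the exponent. *)
Lemma fGBm_kernel_sign s t u : 0 <= s -> 0 <= t -> 0 <= K s u * K t u.
Proof.
move=> s0 t0; have [u0|u0] := leP 0 u.
  by rewrite /fGBm_kernel ![pos_pow (- u) _]pos_pow_le0 ?oppr_le0// !subr0 mulr_ge0 ?pos_pow_ge0.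
have u1 : 0 < - u by rewrite oppr_gt0.
have h r : 0 <= r -> - u <= r - u /\ 0 < r - u.
  by move=> r0; split; [rewrite lerDr|rewrite ltr_wpDl].
have [a0|a0] := leP 0 a.
  have k r : 0 <= r -> 0 <= K r u.
    move=> /h[r1 r2]; rewrite /fGBm_kernel !pos_powE// subr_ge0.
    by apply: ge0_ler_powR; rewrite ?nnegrE ?(ltW u1) ?(ltW r2).
  by rewrite mulr_ge0 ?k.
have k r : 0 <= r -> K r u <= 0.
  move=> /h[r1 r2]; rewrite /fGBm_kernel !pos_powE// subr_le0.
  rewrite -(opprK a) !(powRN _ (- a)) lef_pV2 ?posrE ?powR_gt0//.
  by apply: ge0_ler_powR; rewrite ?nnegrE ?(ltW u1) ?(ltW r2) ?oppr_ge0 ?(ltW a0).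
by rewrite mulr_le0 ?k.
Qed.

Lemma kernel_cst_gt0 : 0 < kernel_cst a.
Proof.
have /andP[h1 h2] := ha.
rewrite /kernel_cst divr_gt0// mulr_gt0 ?Gamma_gt0//; lra.
Qed.

(** With 2H = 1 + 2a and sin(pi H) = cos(pi a), this is [cos_Gamma]. *)
Lemma fGBm_const_kernel : fGBm_const H ^+ 2 * kernel_cst a = 1.
Proof.
have /andP[h1 h2] := ha; have := cos_Gamma ha; rewrite /fGBm_const /kernel_cst.
have H0 : 0 < 2 * H by rewrite mulr_gt0//; case/andP: hH.
have s0 : 0 <= 2 * H * sin (pi * H) * Gamma (2 * H).
  rewrite mulr_ge0 ?(ltW (Gamma_gt0 _))// mulr_ge0 ?(ltW H0)//; apply: sin_ge0_pi.
  move: hH => /andP[h3 h4]; rewrite mulr_ge0 ?pi_ge0 ?(ltW h3)//=.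
  by rewrite ler_piMr ?pi_ge0// ltW.
rewrite expr_div_n sqr_sqrtr// (_ : 2 * a + 1 = 2 * H); last by field.
rewrite (_ : 1 + 2 * a = 2 * H); last by field.
rewrite (_ : H + 2^-1 = 1 + a); last by field.
rewrite (_ : pi * a = pi * H - pi / 2); last by ring.
rewrite cosBpihalf => e.
have g1 : 0 < Gamma (1 + a) by apply: Gamma_gt0; move: h1; lra.
have g2 : 0 < Gamma (1 - a) by apply: Gamma_gt0; move: h2; lra.
have H0n := lt0r_neq0 H0; have H1 : H != 0 by rewrite lt0r_neq0//; case/andP: hH.
transitivity (sin (pi * H) * Gamma (1 - 2 * a) * Gamma (2 * H) / (Gamma (1 - a) * Gamma (1 + a))).
  move: g1 g2 => /lt0r_neq0 + /lt0r_neq0.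
  move: (Gamma (1 + a)) (Gamma (1 - a)) (Gamma (1 - 2 * a)) (Gamma (2 * H)) (sin _) => x y z w r x0 y0.
  by field; rewrite x0 y0.
by rewrite e mulfV// mulf_neq0// lt0r_neq0.
Qed.

Lemma fGBm_kernel_norm t :
  ('N[mu]_2%:E[EFin \o K t] = (Num.sqrt (`|t| `^ (2 * H) * kernel_cst a))%:E)%E.
Proof.
apply: Lnorm2E; last exact: fGBm_kernel_int.
by rewrite mulr_ge0 ?powR_ge0// ltW// kernel_cst_gt0.
Qed.

Lemma fGBm_kernel_norm_diff s t :
  ('N[mu]_2%:E[EFin \o (K s \- K t)%R] = (Num.sqrt (`|s - t| `^ (2 * H) * kernel_cst a))%:E)%E.
Proof.
apply: Lnorm2E; last exact: fGBm_kernel_diff_int.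
by rewrite mulr_ge0 ?powR_ge0// ltW// kernel_cst_gt0.
Qed.

Lemma fGBm_kernel_Lfun t : (K t : measurableTypeR R -> R) \in Lfun mu 2%:E.
Proof.
rewrite inE; apply/andP; split; rewrite inE /=; first exact: measurable_fGBm_kernel.
by rewrite /finite_norm fGBm_kernel_norm ltry.
Qed.

End kernel.

Local Opaque Gnorm LG_dist.

(** * Integrals of deterministic functions *)

Section approximation.
Variable R : realType.
Local Notation mu := (@lebesgue_measure R).
Local Notation N2 h := ('N[mu]_2%:E[EFin \o h])%E.

Lemma clamp_mul_ge0 (n x y : R) : 0 <= n -> 0 <= x * y -> 0 <= clamp n x * clamp n y.
Proof.
move=> n0; rewrite le_eqVlt => /predU1P[/esym/eqP|xy].
  have c0 z : z = 0 -> clamp n z = 0.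
    by move=> ->; have := clamp_le 0 n0; rewrite normr0 normr_le0 => /eqP.
  by rewrite mulf_eq0 => /orP[]/eqP/c0 ->; rewrite ?mul0r ?mulr0.
by rewrite -(pmulr_lge0 _ xy) mulrACA mulr_ge0// clamp_same_sign.
Qed.

Lemma Lnorm2_near (f g : R -> R) (a b e : R) :
  measurable_fun [set: measurableTypeR R] f -> measurable_fun [set: measurableTypeR R] g ->
  (N2 f = a%:E)%E -> (N2 g = b%:E)%E -> (N2 (f \- g)%R < e%:E)%E -> `|a - b| < e.
Proof.
move=> mf mg fa gb fge.
have sub0 (h : R -> R) : (h \- (fun=> 0))%R = h by apply/funext => x /=; rewrite subr0.
have m0 : measurable_fun [set: measurableTypeR R] (fun=> 0 : R) by exact: measurable_cst.
have h1 := Lnorm2_triangle mf mg m0; have h2 := Lnorm2_triangle mg mf m0.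
rewrite !sub0 fa gb in h1 h2; rewrite (Lnorm2_dist g f) in h2.
move: fge h1 h2; case: (N2 (f \- g)%R) => [r| |] //.
rewrite -!EFinD !lee_fin lte_fin => re h1 h2.
by apply: le_lt_trans re; rewrite ler_norml lerNl opprB !lerBlDr h1 h2.
Qed.

(** Both functions must be sampled on the same grid, so that the signs of the coefficients can be
    compared cell by cell; hence the maxima of the thresholds. *)
Lemma grid_step_cvg (f g : R -> R) :
  (forall h, h = f \/ h = g -> [/\ measurable_fun [set: measurableTypeR R] h,
    (\int[mu]_x ((h x ^+ 2)%:E) < +oo)%E &
    exists p q, forall x, x != p -> x != q -> {for x, continuous h}]) ->
  exists N k : nat -> nat, forall n h, h = f \/ h = g ->
    (N2 (step_fun (grid_step (N n) (k n) h) \- h)%R < (n.+1%:R^-1)%:E)%E.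
Proof.
move=> hyp.
have P n : exists Nk : nat * nat, forall h, h = f \/ h = g ->
    (N2 (step_fun (grid_step Nk.1 Nk.2 h) \- h)%R < (n.+1%:R^-1)%:E)%E.
  have e0 : 0 < n.+1%:R^-1 :> R by rewrite invr_gt0.
  have [mf f2 [p1 [q1 cf]]] := hyp f (or_introl erefl).
  have [mg g2 [p2 [q2 cg]]] := hyp g (or_intror erefl).
  have [M1 H1] := grid_step_dense mf f2 cf e0.
  have [M2 H2] := grid_step_dense mg g2 cg e0.
  have [K1 {}H1] := H1 (maxn M1 M2) (leq_maxl _ _).
  have [K2 {}H2] := H2 (maxn M1 M2) (leq_maxr _ _).
  exists (maxn M1 M2, maxn K1 K2) => h [->|->] /=.
    by apply: H1; exact: leq_maxl.
  by apply: H2; exact: leq_maxr.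
have [Nk HNk] := choice P.
by exists (fun n => (Nk n).1), (fun n => (Nk n).2) => n h; exact: HNk.
Qed.

Lemma inv_lt (e : R) : 0 < e -> exists M, forall n, (M <= n)%N -> n.+1%:R^-1 < e.
Proof.
move=> e0; have [M hM] := archi_div 1 (divr_gt0 e0 (ltr0n _ 2)).
exists M => n Mn; apply: (@le_lt_trans _ _ M.+1%:R^-1).
  by rewrite lef_pV2 ?posrE ?ltr0n// ler_nat.
rewrite mul1r in hM; apply: (le_lt_trans hM).
by move: e0; lra.
Qed.

Lemma plip_cvg (f : R -> R) (u : nat -> R) (l : R) : plip f ->
  u n @[n --> \oo] --> l -> f (u n) @[n --> \oo] --> f l.
Proof.
move=> [C [k [C0 hf]]] /cvgrPdist_lt ul; apply/cvgrPdist_lt => e e0.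
pose K := C * ((1 + `|l|) * (1 + (1 + `|l|))) ^+ k.
have K0 : 0 <= K by rewrite mulr_ge0// exprn_ge0// mulr_ge0// addr_ge0// addr_ge0.
have K1 : 0 < K + 1 by rewrite ltr_wpDl.
near=> n.
have h1 : `|l - u n| < 1 by near: n; exact: ul.
have h2 : `|l - u n| < e / (K + 1) by near: n; apply: ul; rewrite divr_gt0.
have hu : `|u n| <= 1 + `|l|.
  have := ler_normB l (l - u n); rewrite opprB addrC subrK => h.
  by apply: (le_trans h); rewrite addrC lerD2r ltW.
apply: (le_lt_trans (hf _ _)); apply: (@le_lt_trans _ _ (K * `|l - u n|)).
  rewrite ler_wpM2r// ler_wpM2l// lerXn2r ?nnegrE ?mulr_ge0 ?addr_ge0//.
  by rewrite ler_wpM2l ?addr_ge0// lerD2l.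
rewrite ltr_pdivlMr// mulrC in h2; apply: le_lt_trans h2.
by rewrite ler_wpM2r// lerDl.
Unshelve. all: by end_near. Qed.

End approximation.

Section G_integral.
Variables (R : realType) (S : sublinear R) (slo shi : R) (B : R -> S -> R).
Hypothesis GB : two_sided_G_brownian slo shi B.
Hypothesis hs : 0 <= slo <= shi.
Local Notation mu := (@lebesgue_measure R).
Local Notation N2 h := ('N[mu]_2%:E[EFin \o h])%E.
Local Notation E := (sl_E S).
Local Notation "\I f" := (step_integral B f) (at level 10).

Let shi0 : 0 <= shi. Proof. by case/andP: hs; exact: le_trans. Qed.

Let HI h : sl_H S (\I h). Proof. exact: H_step GB h. Qed.

Section with_f.
Variable f : R -> R.
Hypothesis mf : measurable_fun [set: measurableTypeR R] f.

Lemma step_integral_near (g h : step R) (d e : R) :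
  (N2 (step_fun g \- f)%R < d%:E)%E -> (N2 (step_fun h \- f)%R < e%:E)%E ->
  Gnorm 2 (fun w => \I g w - \I h w) <= shi * (d + e).
Proof.
move=> gd he.
have [S0 [X0 [Xb0 [HX0 HXb0 ic0 GX0 [Xvhi Xvlo]]]]] := brownian_realization GB.
have [r r0 [-> nr]] := step_isometry GB hs HX0 HXb0 ic0 GX0 Xvhi Xvlo g h.
apply: ler_wpM2l => //; rewrite -lee_fin -nr.
apply: (le_trans (Lnorm2_triangle (measurable_step_fun g) mf (measurable_step_fun h))).
by rewrite (EFinD d e) (Lnorm2_dist f); apply: leeD; exact: ltW.
Qed.

(** [is_G_integral] provides only some approximating sequence. By the isometry any other L^2
    approximation has integrals with the same limit, so the grid approximations may be used
    instead. *)
Lemma step_integral_cvg (X : LG S 2) (h : nat -> step R) : is_G_integral B f X ->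
  (forall e : R, 0 < e -> exists M, forall n, (M <= n)%N ->
     (N2 (step_fun (h n) \- f)%R < e%:E)%E) ->
  LG_cvg (fun n => \I (h n)) X.
Proof.
move=> [_ [g [gf gX]]] hf.
apply: (LG_cvg_close (@Gnorm2_triangle R S) _ _ gX) => [n|n|e e0]; try exact: HI.
have s1 : 0 < shi + 1 by rewrite ltr_wpDl.
pose d := e / 2 / (shi + 1).
have d0 : 0 < d by rewrite !divr_gt0.
have [M HM] := hf d d0; have [M' HM'] := ecvg0_lt gf d0.
exists M => n Mn; exists M' => m Mm.
apply: (le_trans (step_integral_near (HM n Mn) (HM' m Mm))).
have -> : shi * (d + d) = shi / (shi + 1) * e by rewrite /d; field; exact: lt0r_neq0.
by rewrite ler_piMl ?(ltW e0)// ler_pdivrMr// mul1r lerDl.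
Qed.

Lemma G_integral_exists (h : nat -> step R) : (f : measurableTypeR R -> R) \in Lfun mu 2%:E ->
  (forall n, (N2 (step_fun (h n) \- f)%R < (n.+1%:R^-1)%:E)%E) ->
  exists X : LG S 2, is_G_integral B f X.
Proof.
move=> Lf hf.
have small (e : R) : 0 < e -> exists M, forall n, (M <= n)%N ->
    (N2 (step_fun (h n) \- f)%R < e%:E)%E.
  move=> /inv_lt[M HM]; exists M => n Mn; apply: (lt_trans (hf n)).
  by rewrite lte_fin HM.
have cauchy (e : R) : 0 < e -> exists N : nat, forall j k : nat,
    (N <= j)%N -> (N <= k)%N -> Gnorm 2 (fun w => \I (h j) w - \I (h k) w) < e.
  move=> e0; have s1 : 0 < shi + 1 by rewrite ltr_wpDl.
  pose d := e / 2 / (shi + 1).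
  have d0 : 0 < d by rewrite !divr_gt0.
  have [M HM] := small d d0; exists M => j k Mj Mk.
  apply: (le_lt_trans (step_integral_near (HM j Mj) (HM k Mk))).
  have -> : shi * (d + d) = shi / (shi + 1) * e by rewrite /d; field; exact: lt0r_neq0.
  by rewrite gtr_pMl// ltr_pdivrMr// mul1r ltrDl.
pose X := @MkLG R S 2 (fun n => \I (h n)) (fun n => HI (h n)) cauchy.
have hX := LG_cvg_self (@Gnorm2_triangle R S) X.
exists X; split; first exact: Lf.
exists h; split; last by exact hX.
apply: (@squeeze_cvge _ _ _ _ (fun=> 0%E) _ (fun n => (n.+1%:R^-1)%:E)).
- by near=> n; rewrite Lnorm_ge0/= ltW.
- exact: cvg_cst.
- by apply: cvg_EFin; [exact: nearW|exact: cvg_harmonic].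
Unshelve. all: by end_near. Qed.

End with_f.

Section with_realization.
Variables (S0 : sublinear R) (X0 Xb0 : S0 -> R).
Hypotheses (HX0 : sl_H S0 X0) (HXb0 : sl_H S0 Xb0) (ic0 : independent_copy X0 Xb0).
Hypothesis GX0 : forall a b : R, 0 <= a -> 0 <= b ->
        same_distr (law1 (fun w => a * X0 w + b * Xb0 w))
                   (law1 (fun w => Num.sqrt (a ^+ 2 + b ^+ 2) * X0 w)).
Hypotheses (Xvhi : sl_E S0 (fun t => X0 t ^+ 2) = shi ^+ 2)
  (Xvlo : sl_E S0 (fun t => - X0 t ^+ 2) = - slo ^+ 2).

(** The integral has the law of a multiple of [X0], with a factor within 1 of [c]. The resulting
    bound does not depend on [h], as [LG_expect_lim] requires of the moments. *)
Lemma step_moment (f : R -> R) (h : step R) (C c : R) m :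
  measurable_fun [set: measurableTypeR R] f -> (N2 f = c%:E)%E ->
  (N2 (step_fun h \- f)%R < 1%:E)%E ->
  E (fun w => `|C * \I h w| ^+ m) <=
    (`|C| * (1 + `|c|)) ^+ m * sl_E S0 (fun w => `|X0 w| ^+ m).
Proof.
move=> mf fc hf; have [d d0 [hd nd]] := step_law GB HX0 HXb0 ic0 GX0 Xvhi Xvlo h.
rewrite (has_law_norm HX0 m (has_law_scale C hd)).
apply: ler_wpM2r.
  by apply: E_ge0 => [|w]; [exact: H_exp (H_norm HX0)|exact: exprn_ge0].
have := Lnorm2_near (measurable_step_fun h) mf nd fc hf => dc.
apply: lerXn2r; rewrite ?nnegrE ?mulr_ge0 ?addr_ge0//.
rewrite normrM ler_wpM2l//.
have := ler_normD (d - c) c; rewrite subrK => h1.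
by apply: (le_trans h1); rewrite lerD2r ltW.
Qed.

(** Along the approximations the law is that of [C * d n] times [X0], with [d n] tending to [c]. The
    expectation of a test function depends continuously on the factor, being itself a test function
    of it. *)
Lemma G_integral_law (f : R -> R) (X : LG S 2) (h : nat -> step R) (C c : R) :
  measurable_fun [set: measurableTypeR R] f -> (N2 f = c%:E)%E ->
  is_G_integral B f X ->
  (forall n, (N2 (step_fun (h n) \- f)%R < (n.+1%:R^-1)%:E)%E) ->
  LG_has_law (fun _ : 'I_1 => scaleL2 C X) (fun phi => law1 X0 (fun x => phi ((C * c) *: x))).
Proof.
move=> mf fc fX hf phi Cphi; have pphi := C_lLip_plip Cphi.
have small (e : R) : 0 < e -> exists M, forall n, (M <= n)%N ->
    (N2 (step_fun (h n) \- f)%R < e%:E)%E.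
  move=> /inv_lt[M HM]; exists M => n Mn; apply: (lt_trans (hf n)).
  by rewrite lte_fin HM.
have hX := step_integral_cvg mf fX small.
pose psi (x : R) := phi (const_mx x).
have ppsi : plip psi by exact: plip_comp pphi (@plip_const_mx R).
have P n : exists d, has_law X0 (\I (h n)) d /\ (N2 (step_fun (h n)) = d%:E)%E.
  by have [d _ hd] := step_law GB HX0 HXb0 ic0 GX0 Xvhi Xvlo (h n); exists d.
have [d Hd] := choice P.
have dc : d n @[n --> \oo] --> c.
  apply/cvgrPdist_lt => e e0; have [M HM] := small e e0.
  exists M => // n /= Mn; rewrite distrC.
  exact: Lnorm2_near (measurable_step_fun (h n)) mf (Hd n).2 fc (HM n Mn).
have HZ k (i : 'I_1) : sl_H S (fun w => C * \I (h k) w) by exact/sl_H_scale/HI.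
apply: (LG_expect_lim HZ _ _ pphi).
- by move=> _; apply: LG_cvg_scale hX => n; exact: HI.
- move=> m; eexists => k _; apply: (step_moment C m mf fc).
  by apply: (lt_le_trans (hf k)); rewrite lee_fin invf_le1 ?ler1n ?ltr0n.
have pg : plip (fun x => sl_E S0 (fun w => psi (x * X0 w))).
  have pf : plip (fun z : R * 'rV[R]_1 => psi (z.1 * z.2 0 0)).
    apply: (plip_comp ppsi); apply: plip_mul; first exact: plip_fst.
    exact: (plip_comp (@plip_coord _ _ _ _ _) (@plip_snd _ _ _)).
  have := plip_E (Y := fun _ : 'I_1 => X0) (fun=> HX0) (f := fun x y => psi (x * y 0 0)) pf.
  by under eq_fun do under eq_fun do rewrite mxE.
have -> : law1 X0 (fun x => phi ((C * c) *: x)) = sl_E S0 (fun w => psi (C * c * X0 w)).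
  by rewrite /law1 /law; under eq_fun do rewrite vec1 scalemx_const.
have -> : (fun k => E (fun w => phi (vec (fun _ : 'I_1 => fun w => C * \I (h k) w) w))) =
    (fun k => sl_E S0 (fun w => psi (C * d k * X0 w))).
  apply/funext => k; rewrite -(has_law_scale C (Hd k).1 ppsi).
  by under eq_fun do rewrite vec1.
apply: (plip_cvg pg (u := fun k => C * d k)).
by apply: cvgM; [exact: cvg_cst|exact: dc].
Qed.

End with_realization.

End G_integral.

(** * Covariances of integrals *)

Section covariance.
Variables (R : realType) (S : sublinear R) (slo shi : R) (B : R -> S -> R).
Hypothesis GB : two_sided_G_brownian slo shi B.
Hypothesis hs : 0 <= slo <= shi.
Local Notation mu := (@lebesgue_measure R).
Local Notation N2 h := ('N[mu]_2%:E[EFin \o h])%E.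
Local Notation "\I f" := (step_integral B f) (at level 10).

Let lohi : slo ^+ 2 <= shi ^+ 2.
Proof.
case/andP: hs => s0 ss; apply: lerXn2r; rewrite ?nnegrE//; exact: le_trans ss.
Qed.

Variables (f g : R -> R) (a b e : R).
Hypotheses (mf : measurable_fun [set: measurableTypeR R] f)
  (mg : measurable_fun [set: measurableTypeR R] g).
Hypotheses (fa : (N2 f = a%:E)%E) (gb : (N2 g = b%:E)%E) (fge : (N2 (f \- g)%R = e%:E)%E).
Hypothesis fg0 : forall u, 0 <= f u * g u.
Variables (X Y : LG S 2) (N k : nat -> nat).
Hypotheses (fX : is_G_integral B f X) (gY : is_G_integral B g Y).
Let hf n := grid_step (N n) (k n) f.
Let hg n := grid_step (N n) (k n) g.
Hypotheses (hfE : forall n, (N2 (step_fun (hf n) \- f)%R < (n.+1%:R^-1)%:E)%E)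
  (hgE : forall n, (N2 (step_fun (hg n) \- g)%R < (n.+1%:R^-1)%:E)%E).

(** The grid depends only on [N n] and [k n], so it is shared with [hg n]; the coefficients [al] and
    [be] are clamped samples of [f] and [g] at the same points, and their products stay
    nonnegative. *)
Let m n := step_n (hf n).
Let t n := step_t (hf n).
Let al n := step_a (hf n).
Let be n := step_a (hg n).
Let s n := \sum_(i < m n) al n i * be n i * (t n i.+1 - t n i).

Let t_homo n : {homo t n : i j / (i <= j)%N >-> i <= j}.
Proof.
by move=> i j ij; rewrite /t /= lerD2l ler_pM2r ?invr_gt0 ?ltr0n// ler_nat.
Qed.

Let al_be n i : 0 <= al n i * be n i.
Proof. exact: clamp_mul_ge0. Qed.

Let sq (c : nat -> R) n := \sum_(i < m n) c i ^+ 2 * (t n i.+1 - t n i).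

Let sq_ge0 c n : 0 <= sq c n.
Proof. by apply: sumr_ge0 => i _; rewrite mulr_ge0 ?sqr_ge0// subr_ge0; exact: t_homo. Qed.

(** Only the norms of [f], [g] and their difference are known, so the scalar product is written
    through squared norms. *)
Let sE n : s n = 2^-1 * (sq (al n) n + sq (be n) n - sq (fun i => al n i - be n i) n).
Proof.
rewrite /s /sq -big_split -sumrB big_distrr /=; apply: eq_bigr => i _.
by move: (t n _ - t n _) => d; field.
Qed.

Let sq_cvg (u : nat -> nat -> R) (c d : R) : 
  (forall n, `|Num.sqrt (sq (u n) n) - c| < d * n.+1%:R^-1) -> 0 < d ->
  sq (u n) n @[n --> \oo] --> c ^+ 2.
Proof.
move=> h d0.
have hc : Num.sqrt (sq (u n) n) @[n --> \oo] --> c.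
  apply/cvgrPdist_lt => r r0; have [M HM] := inv_lt (divr_gt0 r0 d0).
  exists M => // n /= Mn; rewrite distrC; apply: (lt_trans (h n)).
  by have := HM n Mn; rewrite ltr_pdivlMr// mulrC.
rewrite (_ : (fun n => _) = (fun n => Num.sqrt (sq (u n) n) ^+ 2)).
  by rewrite expr2; under eq_fun do rewrite expr2; exact: cvgM.
by apply/funext => n; rewrite sqr_sqrtr.
Qed.

Let s_cvg : s n @[n --> \oo] --> 2^-1 * (a ^+ 2 + b ^+ 2 - e ^+ 2).
Proof.
under eq_fun do rewrite sE.
have fE n : step_fun (hf n) = fun x => sum_incr (m n) (t n) (al n) (fun t => (x <= t)%R%:R).
  by apply/funext => x; rewrite step_funE.
have gE n : step_fun (hg n) = fun x => sum_incr (m n) (t n) (be n) (fun t => (x <= t)%R%:R).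
  by apply/funext => x; rewrite step_funE.
have fgE n : (step_fun (hf n) \- step_fun (hg n))%R =
    fun x => sum_incr (m n) (t n) (fun i => al n i - be n i) (fun t => (x <= t)%R%:R).
  apply/funext => x; rewrite fE gE /sum_incr /= -sumrB.
  by apply: eq_bigr => i _; rewrite mulrBl.
apply: cvgM; first exact: cvg_cst.
apply: cvgB; first apply: cvgD.
- apply: (@sq_cvg al a 1) => // n; rewrite mul1r.
  apply: (Lnorm2_near (measurable_step_fun (hf n)) mf _ fa (hfE n)).
  by rewrite fE; exact: Lnorm2_grid.
- apply: (@sq_cvg be b 1) => // n; rewrite mul1r.
  apply: (Lnorm2_near (measurable_step_fun (hg n)) mg _ gb (hgE n)).
  by rewrite gE; exact: Lnorm2_grid.
(* The triangle inequality through [f] minus the approximation of [g] adds the two errors, hence the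
   factor 2. *)
- apply: (@sq_cvg (fun n i => al n i - be n i) e 2) => // n.
  have m1 : measurable_fun [set: measurableTypeR R] (step_fun (hf n) \- step_fun (hg n))%R.
    by apply: measurable_funB; exact: measurable_step_fun.
  have m2 : measurable_fun [set: measurableTypeR R] (f \- step_fun (hg n))%R.
    by apply: measurable_funB => //; exact: measurable_step_fun.
  have m3 : measurable_fun [set: measurableTypeR R] (f \- g)%R by exact: measurable_funB.
  apply: (Lnorm2_near m1 m3 _ fge); first by rewrite fgE; exact: Lnorm2_grid.
  apply: (le_lt_trans (Lnorm2_triangle m1 m2 m3)).
  have -> : ((step_fun (hf n) \- step_fun (hg n)) \- (f \- step_fun (hg n)))%R =
      (step_fun (hf n) \- f)%R by apply/funext => x /=; ring.
  have -> : ((f \- step_fun (hg n)) \- (f \- g))%R = (g \- step_fun (hg n))%R.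
    by apply/funext => x /=; ring.
  rewrite (Lnorm2_dist g) mulr_natl mulr2n (EFinD n.+1%:R^-1).
  by apply: lteD; [exact: hfE|exact: hgE].
Qed.

Lemma G_integral_cov (C : R) :
  let c := C ^+ 2 * (2^-1 * (a ^+ 2 + b ^+ 2 - e ^+ 2)) in
  LG_expect (pairL2 (scaleL2 C X) (scaleL2 C Y)) (fun x => x 0 0 * x 0 1) (shi ^+ 2 * c) /\
  LG_expect (pairL2 (scaleL2 C X) (scaleL2 C Y)) (fun x => - (x 0 0 * x 0 1)) (- (slo ^+ 2 * c)).
Proof.
move=> c.
have [S0 [X0 [Xb0 [HX0 HXb0 ic0 GX0 [Xvhi Xvlo]]]]] := brownian_realization GB.
have small h (u : nat -> step R) :
    (forall n, (N2 (step_fun (u n) \- h)%R < (n.+1%:R^-1)%:E)%E) ->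
    forall r : R, 0 < r -> exists M, forall n, (M <= n)%N -> (N2 (step_fun (u n) \- h)%R < r%:E)%E.
  move=> hu r /inv_lt[M HM]; exists M => n Mn; apply: (lt_trans (hu n)).
  by rewrite lte_fin HM.
have HI h : sl_H S (\I h) by exact: H_step GB h.
pose Z n (i : 'I_2) : S -> R := if i == 0 then fun w => C * \I (hf n) w else fun w => C * \I (hg n) w.
have HZ n i : sl_H S (Z n i) by rewrite /Z; case: ifP => _; exact/sl_H_scale/HI.
have cX := step_integral_cvg GB hs mf fX (small _ _ hfE).
have cY := step_integral_cvg GB hs mg gY (small _ _ hgE).
have cZ i : LG_cvg (fun n => Z n i) (pairL2 (scaleL2 C X) (scaleL2 C Y) i).
  rewrite /Z /pairL2; case: ifP => _.
    by have h := LG_cvg_scale C (fun n => HI (hf n)) cX; exact h.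
  by have h := LG_cvg_scale C (fun n => HI (hg n)) cY; exact h.
have mom p : exists M : R, forall n i, sl_E S (fun w => `|Z n i w| ^+ p) <= M.
  have le1 n : ((n.+1%:R^-1)%:E <= 1%:E :> \bar R)%E by rewrite lee_fin invf_le1 ?ler1n ?ltr0n.
  have m1 n := step_moment GB HX0 HXb0 ic0 GX0 Xvhi Xvlo C p mf fa (lt_le_trans (hfE n) (le1 n)).
  have m2 n := step_moment GB HX0 HXb0 ic0 GX0 Xvhi Xvlo C p mg gb (lt_le_trans (hgE n) (le1 n)).
  move: m1 m2; set M1 := _ * _; set M2 := (X in _ -> (forall n, _ <= X) -> _) => m1 m2.
  exists (Num.max M1 M2) => n i; rewrite le_max /Z; case: ifP => _; first by rewrite m1.
  by rewrite m2 orbT.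
have p0 : plip (fun x : 'rV[R]_2 => x 0 0 * x 0 1).
  by apply: plip_mul; exact: plip_coord.
have [B1 [B2 [G1 G2 ind q1 q2]]] := GB.
have Zv n w : (vec (Z n) w) 0 0 * (vec (Z n) w) 0 1 = C ^+ 2 * (\I (hf n) w * \I (hg n) w).
  by rewrite !mxE /Z /=; ring.
have HP n : sl_H S (fun w => \I (hf n) w * \I (hg n) w) by apply: H_mul; exact: HI.
split.
  apply: (LG_expect_lim HZ cZ mom p0).
  rewrite (_ : (fun n => _) = (fun n => shi ^+ 2 * (C ^+ 2 * s n))).
    by apply: cvgM; [exact: cvg_cst|apply: cvgM; [exact: cvg_cst|exact: s_cvg]].
  apply/funext => n; under eq_fun do rewrite Zv.
  rewrite sl_E_scale ?sqr_ge0// [RHS]mulrCA; congr (_ * _).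
  exact: (sumB_prod HX0 HXb0 ic0 GX0 Xvhi Xvlo lohi G1 G2 ind q1 q2 (m n) (t_homo n) (al_be n)).
apply: (LG_expect_lim HZ cZ mom (plip_opp p0)).
rewrite (_ : (fun n => _) = (fun n => - (slo ^+ 2 * (C ^+ 2 * s n)))).
  by apply: cvgN; apply: cvgM; [exact: cvg_cst|apply: cvgM; [exact: cvg_cst|exact: s_cvg]].
apply/funext => n; under eq_fun do rewrite Zv -mulrN.
rewrite sl_E_scale ?sqr_ge0//; last by apply: H_opp; exact: HP.
rewrite [_ * (C ^+ 2 * _)]mulrCA -mulrN; congr (_ * _).
exact: (sumB_prodN HX0 HXb0 ic0 GX0 Xvhi Xvlo lohi G1 G2 ind q1 q2 (m n) (t_homo n) (al_be n)).
Qed.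

End covariance.

Section fGBm_kernel_approximation.
Variables (R : realType) (H : R).
Hypothesis hH : 0 < H < 1.
Local Notation mu := (@lebesgue_measure R).
Local Notation N2 h := ('N[mu]_2%:E[EFin \o h])%E.
Local Notation K := (fGBm_kernel H).

Lemma fGBm_kernel_grid s t : exists N k : nat -> nat, forall n h, h = K s \/ h = K t ->
  (N2 (step_fun (grid_step (N n) (k n) h) \- h)%R < (n.+1%:R^-1)%:E)%E.
Proof.
have P r : [/\ measurable_fun [set: measurableTypeR R] (K r),
    (\int[mu]_x ((K r x ^+ 2)%:E) < +oo)%E &
    exists p q, forall x, x != p -> x != q -> {for x, continuous (K r)}].
  split; [exact: measurable_fGBm_kernel|by rewrite fGBm_kernel_int// ltry|].
  by exists 0, r => x; exact: fGBm_kernel_continuous.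
apply: grid_step_cvg => h h'; have [->|->] := h'; exact: P.
Qed.

End fGBm_kernel_approximation.

(** The integral is determined only up to equality in L^2_G, so the representation is proved for
    every choice [Y] of the integrals; existence ensures that there is one. *)
Theorem theorem1 (R : realType) (S : sublinear R) (H slo shi : R)
    (B : R -> S -> R)
    (hH : 0 < H < 1) (hsigma : 0 <= slo <= shi)
    (hB : two_sided_G_brownian slo shi B) :
  (exists Y : R -> LG S 2,
     forall t : R, is_G_integral B (fGBm_kernel H t) (Y t)) /\
  (forall Y : R -> LG S 2,
     (forall t : R, is_G_integral B (fGBm_kernel H t) (Y t)) ->
     fGBm H slo shi (fun t : R => scaleL2 (fGBm_const H) (Y t))).
Proof.
have mK t := measurable_fGBm_kernel H t.
have H1 : 0 <= H <= 1 by case/andP: hH => h0 h1; rewrite !ltW.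
split.
  suff P t : exists X : LG S 2, is_G_integral B (fGBm_kernel H t) X.
    by have [Y HY] := choice P; exists Y; exact HY.
  have [N [k HNk]] := fGBm_kernel_grid hH t t.
  apply: (G_integral_exists hB hsigma (mK t) (fGBm_kernel_Lfun hH t)).
  by move=> n; exact: (HNk n _ (or_introl erefl)).
move=> Y HY.
have [S0 [X0 [Xb0 [HX0 HXb0 ic0 GX0 [Xvhi Xvlo]]]]] := brownian_realization hB.
have I0 := kernel_cst_gt0 hH; set I := kernel_cst (H - 2^-1) in I0.
set C := fGBm_const H.
have CI : C ^+ 2 * I = 1 by exact: fGBm_const_kernel.
split.
- move=> t; have [N [k HNk]] := fGBm_kernel_grid hH t t.
  pose c := Num.sqrt (`|t| `^ (2 * H) * I).
  have cE := fGBm_kernel_norm hH t.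
  have law := G_integral_law hB hsigma HX0 HXb0 ic0 GX0 Xvhi Xvlo C (mK t) cE (HY t)
    (fun n => HNk n _ (or_introl erefl)).
  exists (slo * `|C * c|), (shi * `|C * c|); split.
    case/andP: hsigma => s0 ss; rewrite mulr_ge0//= ler_wpM2r//.
  exists (fun phi => law1 X0 (fun x => phi ((C * c) *: x))); first exact law.
  have sqE (x : R) : (x * `|C * c|) ^+ 2 = (C * c) ^+ 2 * x ^+ 2.
    by rewrite exprMn real_normK ?num_real// mulrC.
  rewrite (sqE slo) (sqE shi).
  exact (G_normal_var_scale (C * c) (G_normal_var_X0 HX0 HXb0 ic0 GX0 Xvhi Xvlo)).
(* At time 0 the kernel vanishes, so the empty step function approximates it exactly; its integral
   is 0 and must be the limit. *)
- pose z := @Step R 0%N (fun=> 0) (fun=> 0) (fun i (h : (i < 0)%N) => False_ind _ (Bool.diff_false_true h)).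
  have zI w : step_integral B z w = 0 by rewrite /step_integral big_ord0.
  have cz : LG_cvg (fun=> step_integral B z) (Y 0).
    apply: (step_integral_cvg hB hsigma (mK 0) (HY 0)) => e e0; exists 0%N => n _.
    have -> : (step_fun z \- fGBm_kernel H 0)%R = fun=> 0.
      by apply/funext => u /=; rewrite /step_fun big_ord0 fGBm_kernel0 subr0.
    rewrite (@Lnorm2E _ (fun=> 0) 0)// ?sqrtr0//.
    by rewrite integral0_eq// => u _; rewrite expr0n.
  have HI : sl_H S (step_integral B z) by exact: H_step hB z.
  rewrite /LG_eq; apply/cvg0P => [n|e e0]; first exact: Gnorm_ge0.
  have C1 : 0 < `|C| + 1 by rewrite ltr_wpDl.
  have [M HM] := (LG_cvgP (@Gnorm2_triangle R S) (Y 0) (fun=> HI)).1 cz _ (divr_gt0 e0 C1).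
  have [M' HM'] := LG_dist_lt (@Gnorm2_triangle R S) HI (HM M (leqnn M)).
  exists M' => n Mn; have := HM' n Mn.
  have -> : (fun w => step_integral B z w - Y 0 n w) = (fun w => - Y 0 n w).
    by apply/funext => w; rewrite zI sub0r.
  rewrite Gnorm_opp (ltr_pdivlMr _ _ C1) => h; apply: le_lt_trans h.
  have -> : (fun w => scaleL2 C (Y 0) n w - zeroL2 S n w) = (fun w => C * Y 0 n w).
    by apply/funext => w /=; rewrite subr0.
  rewrite Gnorm2_scale; last exact: LG_H.
  by rewrite mulrC ler_wpM2l ?Gnorm_ge0// lerDl.
- move=> s t s0 t0 c.
  have [N [k HNk]] := fGBm_kernel_grid hH s t.
  have [e1 e2] := G_integral_cov hB hsigma (mK s) (mK t) (fGBm_kernel_norm hH s)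
    (fGBm_kernel_norm hH t) (fGBm_kernel_norm_diff hH s t)
    (fun u => fGBm_kernel_sign H u s0 t0) (HY s) (HY t)
    (fun n => HNk n _ (or_introl erefl)) (fun n => HNk n _ (or_intror erefl)) C.
  (* The squared norms at s, t and s - t are powers with exponent 2H times [I], and C^2 I = 1
     removes the constant. *)
  have cE : C ^+ 2 * (2^-1 * (Num.sqrt (`|s| `^ (2 * H) * I) ^+ 2 +
      Num.sqrt (`|t| `^ (2 * H) * I) ^+ 2 - Num.sqrt (`|s - t| `^ (2 * H) * I) ^+ 2)) = 2^-1 * c.
    have sI (x : R) : Num.sqrt (x `^ (2 * H) * I) ^+ 2 = x `^ (2 * H) * I.
      by rewrite sqr_sqrtr//; apply: mulr_ge0; [exact: powR_ge0|exact: ltW].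
    rewrite !sI /c (distrC t s).
    transitivity (C ^+ 2 * I * (2^-1 * (`|t| `^ (2 * H) + `|s| `^ (2 * H) - `|s - t| `^ (2 * H)))).
      by ring.
    by rewrite CI mul1r.
  rewrite cE in e1 e2; split.
    by rewrite (_ : 2^-1 * shi ^+ 2 * c = shi ^+ 2 * (2^-1 * c)); [exact: e1|ring].
  by exists (- (slo ^+ 2 * (2^-1 * c))); [exact: e2|rewrite opprK; ring].
Qed.
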